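(* Every diagram of type (III, III) is $C^{\infty}$-equivalent to a diagram in the following normal form: $$f_{1}(x_1, y_1)=x_{1}+y_{1},\quad \gamma_{1}(x_1,y_1)=(x_{1}, y_{1}^{2}),$$ $$f_{2}(x_2, y_2)=x_{2}+y_{2}+\theta (x_{2}, y_{2}),\quad \gamma_{2}(x_2,y_2)=(x_{2}^{2}, y_{2}),$$ where $\theta$ is an arbitrary function germ in the maximal ideal $\mathcal{M}_{x_{2}, y_{2}}$ (of the ring of smooth function germs on $(\mathbb{R}^2,0)$ in the variables $(x_2,y_2)$) satisfying $\theta (x_{2}, 0)=\theta (0, y_{2})=0$.
   Context: One considers diagrams of $C^{\infty}$ map germs $(\mathbb{R},0) \xleftarrow{f_1} (\mathbb{R}^{2},0) \xrightarrow{\gamma_1} (\mathbb{R}^2,0) \xleftarrow{\gamma_2} (\mathbb{R}^{2},0) \xrightarrow{f_2} (\mathbb{R},0)$. Two such diagrams $(f_1^{j}, \gamma_1^{j}; f_2^{j}, \gamma_2^{j})$, $j=1,2$, are $C^{\infty}$-equivalent if there exist $C^{\infty}$-diffeomorphism germs $h_i:(\mathbb{R},0)\to(\mathbb{R},0)$, $H_i:(\mathbb{R}^2,0)\to(\mathbb{R}^2,0)$ ($i=1,2$) and $K:(\mathbb{R}^2,0)\to(\mathbb{R}^2,0)$ with $h_i\circ f_i^1 = f_i^2\circ H_i$ and $K\circ\gamma_i^1 = \gamma_i^2\circ H_i$ for $i=1,2$. A pair $(f,\gamma)$, $(\mathbb{R},0)\xleftarrow{f}(\mathbb{R}^2,0)\xrightarrow{\gamma}(\mathbb{R}^2,0)$,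 is of type (III) if $f$ is a submersion, $\gamma$ is a fold, $f$ restricted to the singular set $S_\gamma$ of $\gamma$ is regular, and $(f,\gamma):(\mathbb{R}^2,0)\to(\mathbb{R}^3,0)$ is regular. A diagram is of type (III, III) if $(f_1,\gamma_1)$ and $(f_2,\gamma_2)$ are both of type (III) and the discriminant curves $\gamma_1(S_{\gamma_1})$ and $\gamma_2(S_{\gamma_2})$ are transversal at $0$. *)

(* Defs.v *)
From Stdlib Require Import Reals.
From Coquelicot Require Import Coquelicot.
Open Scope R_scope.

Definition box (r : R) (p : R * R) : Prop := Rabs (fst p) < r /\ Rabs (snd p) < r.

Definition near0_2 (P : R * R -> Prop) : Prop :=
  exists r, 0 < r /\ forall p, box r p -> P p.
Definition near0_1 (P : R -> Prop) : Prop :=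
  exists r, 0 < r /\ forall t, Rabs t < r -> P t.

Definition cont2_on (U : R * R -> Prop) (f : R * R -> R) : Prop :=
  forall p, U p -> forall eps, 0 < eps -> exists d, 0 < d /\
    forall q, Rabs (fst q - fst p) < d -> Rabs (snd q - snd p) < d ->
      Rabs (f q - f p) < eps.

Fixpoint Ck2 (n : nat) (U : R * R -> Prop) (f : R * R -> R) : Prop :=
  cont2_on U f /\
  match n with
  | O => True
  | S m => exists fx fy : R * R -> R,
      (forall p, U p ->
         is_derive (fun t => f (t, snd p)) (fst p) (fx p) /\
         is_derive (fun t => f (fst p, t)) (snd p) (fy p)) /\
      Ck2 m U fx /\ Ck2 m U fy
  end.

Definition smooth2 (f : R * R -> R) : Prop :=
  exists r, 0 < r /\ forall n, Ck2 n (box r) f.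

Definition cont1_on (U : R -> Prop) (f : R -> R) : Prop :=
  forall x, U x -> forall eps, 0 < eps -> exists d, 0 < d /\
    forall y, Rabs (y - x) < d -> Rabs (f y - f x) < eps.

Fixpoint Ck1 (n : nat) (U : R -> Prop) (f : R -> R) : Prop :=
  cont1_on U f /\
  match n with
  | O => True
  | S m => exists f' : R -> R,
      (forall x, U x -> is_derive f x (f' x)) /\ Ck1 m U f'
  end.

Definition smooth1 (f : R -> R) : Prop :=
  exists r, 0 < r /\ forall n, Ck1 n (fun t => Rabs t < r) f.

Definition smooth_map2 (F : R * R -> R * R) : Prop :=
  smooth2 (fun p => fst (F p)) /\ smooth2 (fun p => snd (F p)).

Definition diffeo2 (H : R * R -> R * R) : Prop :=
  smooth_map2 H /\ H (0, 0) = (0, 0) /\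
  exists G : R * R -> R * R, smooth_map2 G /\ G (0, 0) = (0, 0) /\
    near0_2 (fun p => G (H p) = p) /\ near0_2 (fun p => H (G p) = p).

Definition diffeo1 (h : R -> R) : Prop :=
  smooth1 h /\ h 0 = 0 /\
  exists g : R -> R, smooth1 g /\ g 0 = 0 /\
    near0_1 (fun t => g (h t) = t) /\ near0_1 (fun t => h (g t) = t).

Definition fgerm (f : R * R -> R) : Prop := smooth2 f /\ f (0, 0) = 0.
Definition mgerm (F : R * R -> R * R) : Prop := smooth_map2 F /\ F (0, 0) = (0, 0).

Definition d1 (f : R * R -> R) (p : R * R) : R := Derive (fun t => f (t, snd p)) (fst p).
Definition d2 (f : R * R -> R) (p : R * R) : R := Derive (fun t => f (fst p, t)) (snd p).

Definition comp1 (F : R * R -> R * R) (p : R * R) : R := fst (F p).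
Definition comp2 (F : R * R -> R * R) (p : R * R) : R := snd (F p).

Definition jac_det (g : R * R -> R * R) (p : R * R) : R :=
  d1 (comp1 g) p * d2 (comp2 g) p - d2 (comp1 g) p * d1 (comp2 g) p.

Definition sing_set (g : R * R -> R * R) (p : R * R) : Prop := jac_det g p = 0.

Definition fold_nf (p : R * R) : R * R := (fst p, snd p ^ 2).

Definition is_fold (g : R * R -> R * R) : Prop :=
  exists Phi Psi : R * R -> R * R, diffeo2 Phi /\ diffeo2 Psi /\
    near0_2 (fun p => Psi (g p) = fold_nf (Phi p)).

Definition submersion0 (f : R * R -> R) : Prop :=
  d1 f (0, 0) <> 0 \/ d2 f (0, 0) <> 0.

(** Tangent vector at 0 of the (regular) curve S_gamma = {jac_det gamma = 0}. *)
Definition sing_tangent (g : R * R -> R * R) : R * R :=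
  (- d2 (jac_det g) (0, 0), d1 (jac_det g) (0, 0)).

(** f restricted to S_gamma is regular at 0: df(0) does not vanish on T_0 S_gamma. *)
Definition restr_regular (f : R * R -> R) (g : R * R -> R * R) : Prop :=
  d1 f (0, 0) * fst (sing_tangent g) + d2 f (0, 0) * snd (sing_tangent g) <> 0.

Definition pair_regular (f : R * R -> R) (g : R * R -> R * R) : Prop :=
  forall a b : R,
    a * d1 f (0, 0) + b * d2 f (0, 0) = 0 ->
    a * d1 (comp1 g) (0, 0) + b * d2 (comp1 g) (0, 0) = 0 ->
    a * d1 (comp2 g) (0, 0) + b * d2 (comp2 g) (0, 0) = 0 ->
    a = 0 /\ b = 0.

Definition type_III (f : R * R -> R) (g : R * R -> R * R) : Prop :=
  submersion0 f /\ is_fold g /\ restr_regular f g /\ pair_regular f g.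

(** Tangent vector at 0 of the discriminant curve gamma(S_gamma):
    image of the tangent of S_gamma under d gamma(0). *)
Definition disc_tangent (g : R * R -> R * R) : R * R :=
  let v := sing_tangent g in
  (d1 (comp1 g) (0, 0) * fst v + d2 (comp1 g) (0, 0) * snd v,
   d1 (comp2 g) (0, 0) * fst v + d2 (comp2 g) (0, 0) * snd v).

Definition transversal_disc (g1 g2 : R * R -> R * R) : Prop :=
  let u := disc_tangent g1 in let w := disc_tangent g2 in
  fst u * snd w - snd u * fst w <> 0.

Definition type_III_III (f1 : R * R -> R) (g1 : R * R -> R * R)
    (f2 : R * R -> R) (g2 : R * R -> R * R) : Prop :=
  type_III f1 g1 /\ type_III f2 g2 /\ transversal_disc g1 g2.

Definition diagram_equiv
    (f1 : R * R -> R) (g1 : R * R -> R * R) (f2 : R * R -> R) (g2 : R * R -> R * R)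
    (f1' : R * R -> R) (g1' : R * R -> R * R) (f2' : R * R -> R) (g2' : R * R -> R * R)
    : Prop :=
  exists (h1 h2 : R -> R) (H1 H2 K : R * R -> R * R),
    diffeo1 h1 /\ diffeo1 h2 /\ diffeo2 H1 /\ diffeo2 H2 /\ diffeo2 K /\
    near0_2 (fun p => h1 (f1 p) = f1' (H1 p)) /\
    near0_2 (fun p => h2 (f2 p) = f2' (H2 p)) /\
    near0_2 (fun p => K (g1 p) = g1' (H1 p)) /\
    near0_2 (fun p => K (g2 p) = g2' (H2 p)).

(* Main.v *)
(** The second components of the target charts of the two folds are equations of the discriminant
curves, so by transversality they form a chart in which the folds become [(x, y^2)] and [(x^2, y)].
It remains to normalise [F1] and [F2] by diffeomorphisms preserving the two folds. After composing
with a diffeomorphism [h1] of the line, split [F1] into its even and odd parts in [y],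
[h1 o F1 = x A(x, y^2) + y b(x, y^2)] (Whitney), which is possible as soon as [h1 (F1 (0, y))] is odd.
Then [K = (X A, Y b^2)] lifts to both folds, to [H1 = (x A(x, y^2), y b(x, y^2))] and to
[H2 = (+- x sqrt (A (x^2, y)), y b(x^2, y)^2)], and turns [F1] into [x + y]. The remaining freedom is
the odd diffeomorphism [k t = +- t c(t^2)] with [h1 (F1 (0, y)) = k y]. The conditions
[theta (x, 0) = theta (0, y) = 0] determine [h2] in two ways, and equating them gives for [L = ln c]
a functional equation [L = g + (L o tau) / 4] with [tau] vanishing to order 4 at the origin, solved by a
series converging together with all its derivatives. *)
From Stdlib Require Import Reals Ranalysis5 Lra Lia ClassicalEpsilon FunctionalExtensionality.
From Coquelicot Require Import Coquelicot.
Require Import Defs.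
Open Scope R_scope.

(** * Calculus of [Ck2] functions *)

(** The factor 1/4 is a product of two halves. For [theta] to vanish on the axes, [h2 o F2], read in
    the chart [H2], must agree with the coordinate on each of them. On [x = 0] one has
    [H2 (0, v) = (0, v c(v)^2)]; on [y = 0] one has [H2 (u, 0) = (+- u sqrt (A (u^2, 0)), 0)], where
    [A (x, 0)] is a known factor times [c] at a square. Matching points with [F2 (u, 0) = F2 (0, v)]
    and taking logarithms leaves [2 L] on one side and half of [L o tau] on the other. Two obstacles
    shape the analysis. A fold reaches only nonnegative values of its squared coordinate, whereas
    [K] must be smooth on a full neighbourhood, so [A] and [b] have to be continued smoothly through
    zero; Seeley's reflection does this by one explicit series whose derivatives are series of the
    same kind. Moreover [smooth2] asks for a single box that serves all orders, so the estimates for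
    the functional equation must not shrink the interval as the order grows. *)

Definition open_set (U : R * R -> Prop) : Prop :=
  forall p, U p -> exists d, 0 < d /\ forall q,
    Rabs (fst q - fst p) < d -> Rabs (snd q - snd p) < d -> U q.

Lemma cont2_onE U f : cont2_on U f <-> forall p, U p -> continuous f p.
Proof.
split; intros H p Up.
- intros P [e He]; destruct (H p Up e (cond_pos e)) as [d [d0 Hd]].
  exists (mkposreal d d0); intros q [Hq1 Hq2]; apply He, Hd; assumption.
- intros eps e0.
  destruct (H p Up (ball (f p) eps)) as [d Hd];
    [now exists (mkposreal eps e0)|].
  exists d; split; [apply cond_pos|]; intros q H1 H2; apply Hd; split; assumption.
Qed.

Lemma continuous_continuity_2d f p : continuous f p -> continuity_2d_pt (fun u v => f (u, v)) (fst p) (snd p).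
Proof.
intros H eps; destruct (H (ball (f p) eps)) as [d Hd]; [now exists eps|].
exists d; intros u v H1 H2.
rewrite <- surjective_pairing.
exact (Hd (u, v) (conj H1 H2)).
Qed.

Lemma is_derive_ext_near (f g : R -> R) x d l : 0 < d ->
  (forall t, Rabs (t - x) < d -> f t = g t) -> is_derive f x l -> is_derive g x l.
Proof.
intros d0 H; apply is_derive_ext_loc; exists (mkposreal d d0); intros t Ht; apply H, Ht.
Qed.

(** Total differentiability of [f] at the point follows from the two partial derivatives nearby and
    the continuity of just one of them, here [fx]; the chain rule then applies. *)
Lemma is_derive_comp2 (f fx fy : R * R -> R) (c1 c2 : R -> R) t l1 l2 d : 0 < d ->
  (forall q, Rabs (fst q - c1 t) < d -> Rabs (snd q - c2 t) < d ->
     is_derive (fun s => f (s, snd q)) (fst q) (fx q) /\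
     is_derive (fun s => f (fst q, s)) (snd q) (fy q)) ->
  continuous fx (c1 t, c2 t) ->
  is_derive c1 t l1 -> is_derive c2 t l2 ->
  is_derive (fun s => f (c1 s, c2 s)) t (fx (c1 t, c2 t) * l1 + fy (c1 t, c2 t) * l2).
Proof.
intros d0 Hd Cx H1 H2.
apply is_derive_Reals.
apply (derivable_pt_lim_comp_2d (fun u v => f (u, v))).
2, 3: apply is_derive_Reals; assumption.
apply filterdiff_differentiable_pt_lim.
apply (is_derive_filterdiff (fun u v => f (u, v)) _ _ (fun u v => fx (u, v))).
- exists (mkposreal d d0); intros q [Hq1 Hq2]; destruct q as [q1 q2].
  apply (proj1 (Hd (q1, q2) Hq1 Hq2)).
- apply (Hd (c1 t, c2 t)); cbn; rewrite Rminus_diag, Rabs_R0; exact d0.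
- apply continuous_ext with fx; [now intros []|exact Cx].
Qed.

Lemma Ck2_cont n U f : Ck2 n U f -> cont2_on U f.
Proof. destruct n; intros H; apply H. Qed.

Lemma Ck2_sub n : forall (U V : R * R -> Prop) f, (forall p, U p -> V p) -> Ck2 n V f -> Ck2 n U f.
Proof.
induction n as [|n IH]; intros U V f UV [C H]; split.
1, 3: intros p Up; apply C, UV, Up. 1: exact I.
destruct H as [fx [fy [D [Hx Hy]]]]; exists fx, fy; split; [intros p Up; apply D, UV, Up|].
split; eapply IH; eassumption.
Qed.

Lemma Ck2_pred n : forall U f, Ck2 (S n) U f -> Ck2 n U f.
Proof.
induction n as [|n IH]; intros U f [C [fx [fy [D [Hx Hy]]]]]; split; auto.
exists fx, fy; auto.
Qed.

Lemma continuous_ext_box (f g : R * R -> R) p d : 0 < d ->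
  (forall q, Rabs (fst q - fst p) < d -> Rabs (snd q - snd p) < d -> f q = g q) ->
  continuous f p -> continuous g p.
Proof.
intros d0 H; apply continuous_ext_loc; exists (mkposreal d d0); intros q [H1 H2]; now apply H.
Qed.

Lemma Ck2_ext n : forall U f g, open_set U -> (forall p, U p -> f p = g p) -> Ck2 n U f -> Ck2 n U g.
Proof.
assert (C0 : forall U f g, open_set U -> (forall p, U p -> f p = g p) -> cont2_on U f -> cont2_on U g).
{ intros U f g OU E C; apply cont2_onE; intros p Up; destruct (OU p Up) as [d [d0 Hd]].
  apply (continuous_ext_box f g p d d0); [|now apply (proj1 (cont2_onE U f) C)].
  intros q H1 H2; apply E, Hd; assumption. }
induction n as [|n IH]; intros U f g OU E [C H]; split; eauto.
destruct H as [fx [fy [D [Hx Hy]]]]; exists fx, fy; split; auto.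
intros p Up; destruct (D p Up) as [Dx Dy]; destruct (OU p Up) as [d [d0 Hd]].
split; eapply is_derive_ext_near; try eassumption; intros t Ht; apply E, Hd; cbn; auto;
  rewrite Rminus_diag, Rabs_R0; exact d0.
Qed.

(** The induction on the order has to run over all members of the family at once: a derivative of
    one member is another member, so no single function could carry the induction hypothesis. *)
Lemma Ck2_coind (F : (R * R -> R) -> Prop) U :
  (forall f, F f -> cont2_on U f /\ exists fx fy, F fx /\ F fy /\ forall p, U p ->
      is_derive (fun t => f (t, snd p)) (fst p) (fx p) /\
      is_derive (fun t => f (fst p, t)) (snd p) (fy p)) ->
  forall n f, F f -> Ck2 n U f.
Proof.
intros H; induction n as [|n IH]; intros f Ff; destruct (H f Ff) as [C [fx [fy [Fx [Fy D]]]]].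
- split; auto.
- split; [exact C|exists fx, fy; auto].
Qed.

Lemma Ck2_const c U n : Ck2 n U (fun _ => c).
Proof.
apply (Ck2_coind (fun f => exists c, f = fun _ => c)); [|now exists c].
intros f [a ->]; split.
- apply cont2_onE; intros p _; apply continuous_const.
- exists (fun _ => 0), (fun _ => 0); split; [now exists 0|split; [now exists 0|]].
  intros p _; split; apply @is_derive_const.
Qed.

Lemma Ck2_fst U n : Ck2 n U fst.
Proof.
destruct n; (split; [apply cont2_onE; intros p _; apply continuous_fst|]); [exact I|].
exists (fun _ => 1), (fun _ => 0); split; [|split; apply Ck2_const].
intros p _; cbn; split; auto_derive; trivial.
Qed.

Lemma Ck2_snd U n : Ck2 n U snd.
Proof.
destruct n; (split; [apply cont2_onE; intros p _; apply continuous_snd|]); [exact I|].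
exists (fun _ => 0), (fun _ => 1); split; [|split; apply Ck2_const].
intros p _; cbn; split; auto_derive; trivial.
Qed.

Lemma Ck2_plus n : forall U f g, Ck2 n U f -> Ck2 n U g -> Ck2 n U (fun p => f p + g p).
Proof.
induction n as [|n IH]; intros U f g [Cf Hf] [Cg Hg]; split.
1, 3: apply cont2_onE; intros p Up; apply (continuous_plus f g);
  [now apply (proj1 (cont2_onE U f) Cf)|now apply (proj1 (cont2_onE U g) Cg)].
1: exact I.
destruct Hf as [fx [fy [D [Hx Hy]]]], Hg as [gx [gy [D' [Hx' Hy']]]].
exists (fun p => fx p + gx p), (fun p => fy p + gy p); split; [|split; now apply IH].
intros p Up; destruct (D p Up), (D' p Up).
split; now apply @is_derive_plus.
Qed.

Lemma Ck2_mult n : forall U f g, Ck2 n U f -> Ck2 n U g -> Ck2 n U (fun p => f p * g p).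
Proof.
induction n as [|n IH]; intros U f g Hf0 Hg0; pose proof Hf0 as [Cf Hf]; pose proof Hg0 as [Cg Hg];
  split.
1, 3: apply cont2_onE; intros p Up; apply (continuous_mult f g);
  [now apply (proj1 (cont2_onE U f) Cf)|now apply (proj1 (cont2_onE U g) Cg)].
1: exact I.
destruct Hf as [fx [fy [D [Hx Hy]]]], Hg as [gx [gy [D' [Hx' Hy']]]].
exists (fun p => fx p * g p + f p * gx p), (fun p => fy p * g p + f p * gy p); split.
2: apply Ck2_pred in Hf0, Hg0; split; apply Ck2_plus; apply IH; assumption.
intros p Up; destruct (D p Up), (D' p Up), p as [x y].
split; apply @is_derive_mult; auto; intros; apply Rmult_comm.
Qed.

Lemma Ck2_scal c n U f : Ck2 n U f -> Ck2 n U (fun p => c * f p).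
Proof. intros H; apply (Ck2_mult n U (fun _ => c)); [apply Ck2_const|exact H]. Qed.

Lemma Ck2_minus n U f g : Ck2 n U f -> Ck2 n U g -> Ck2 n U (fun p => f p - g p).
Proof.
intros Hf Hg.
replace (fun p => f p - g p) with (fun p => f p + (-1) * g p)
  by (apply functional_extensionality; intro; ring).
apply Ck2_plus; [exact Hf|now apply Ck2_scal].
Qed.

Lemma Ck2_inv n : forall U f, (forall p, U p -> f p <> 0) -> Ck2 n U f -> Ck2 n U (fun p => / f p).
Proof.
assert (C0 : forall U f, (forall p, U p -> f p <> 0) -> cont2_on U f -> cont2_on U (fun p => / f p)).
{ intros U f N C; apply cont2_onE; intros p Up; apply (continuous_comp f Rinv).
  - now apply (proj1 (cont2_onE U f) C).
  - now apply continuous_Rinv, N. }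
induction n as [|n IH]; intros U f N H0; pose proof H0 as [C H]; split; auto.
destruct H as [fx [fy [D [Hx Hy]]]].
assert (Hi := IH U f N (Ck2_pred n U f H0)).
exists (fun p => -1 * (fx p * (/ f p * / f p))), (fun p => -1 * (fy p * (/ f p * / f p))).
split; [|split; apply Ck2_scal; apply Ck2_mult; auto; apply Ck2_mult; auto].
intros p Up; destruct (D p Up); specialize (N p Up); destruct p as [x y].
split.
- replace (-1 * _) with (- fx (x, y) / (f (x, y)) ^ 2) by (now field).
  apply (is_derive_inv (fun t => f (t, y))); assumption.
- replace (-1 * _) with (- fy (x, y) / (f (x, y)) ^ 2) by (now field).
  apply (is_derive_inv (fun t => f (x, t))); assumption.
Qed.

Lemma Ck2_comp n : forall U V f (F1 F2 : R * R -> R), open_set V ->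
  (forall p, U p -> V (F1 p, F2 p)) ->
  Ck2 n V f -> Ck2 n U F1 -> Ck2 n U F2 -> Ck2 n U (fun p => f (F1 p, F2 p)).
Proof.
assert (C0 : forall (U V : R * R -> Prop) f (F1 F2 : R * R -> R), (forall p, U p -> V (F1 p, F2 p)) ->
  cont2_on V f -> cont2_on U F1 -> cont2_on U F2 -> cont2_on U (fun p => f (F1 p, F2 p))).
{ intros U V f F1 F2 UV Cf C1 C2; apply cont2_onE; intros p Up.
  apply (continuous_comp_2 F1 F2 (fun u v => f (u, v))).
  - now apply (proj1 (cont2_onE U F1) C1).
  - now apply (proj1 (cont2_onE U F2) C2).
  - apply continuous_ext with f; [now intros []|].
    apply (proj1 (cont2_onE V f) Cf), UV, Up. }
induction n as [|n IH]; intros U V f F1 F2 OV UV Hf0 H10 H20;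
  pose proof Hf0 as [Cf Hf]; pose proof H10 as [C1 H1]; pose proof H20 as [C2 H2];
  split; eauto.
destruct Hf as [fx [fy [D [Hx Hy]]]], H1 as [f1x [f1y [D1 [Hx1 Hy1]]]],
  H2 as [f2x [f2y [D2 [Hx2 Hy2]]]].
apply Ck2_pred in H10, H20.
exists (fun p => fx (F1 p, F2 p) * f1x p + fy (F1 p, F2 p) * f2x p),
  (fun p => fx (F1 p, F2 p) * f1y p + fy (F1 p, F2 p) * f2y p).
split.
2: split; apply Ck2_plus; apply Ck2_mult; auto; apply (IH U V); auto.
intros p Up; destruct (D1 p Up) as [D1x D1y]; destruct (D2 p Up) as [D2x D2y].
destruct (OV _ (UV p Up)) as [d [d0 Hd]].
assert (Cx : continuous fx (F1 p, F2 p)).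
{ apply (proj1 (cont2_onE V fx) (Ck2_cont n V fx Hx)), UV, Up. }
destruct p as [x y]; cbn in *; split.
- apply (is_derive_comp2 f fx fy (fun t => F1 (t, y)) (fun t => F2 (t, y)) x _ _ d); auto.
- apply (is_derive_comp2 f fx fy (fun t => F1 (x, t)) (fun t => F2 (x, t)) y _ _ d); auto.
Qed.

(** * Smoothness of all orders on a set, and its local character *)

Definition smooth_on (U : R * R -> Prop) (f : R * R -> R) : Prop := forall n, Ck2 n U f.
Definition full (p : R * R) : Prop := True.

Lemma open_full : open_set full.
Proof. intros p _; exists 1; split; [lra|intros; exact I]. Qed.

Lemma open_fst (P : R -> Prop) :
  (forall x, P x -> exists d, 0 < d /\ forall y, Rabs (y - x) < d -> P y) ->
  open_set (fun p => P (fst p)).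
Proof.
intros H p Pp; destruct (H _ Pp) as [d [d0 Hd]]; exists d; split; auto.
Qed.

Lemma open_gt0 : open_set (fun p => 0 < fst p).
Proof.
apply open_fst; intros x x0; exists x; split; auto.
intros y Hy; apply Rabs_def2 in Hy; lra.
Qed.

Lemma open_box r : open_set (box r).
Proof.
intros [x y] [Hx Hy]; cbn in *.
exists (Rmin (r - Rabs x) (r - Rabs y)); split; [apply Rmin_glb_lt; lra|].
intros [u v] Hu Hv; cbn in *; split; cbn.
- pose proof (Rmin_l (r - Rabs x) (r - Rabs y)); pose proof (Rabs_triang (u - x) x).
  replace (u - x + x) with u in * by ring; lra.
- pose proof (Rmin_r (r - Rabs x) (r - Rabs y)); pose proof (Rabs_triang (v - y) y).
  replace (v - y + y) with v in * by ring; lra.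
Qed.

Lemma smooth_on_derive U f : open_set U -> smooth_on U f ->
  smooth_on U (d1 f) /\ smooth_on U (d2 f) /\ forall p, U p ->
    is_derive (fun t => f (t, snd p)) (fst p) (d1 f p) /\
    is_derive (fun t => f (fst p, t)) (snd p) (d2 f p).
Proof.
intros OU H; repeat apply conj.
3: { intros p Up; destruct (H 1%nat) as [_ [fx [fy [D _]]]]; destruct (D p Up).
  split; apply Derive_correct; eexists; eassumption. }
all: intros n; destruct (H (S n)) as [_ [fx [fy [D [Hx Hy]]]]].
- apply (Ck2_ext n U fx); auto; intros p Up; symmetry; apply is_derive_unique, D, Up.
- apply (Ck2_ext n U fy); auto; intros p Up; symmetry; apply is_derive_unique, D, Up.
Qed.

Lemma smooth_on_cont U f p : smooth_on U f -> U p -> continuous f p.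
Proof. intros H; apply (cont2_onE U f), (Ck2_cont 0), H. Qed.

Lemma smooth_on_local U f :
  (forall p, U p -> exists V, open_set V /\ V p /\ smooth_on V f) -> smooth_on U f.
Proof.
assert (HV : forall V, open_set V -> smooth_on V f -> forall n, Ck2 n V f) by auto.
intros H n; revert f H HV.
induction n as [|n IH]; intros f H _.
- split; [|exact I]; apply cont2_onE; intros p Up; destruct (H p Up) as [V [OV [Vp Hf]]].
  now apply (smooth_on_cont V).
- split.
  + apply cont2_onE; intros p Up; destruct (H p Up) as [V [OV [Vp Hf]]].
    now apply (smooth_on_cont V).
  + exists (d1 f), (d2 f); split; [|split; apply IH; auto].
    * intros p Up; destruct (H p Up) as [V [OV [Vp Hf]]].
      now apply (smooth_on_derive V f).
    * intros p Up; destruct (H p Up) as [V [OV [Vp Hf]]]; exists V; repeat split; auto;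
        apply (smooth_on_derive V f); auto.
    * intros p Up; destruct (H p Up) as [V [OV [Vp Hf]]]; exists V; repeat split; auto;
        apply (smooth_on_derive V f); auto.
Qed.

Lemma smooth_on_ext U f g : open_set U -> (forall p, U p -> f p = g p) -> smooth_on U f -> smooth_on U g.
Proof. intros OU E H n; now apply (Ck2_ext n U f). Qed.

Lemma smooth_on_comp U V f F1 F2 : open_set V -> (forall p, U p -> V (F1 p, F2 p)) ->
  smooth_on V f -> smooth_on U F1 -> smooth_on U F2 -> smooth_on U (fun p => f (F1 p, F2 p)).
Proof. intros OV UV Hf H1 H2 n; now apply (Ck2_comp n U V). Qed.

Lemma smooth_on_comp1 U (P : R -> Prop) h f : open_set (fun p => P (fst p)) ->
  (forall p, U p -> P (f p)) ->
  smooth_on (fun p => P (fst p)) (fun p => h (fst p)) -> smooth_on U f ->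
  smooth_on U (fun p => h (f p)).
Proof.
intros OV UV Hh Hf.
apply (smooth_on_comp U (fun p => P (fst p)) (fun p => h (fst p)) f (fun _ => 0)); auto.
intros n; apply Ck2_const.
Qed.

Lemma derive_cont (f : R -> R) x : ex_derive f x -> continuous f x.
Proof. exact (ex_derive_continuous (V := R_NormedModule) f x). Qed.

(** * Exponential, logarithm and square root *)

Lemma smooth_on_exp U f : smooth_on U f -> smooth_on U (fun p => exp (f p)).
Proof.
apply (smooth_on_comp1 U (fun _ => True)); [exact open_full|auto|].
(* The constant closes the family under both derivatives: the derivative in the second variable is
   the member with [c = 0]. *)
intros n; apply (Ck2_coind (fun f => exists c, f = fun p => c * exp (fst p)));
  [|exists 1; apply functional_extensionality; intro; ring].
intros g [c ->]; split.
- apply cont2_onE; intros p _.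
  apply (continuous_comp fst (fun x => c * exp x)); [apply continuous_fst|].
  apply derive_cont; auto_derive; trivial.
- exists (fun p => c * exp (fst p)), (fun p => 0 * exp (fst p)).
  split; [now exists c|split; [now exists 0|]].
  intros p _; cbn; split; auto_derive; trivial; ring.
Qed.

Lemma smooth_on_ln U f : (forall p, U p -> 0 < f p) -> smooth_on U f -> smooth_on U (fun p => ln (f p)).
Proof.
intros f0; apply (smooth_on_comp1 U (fun x => 0 < x)); [exact open_gt0|auto|].
assert (C : cont2_on (fun p => 0 < fst p) (fun p => ln (fst p))).
{ apply cont2_onE; intros p p0.
  apply (continuous_comp fst ln); [apply continuous_fst|].
  apply derive_cont; auto_derive; trivial. }
intros [|n]; split; auto.
exists (fun p => / fst p), (fun _ => 0); split; [|split; [apply Ck2_inv|apply Ck2_const]].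
- intros p p0; cbn; split; auto_derive; trivial; ring.
- intros p p0; lra.
- apply Ck2_fst.
Qed.

Lemma smooth_on_sqrt U f : open_set U -> (forall p, U p -> 0 < f p) -> smooth_on U f ->
  smooth_on U (fun p => sqrt (f p)).
Proof.
intros OU f0 H.
apply (smooth_on_ext U (fun p => exp (/ 2 * ln (f p)))); auto.
- intros p Up; rewrite <- Rpower_sqrt by auto; reflexivity.
- apply smooth_on_exp; intros n; apply Ck2_scal; now apply smooth_on_ln.
Qed.

(** * Cutoff functions *)

(** By the mean value theorem each difference quotient at [x] is a value of [g'] at an intermediate
    point, and these values converge to [g' x]. This carries derivatives across the exceptional
    point 0 of [flat] and [seeley]. *)
Lemma is_derive_limit (g g' : R -> R) x d : 0 < d ->
  continuous g x -> continuous g' x ->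
  (forall t, Rabs (t - x) < d -> t <> x -> is_derive g t (g' t)) ->
  is_derive g x (g' x).
Proof.
intros d0 Cg Cg' H.
apply is_derive_Reals; intros eps e0.
destruct (Cg' (ball (g' x) eps)) as [d' Hd']; [now exists (mkposreal eps e0)|].
assert (m0 : 0 < Rmin d d') by (apply Rmin_glb_lt; [exact d0|apply cond_pos]).
exists (mkposreal _ m0); cbn; intros h h0 Hh.
pose proof (Rmin_l d d'); pose proof (Rmin_r d d').
assert (I : forall t, Rmin x (x + h) <= t <= Rmax x (x + h) -> Rabs (t - x) <= Rabs h).
{ intros t; unfold Rmin, Rmax; destruct (Rle_dec x (x + h)); intros Ht; unfold Rabs;
    destruct (Rcase_abs h), (Rcase_abs (t - x)); lra. }
destruct (MVT_gen g x (x + h) g') as [c [Hc E]].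
- intros t Ht; apply H.
  + eapply Rle_lt_trans; [apply I; lra|lra].
  + unfold Rmin, Rmax in Ht; destruct (Rle_dec x (x + h)); lra.
- intros t Ht; apply continuity_pt_filterlim; destruct (Req_dec t x) as [->|N]; [exact Cg|].
  apply derive_cont; exists (g' t); apply H; auto.
  eapply Rle_lt_trans; [apply I; lra|lra].
- replace ((g (x + h) - g x) / h - g' x) with (g' c - g' x) by (rewrite E; field; exact h0).
  apply (Hd' c); change (Rabs (c - x) < d'); eapply Rle_lt_trans; [apply I; lra|lra].
Qed.

(* Differentiation maps this family into its own span, so one induction over all [k] proves smoothness. *)
Definition flat (k : nat) (x : R) : R := if Rlt_dec 0 x then (/ x) ^ k * exp (- / x) else 0.

Lemma flat_pos k x : 0 < x -> 0 < flat k x.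
Proof.
intros x0; unfold flat; destruct (Rlt_dec 0 x); [|lra].
apply Rmult_lt_0_compat; [apply pow_lt, Rinv_0_lt_compat, x0|apply exp_pos].
Qed.

Lemma flat_npos k x : x <= 0 -> flat k x = 0.
Proof. intros x0; unfold flat; destruct (Rlt_dec 0 x); lra. Qed.

Lemma flat_nneg k x : 0 <= flat k x.
Proof.
destruct (Rle_or_lt x 0); [rewrite flat_npos; lra|apply Rlt_le, flat_pos; auto].
Qed.

(** With [u = 1 / x] and [N = k + 1], the inequality [exp (u / N) >= u / N] gives
    [exp u >= (u / N) ^ N]. Using one power more than [k] leaves a factor [x], which yields
    continuity at 0. *)
Lemma flat_bound k x : 0 < x -> flat k x <= INR (S k) ^ S k * x.
Proof.
intros x0; unfold flat; destruct (Rlt_dec 0 x); [|lra].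
set (u := / x); assert (u0 : 0 < u) by (apply Rinv_0_lt_compat, x0).
set (N := INR (S k)); assert (N0 : 0 < N) by (apply lt_0_INR; lia).
assert (E : (u / N) ^ S k <= exp u).
{ replace (exp u) with (exp (u / N) ^ S k).
  - apply pow_incr; split; [apply Rlt_le, Rdiv_lt_0_compat; auto|].
    pose proof (exp_ineq1_le (u / N)); lra.
  - rewrite <- Rpower_pow by apply exp_pos; unfold Rpower; rewrite ln_exp; f_equal.
    fold N; field; lra. }
rewrite exp_Ropp; replace x with (/ u) by (unfold u; now rewrite Rinv_inv).
apply Rmult_le_reg_r with (exp u * u); [apply Rmult_lt_0_compat; auto; apply exp_pos|].
replace (u ^ k * / exp u * (exp u * u)) with (u ^ S k)
  by (cbn [pow]; field; apply Rgt_not_eq, exp_pos).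
replace (N ^ S k * / u * (exp u * u)) with (N ^ S k * exp u) by (field; lra).
replace (u ^ S k) with (N ^ S k * (u / N) ^ S k).
- apply Rmult_le_compat_l; [apply pow_le; lra|exact E].
- rewrite <- Rpow_mult_distr; f_equal; field; lra.
Qed.

Lemma flat_derive_ne k x : x <> 0 ->
  is_derive (flat k) x (- INR k * flat (S k) x + flat (S (S k)) x).
Proof.
intros N; destruct (Rlt_or_le 0 x) as [x0|x0].
- apply (is_derive_ext_near (fun t => (/ t) ^ k * exp (- / t)) _ x x); auto.
  + intros t Ht; apply Rabs_def2 in Ht; unfold flat; destruct (Rlt_dec 0 t); auto; lra.
  + unfold flat; destruct (Rlt_dec 0 x); [|lra]; auto_derive; auto.
    destruct k; cbn [pow Init.Nat.pred]; [cbn|]; field; auto.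
- rewrite !flat_npos by lra; apply (is_derive_ext_near (fun _ => 0) _ x (- x)); [lra| |].
  + intros t Ht; apply Rabs_def2 in Ht; rewrite flat_npos; lra.
  + replace (- INR k * 0 + 0) with 0 by ring; apply @is_derive_const.
Qed.

Lemma flat_cont k x : continuous (flat k) x.
Proof.
destruct (Req_dec x 0) as [->|N].
- intros P [e He]; set (C := INR (S k) ^ S k).
  assert (C0 : 0 < C) by (apply pow_lt, lt_0_INR; lia).
  assert (d0 : 0 < e / C) by (apply Rdiv_lt_0_compat; [apply cond_pos|auto]).
  exists (mkposreal _ d0); intros t Ht; apply He.
  change (Rabs (t - 0) < e / C) in Ht; change (Rabs (flat k t - flat k 0) < e).
  rewrite (flat_npos k 0), Rminus_0_r, Rabs_pos_eq by (try apply flat_nneg; lra).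
  rewrite Rminus_0_r in Ht; apply Rabs_def2 in Ht.
  destruct (Rle_or_lt t 0) as [t0|t0]; [rewrite flat_npos by auto; apply cond_pos|].
  eapply Rle_lt_trans; [now apply flat_bound|]; fold C.
  apply Rlt_le_trans with (C * (e / C)); [apply Rmult_lt_compat_l; [auto|apply Ht]|].
  right; field; lra.
- apply derive_cont; eexists; now apply flat_derive_ne.
Qed.

Lemma flat_derive k x : is_derive (flat k) x (- INR k * flat (S k) x + flat (S (S k)) x).
Proof.
destruct (Req_dec x 0) as [->|N]; [|now apply flat_derive_ne].
apply (is_derive_limit _ (fun x => - INR k * flat (S k) x + flat (S (S k)) x) _ 1); [lra| | |].
- apply flat_cont.
- apply @continuous_plus; [|apply flat_cont].
  apply (continuous_mult (K := R_AbsRing) (fun _ => - INR k));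
    [apply continuous_const|apply flat_cont].
- intros t _ N; now apply flat_derive_ne.
Qed.

Lemma smooth_on_flat U k f : smooth_on U f -> smooth_on U (fun p => flat k (f p)).
Proof.
apply (smooth_on_comp1 U (fun _ => True)); [exact open_full|auto|].
intros n; revert k; induction n as [|n IH]; intros k; split; auto.
1, 2: apply cont2_onE; intros p _; apply (continuous_comp fst (flat k));
  [apply continuous_fst|apply flat_cont].
exists (fun p => - INR k * flat (S k) (fst p) + flat (S (S k)) (fst p)), (fun _ => 0).
split; [|split; [apply Ck2_plus; [apply Ck2_scal|]; apply IH|apply Ck2_const]].
intros p _; cbn [fst snd]; split; [apply flat_derive|apply @is_derive_const].
Qed.

(** A cutoff equal to 1 for [|t| <= r / 2] and to 0 for [|t| >= r]. It depends on [t] only through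
    [t ^ 2], so that cutting off a germ preserves evenness and oddness in a coordinate. *)
Definition bump (r t : R) : R :=
  flat 0 (r ^ 2 - t ^ 2) / (flat 0 (r ^ 2 - t ^ 2) + flat 0 (t ^ 2 - (r / 2) ^ 2)).

Lemma bump_den r t : 0 < r -> 0 < flat 0 (r ^ 2 - t ^ 2) + flat 0 (t ^ 2 - (r / 2) ^ 2).
Proof.
intros r0; pose proof (flat_nneg 0 (r ^ 2 - t ^ 2)); pose proof (flat_nneg 0 (t ^ 2 - (r / 2) ^ 2)).
destruct (Rlt_or_le (t ^ 2) (r ^ 2)).
- pose proof (flat_pos 0 (r ^ 2 - t ^ 2)); lra.
- pose proof (flat_pos 0 (t ^ 2 - (r / 2) ^ 2)); nra.
Qed.

Lemma bump_even r t : bump r (- t) = bump r t.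
Proof. unfold bump; replace ((- t) ^ 2) with (t ^ 2) by ring; reflexivity. Qed.

Lemma bump_out r t : 0 < r -> r <= Rabs t -> bump r t = 0.
Proof.
intros r0 H; unfold bump; rewrite (flat_npos 0 (r ^ 2 - t ^ 2)).
- unfold Rdiv; ring.
- rewrite <- (pow2_abs t); nra.
Qed.

Lemma bump_in r t : 0 < r -> Rabs t <= r / 2 -> bump r t = 1.
Proof.
intros r0 H; pose proof (bump_den r t r0); unfold bump.
assert (E : flat 0 (t ^ 2 - (r / 2) ^ 2) = 0).
{ apply flat_npos; rewrite <- (pow2_abs t); pose proof (Rabs_pos t); nra. }
rewrite E in *; field; lra.
Qed.

Lemma smooth_on_bump U r f : 0 < r -> smooth_on U f -> smooth_on U (fun p => bump r (f p)).
Proof.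
intros r0 Hf n.
assert (S2 : Ck2 n U (fun p => f p ^ 2)) by (apply Ck2_mult; auto; apply Ck2_mult; auto; apply Ck2_const).
assert (H : Ck2 n U (fun p => flat 0 (r ^ 2 - f p ^ 2))).
{ apply (smooth_on_flat U 0 (fun p => r ^ 2 - f p ^ 2)); intro; apply Ck2_minus; [apply Ck2_const|].
  apply Ck2_mult; auto; apply Ck2_mult; auto; apply Ck2_const. }
apply Ck2_mult; auto; apply Ck2_inv.
- intros p _; pose proof (bump_den r (f p) r0); lra.
- apply Ck2_plus; auto.
  apply (smooth_on_flat U 0 (fun p => f p ^ 2 - (r / 2) ^ 2)); intro; apply Ck2_minus; [|apply Ck2_const].
  apply Ck2_mult; auto; apply Ck2_mult; auto; apply Ck2_const.
Qed.

Lemma smooth_on_const U c : smooth_on U (fun _ => c).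
Proof. intros n; apply Ck2_const. Qed.
Lemma smooth_on_fst U : smooth_on U (fun p => fst p).
Proof. intros n; apply Ck2_fst. Qed.
Lemma smooth_on_snd U : smooth_on U (fun p => snd p).
Proof. intros n; apply Ck2_snd. Qed.
Lemma smooth_on_plus U f g : smooth_on U f -> smooth_on U g -> smooth_on U (fun p => f p + g p).
Proof. intros F G n; now apply Ck2_plus. Qed.
Lemma smooth_on_mult U f g : smooth_on U f -> smooth_on U g -> smooth_on U (fun p => f p * g p).
Proof. intros F G n; now apply Ck2_mult. Qed.
Lemma smooth_on_minus U f g : smooth_on U f -> smooth_on U g -> smooth_on U (fun p => f p - g p).
Proof. intros F G n; now apply Ck2_minus. Qed.
Lemma smooth_on_pow U f k : smooth_on U f -> smooth_on U (fun p => f p ^ k).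
Proof.
intros F; induction k as [|k IH]; [exact (smooth_on_const U 1)|exact (smooth_on_mult U f _ F IH)].
Qed.
Lemma smooth_on_comp_full U f F1 F2 : smooth_on full f -> smooth_on U F1 -> smooth_on U F2 ->
  smooth_on U (fun p => f (F1 p, F2 p)).
Proof. apply smooth_on_comp; [exact open_full|intros; exact I]. Qed.

Ltac smooth_full := repeat first
  [ assumption | apply smooth_on_const | apply smooth_on_fst | apply smooth_on_snd
  | apply smooth_on_plus | apply smooth_on_minus | apply smooth_on_mult | apply smooth_on_pow
  | apply smooth_on_comp_full ].

(** Uniform continuity supplies a step length over which [f] varies by less than 1. The segment from
    the origin to any point of the square is walked in [N] such steps, with the same [N] for all
    points. *)
Lemma continuous_bounded (f : R * R -> R) r : (forall p, continuous f p) ->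
  exists B, forall x y, Rabs x <= r -> Rabs y <= r -> Rabs (f (x, y)) <= B.
Proof.
intros C.
destruct (uniform_continuity_2d (fun u v => f (u, v)) (- r) r (- r) r) with (eps := mkposreal 1 Rlt_0_1)
  as [d Hd]; [intros x y _ _; apply (continuous_continuity_2d f (x, y)), C|cbn in Hd].
destruct (archimed_cor1 (d / (Rabs r + 1))) as [N [HN N0]].
{ apply Rdiv_lt_0_compat; [apply cond_pos|pose proof (Rabs_pos r); lra]. }
assert (N0' : 0 < INR N) by (apply lt_0_INR; lia).
exists (Rabs (f (0, 0)) + INR N); intros x y Hx Hy.
assert (I : forall z k, Rabs z <= r -> (k <= N)%nat -> - r <= INR k / INR N * z <= r).
{ intros z k Hz Hk; apply Rabs_le_between; rewrite Rabs_mult.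
  assert (0 <= INR k / INR N <= 1).
  { apply le_INR in Hk; pose proof (pos_INR k); split.
    - apply Rmult_le_pos; auto; apply Rlt_le, Rinv_0_lt_compat; auto.
    - apply Rmult_le_reg_r with (INR N); auto; unfold Rdiv; rewrite Rmult_assoc, Rinv_l; lra. }
  rewrite (Rabs_pos_eq (_ / _)) by apply H; pose proof (Rabs_pos z); nra. }
assert (D : forall z k, Rabs z <= r -> Rabs (INR (S k) / INR N * z - INR k / INR N * z) < d).
{ intros z k Hz; rewrite S_INR.
  replace (_ - _) with (/ INR N * z) by (field; lra).
  rewrite Rabs_mult, Rabs_pos_eq by (apply Rlt_le, Rinv_0_lt_compat; auto).
  assert (Rabs r = r) by (apply Rabs_pos_eq; pose proof (Rabs_pos z); lra).
  assert (0 <= r) by (pose proof (Rabs_pos z); lra).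
  apply Rle_lt_trans with (/ INR N * (r + 1)).
  - apply Rmult_le_compat_l; [apply Rlt_le, Rinv_0_lt_compat; auto|lra].
  - apply Rmult_lt_reg_r with (/ (r + 1)); [apply Rinv_0_lt_compat; lra|].
    rewrite Rmult_assoc, Rinv_r, Rmult_1_r by lra; rewrite H in HN; exact HN. }
assert (forall k, (k <= N)%nat ->
  Rabs (f (INR k / INR N * x, INR k / INR N * y)) <= Rabs (f (0, 0)) + INR k).
{ induction k as [|k IH]; intros Hk.
  - cbn [INR]; unfold Rdiv; rewrite !Rmult_0_l; lra.
  - assert (Rabs (f (INR (S k) / INR N * x, INR (S k) / INR N * y)
      - f (INR k / INR N * x, INR k / INR N * y)) < 1).
    { apply Hd; try apply I; auto; lia. }
    specialize (IH ltac:(lia)); rewrite S_INR in *.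
    match goal with H : Rabs (?a - ?b) < 1 |- _ => pose proof (Rabs_triang_inv a b) end; lra. }
specialize (H N (le_n N)); unfold Rdiv in H; rewrite Rinv_r, !Rmult_1_l in H by lra; exact H.
Qed.

(** * Division by a coordinate *)

(* Hadamard's remainder: [f (x, y) - f (x, 0) = y * moment 0 (d2 f) (x, y)], and the family is closed
   under differentiation: [d1 (moment j f) = moment j (d1 f)], [d2 (moment j f) = moment (S j) (d2 f)]. *)
Definition moment (j : nat) (f : R * R -> R) (p : R * R) : R :=
  RInt (fun t => t ^ j * f (fst p, t * snd p)) 0 1.

Lemma smooth_cont_snd g x t : smooth_on full g -> continuous (fun s => g (x, s)) t.
Proof.
intros H; apply derive_cont; exists (d2 g (x, t)).
destruct (smooth_on_derive full g open_full H) as [_ [_ D]]; apply (D (x, t) I).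
Qed.

Lemma moment_ex j f x y : smooth_on full f -> ex_RInt (fun t => t ^ j * f (x, t * y)) 0 1.
Proof.
intros H; apply (ex_RInt_continuous (V := R_CompleteNormedModule)); intros t _.
apply (smooth_cont_snd (fun q => snd q ^ j * f (x, snd q * y)) x t); smooth_full.
Qed.

Lemma moment_cont j f p : smooth_on full f -> continuous (moment j f) p.
Proof.
intros H; revert p; assert (Cf : forall p, continuous f p)
  by (intros p; apply (smooth_on_cont full f p H I)).
enough (E : cont2_on full (moment j f)) by (intros p; apply (cont2_onE full (moment j f)); [exact E|exact I]).
intros [x y] _ eps e0; cbn [fst snd].
set (a := Rabs x + 1); set (b := Rabs y + 1).
assert (e2 : 0 < eps / 2) by lra.
destruct (uniform_continuity_2d (fun u v => f (u, v)) (- a) a (- b) b) with (eps := mkposreal _ e2)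
  as [d Hd]; [intros; apply (continuous_continuity_2d f (x0, y0)), Cf|cbn in Hd].
exists (Rmin d 1); split; [apply Rmin_glb_lt; [apply cond_pos|lra]|].
intros [u v] Hu Hv; cbn [fst snd] in *.
pose proof (Rmin_l d 1); pose proof (Rmin_r d 1).
unfold moment; cbn [fst snd].
rewrite <- (RInt_minus (V := R_CompleteNormedModule)) by now apply moment_ex.
eapply Rle_lt_trans; [apply (abs_RInt_le_const _ 0 1 (eps / 2))|lra].
- lra.
- apply (ex_RInt_minus (V := R_NormedModule)); now apply moment_ex.
- intros t Ht.
  change (Rabs (t ^ j * f (u, t * v) - t ^ j * f (x, t * y)) <= eps / 2).
  rewrite <- Rmult_minus_distr_l, Rabs_mult.
  assert (Rabs (t ^ j) <= 1).
  { rewrite <- RPow_abs, Rabs_pos_eq by lra; rewrite <- (pow1 j); apply pow_incr; lra. }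
  assert (Rabs (f (u, t * v) - f (x, t * y)) < eps / 2).
  { assert (bx : Rabs u <= a).
    { unfold a; pose proof (Rabs_triang (u - x) x); replace (u - x + x) with u in * by ring; lra. }
    assert (by_ : Rabs v <= b).
    { unfold b; pose proof (Rabs_triang (v - y) y); replace (v - y + y) with v in * by ring; lra. }
    assert (sc : forall z, Rabs (t * z) <= Rabs z).
    { intros z; rewrite Rabs_mult, (Rabs_pos_eq t) by lra; pose proof (Rabs_pos z); nra. }
    pose proof (sc v); pose proof (sc y).
    apply Hd; try (apply Rabs_le_between; unfold a, b in *; lra).
    - lra.
    - rewrite <- Rmult_minus_distr_l; pose proof (sc (v - y)); lra. }
  pose proof (Rabs_pos (t ^ j)); pose proof (Rabs_pos (f (u, t * v) - f (x, t * y))); nra.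
Qed.

Lemma is_derive_RInt_param_smooth (F G : R -> R -> R) x :
  (forall u t, is_derive (fun u => F u t) u (G u t)) ->
  smooth_on full (fun q => G (fst q) (snd q)) ->
  (forall u t, continuous (F u) t) ->
  is_derive (fun u => RInt (F u) 0 1) x (RInt (G x) 0 1).
Proof.
intros D S C.
replace (RInt (G x) 0 1) with (RInt (fun t => Derive (fun u => F u t) x) 0 1).
- apply (is_derive_RInt_param F).
  + exists (mkposreal 1 Rlt_0_1); intros; eexists; apply D.
  + intros t _; apply (continuity_2d_pt_ext G).
    * intros; symmetry; apply is_derive_unique, D.
    * apply (continuous_continuity_2d (fun q => G (fst q) (snd q)) (x, t)).
      now apply (smooth_on_cont full).
  + exists (mkposreal 1 Rlt_0_1); intros.
    apply (ex_RInt_continuous (V := R_CompleteNormedModule)); intros; apply C.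
- apply RInt_ext; intros; apply is_derive_unique, D.
Qed.

Lemma moment_smooth j f : smooth_on full f -> smooth_on full (moment j f).
Proof.
intros H n.
apply (Ck2_coind (fun g => exists j f, smooth_on full f /\ g = moment j f)); [|eauto].
clear; intros g [j [f [H ->]]].
destruct (smooth_on_derive full f open_full H) as [S1 [S2 D]].
split; [apply cont2_onE; intros; now apply moment_cont|].
exists (moment j (d1 f)), (moment (S j) (d2 f)); split; [eauto|split; [eauto|]].
intros [x y] _; unfold moment; cbn [fst snd]; split.
- apply (is_derive_RInt_param_smooth (fun u t => t ^ j * f (u, t * y))
    (fun u t => t ^ j * d1 f (u, t * y))); cbn [fst snd].
  + intros u t; apply is_derive_scal; apply (D (u, t * y) I).
  + smooth_full.
  + intros u t; apply (smooth_cont_snd (fun q => snd q ^ j * f (u, snd q * y)) x t); smooth_full.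
- apply (is_derive_RInt_param_smooth (fun u t => t ^ j * f (x, t * u))
    (fun u t => t ^ S j * d2 f (x, t * u))); cbn [fst snd].
  + intros u t; replace (t ^ S j * d2 f (x, t * u)) with (t ^ j * (t * d2 f (x, t * u))) by (cbn; ring).
    apply is_derive_scal; apply (is_derive_comp (fun s => f (x, s)) (fun u => t * u)).
    * apply (D (x, t * u) I).
    * auto_derive; trivial; ring.
  + smooth_full.
  + intros u t; apply (smooth_cont_snd (fun q => snd q ^ j * f (x, snd q * u)) x t); smooth_full.
Qed.

Lemma moment_spec f x y : smooth_on full f -> f (x, y) - f (x, 0) = y * moment 0 (d2 f) (x, y).
Proof.
intros H; destruct (smooth_on_derive full f open_full H) as [S1 [S2 D]].
assert (E : is_RInt (fun t => y * d2 f (x, t * y)) 0 1 (f (x, 1 * y) - f (x, 0 * y))).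
{ apply (is_RInt_derive (fun t => f (x, t * y))); intros t _.
  - apply (is_derive_comp (fun s => f (x, s)) (fun t => t * y)).
    + apply (D (x, t * y) I).
    + auto_derive; trivial; ring.
  - apply (smooth_cont_snd (fun q => y * d2 f (x, snd q * y)) x t); smooth_full. }
rewrite Rmult_1_l, Rmult_0_l in E; rewrite <- (is_RInt_unique _ _ _ _ E); unfold moment; cbn [fst snd].
rewrite <- (RInt_scal (V := R_CompleteNormedModule)) by now apply moment_ex.
apply RInt_ext; intros t _; change (y * d2 f (x, t * y) = y * (t ^ 0 * d2 f (x, t * y))); cbn; ring.
Qed.

(** * Dominated series *)

Lemma ex_series_dom (v w : nat -> R) : (forall k, Rabs (v k) <= w k) -> ex_series w -> ex_series v.
Proof. intros H; apply (ex_series_le (K := R_AbsRing) (V := R_CompleteNormedModule)), H. Qed.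

Lemma Series_dom (v w : nat -> R) : (forall k, Rabs (v k) <= w k) -> ex_series w ->
  Rabs (Series v) <= Series w.
Proof.
intros H W; assert (E : ex_series (fun k => Rabs (v k))).
{ apply (ex_series_dom _ w); auto; intros k; rewrite Rabs_Rabsolu; apply H. }
eapply Rle_trans; [now apply Series_Rabs|].
apply Series_le; auto; intros k; split; [apply Rabs_pos|apply H].
Qed.

(** Dominated convergence for series: the tail is small by domination, and finitely many head terms
    are small by hypothesis. The filter is arbitrary because continuity needs [locally p] and
    differentiability needs [locally' 0]. *)
Lemma tannery {T} (F : (T -> Prop) -> Prop) {FF : Filter F} (v : nat -> T -> R) w :
  ex_series w -> F (fun t => forall k, Rabs (v k t) <= w k) ->
  (forall k eps, 0 < eps -> F (fun t => Rabs (v k t) < eps)) ->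
  forall eps, 0 < eps -> F (fun t => Rabs (Series (fun k => v k t)) < eps).
Proof.
intros W B C eps e0.
assert (TL : exists N, (0 < N)%nat /\ Series (fun k => w (N + k)%nat) < eps / 2).
{ destruct W as [l Hl]; assert (e2 : 0 < eps / 2) by lra.
  destruct (Hl (ball l (eps / 2))) as [N HN]; [now exists (mkposreal _ e2)|].
  exists (S N); split; [lia|].
  specialize (HN N (le_n N)); change (Rabs (sum_n w N - l) < eps / 2) in HN.
  rewrite <- (is_series_unique w l Hl), (Series_incr_n w (S N)), sum_n_Reals in HN
    by (try lia; now exists l).
  cbn [Init.Nat.pred] in HN; apply Rabs_def2 in HN; lra. }
destruct TL as [N [N0 TL]].
assert (e' : 0 < eps / (2 * INR N)).
{ apply Rdiv_lt_0_compat; auto; apply lt_0_INR in N0; lra. }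
assert (HF : forall m, F (fun t => forall k, (k < m)%nat -> Rabs (v k t) < eps / (2 * INR N))).
{ induction m as [|m IH]; [apply filter_forall; intros; lia|].
  generalize (filter_and _ _ IH (C m _ e')); apply filter_imp; intros t [H1 H2] k Hk.
  destruct (Nat.eq_dec k m) as [->|]; [exact H2|apply H1; lia]. }
generalize (filter_and _ _ B (HF N)); apply filter_imp; clear B HF; intros t [B H].
assert (E : ex_series (fun k => v k t)) by (now apply (ex_series_dom _ w)).
rewrite (Series_incr_n _ N) by auto.
assert (S1 : Rabs (sum_f_R0 (fun k => v k t) (Init.Nat.pred N)) <= eps / 2).
{ eapply Rle_trans; [apply Rsum_abs|].
  eapply Rle_trans; [apply (sum_Rle _ (fun _ => eps / (2 * INR N)))|].
  - intros k Hk; apply Rlt_le, H; lia.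
  - rewrite sum_cte; replace (S (Init.Nat.pred N)) with N by lia.
    apply lt_0_INR in N0; right; field; lra. }
assert (S2 : Rabs (Series (fun k => v (N + k)%nat t)) <= Series (fun k => w (N + k)%nat)).
{ apply Series_dom; [intros k; apply B|now apply (ex_series_incr_n w N)]. }
eapply Rle_lt_trans; [apply Rabs_triang|lra].
Qed.

Lemma Series_continuous (u : nat -> R * R -> R) w p d : ex_series w -> 0 < d ->
  (forall k q, Rabs (fst q - fst p) < d -> Rabs (snd q - snd p) < d -> Rabs (u k q) <= w k) ->
  (forall k, continuous (u k) p) -> continuous (fun q => Series (fun k => u k q)) p.
Proof.
intros W d0 B C P [eps He].
assert (Bp : forall k, Rabs (u k p) <= w k).
{ intros k; apply B; rewrite Rminus_diag, Rabs_R0; exact d0. }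
generalize (tannery (locally p) (fun k q => u k q - u k p) (fun k => w k + w k)
  (ex_series_plus w w W W)); intros H.
assert (LB : locally p (fun q => forall k, Rabs (u k q) <= w k)).
{ exists (mkposreal d d0); intros q [H1 H2] k; apply B; assumption. }
unfold filtermap.
generalize (filter_and _ _ LB (H ltac:(revert LB; apply filter_imp; intros q Bq k;
    unfold Rminus; eapply Rle_trans; [apply Rabs_triang|];
    rewrite Rabs_Ropp; specialize (Bq k); specialize (Bp k); lra)
  ltac:(intros k e e0; apply (C k (fun z => Rabs (z - u k p) < e)); now exists (mkposreal e e0))
  eps (cond_pos eps))).
apply filter_imp; intros q [Bq Hq]; apply He.
change (Rabs (Series (fun k => u k q) - Series (fun k => u k p)) < eps).
rewrite <- Series_minus; [exact Hq| |]; now apply (ex_series_dom _ w).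
Qed.

Lemma MVT_abs (f f' : R -> R) x y d : (forall t, Rabs (t - x) < d -> is_derive f t (f' t)) ->
  Rabs (y - x) < d -> exists c, Rabs (c - x) <= Rabs (y - x) /\ f y - f x = f' c * (y - x).
Proof.
intros D Hy.
assert (I : forall t, Rmin x y <= t <= Rmax x y -> Rabs (t - x) <= Rabs (y - x)).
{ intros t; unfold Rmin, Rmax; destruct (Rle_dec x y); intros Ht; unfold Rabs;
    destruct (Rcase_abs (y - x)), (Rcase_abs (t - x)); lra. }
destruct (MVT_gen f x y f') as [c [Hc E]]; [| |exists c; auto].
- intros t Ht; apply D; eapply Rle_lt_trans; [apply I; lra|lra].
- intros t Ht; apply continuity_pt_filterlim, derive_cont; exists (f' t); apply D.
  eapply Rle_lt_trans; [apply I; lra|lra].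
Qed.

(** By the mean value theorem the difference quotients of [u k] are bounded by the same [w k] as the
    derivatives, so Tannery's theorem applies to their difference from [v k x]. The series of the
    [u k] itself has only to converge. *)
Lemma Series_derive (u v : nat -> R -> R) w x d : ex_series w -> 0 < d ->
  (forall y, Rabs (y - x) < d -> ex_series (fun k => u k y)) ->
  (forall k y, Rabs (y - x) < d -> is_derive (u k) y (v k y)) ->
  (forall k y, Rabs (y - x) < d -> Rabs (v k y) <= w k) ->
  is_derive (fun y => Series (fun k => u k y)) x (Series (fun k => v k x)).
Proof.
intros W d0 U D B; apply is_derive_Reals; intros eps e0.
assert (Bx : forall k, Rabs (v k x) <= w k).
{ intros k; apply B; rewrite Rminus_diag, Rabs_R0; exact d0. }
assert (Ux : ex_series (fun k => u k x)) by (apply U; rewrite Rminus_diag, Rabs_R0; exact d0).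
assert (Vx : ex_series (fun k => v k x)) by (now apply (ex_series_dom _ w)).
assert (H : locally' 0 (fun h => Rabs (Series (fun k => (u k (x + h) - u k x) / h - v k x)) < eps)).
{ apply (tannery (locally' 0) (fun k h => (u k (x + h) - u k x) / h - v k x) (fun k => w k + w k)); auto.
  - apply (ex_series_plus w w W W).
  - exists (mkposreal d d0); intros h Hh h0 k; change (Rabs (h - 0) < d) in Hh.
    destruct (MVT_abs (u k) (v k) x (x + h) d) as [c [Hc E]]; [intros; now apply D| |].
    + now replace (x + h - x) with (h - 0) by ring.
    + rewrite E; replace (v k c * (x + h - x) / h) with (v k c) by (field; auto).
      replace (x + h - x) with (h - 0) in Hc by ring.
      specialize (B k c ltac:(lra)); specialize (Bx k).
      unfold Rminus; eapply Rle_trans; [apply Rabs_triang|]; rewrite Rabs_Ropp; lra.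
  - intros k e e1; specialize (D k x ltac:(rewrite Rminus_diag, Rabs_R0; exact d0)).
    apply is_derive_Reals in D; destruct (D e e1) as [d' Hd'].
    exists d'; intros h Hh h0; apply Hd'; auto; change (Rabs (h - 0) < d') in Hh.
    now rewrite Rminus_0_r in Hh. }
destruct H as [d' Hd'].
assert (m0 : 0 < Rmin d d') by (apply Rmin_glb_lt; [auto|apply cond_pos]).
exists (mkposreal _ m0); cbn; intros h h0 Hh.
pose proof (Rmin_l d d'); pose proof (Rmin_r d d').
assert (Uh : ex_series (fun k => u k (x + h))).
{ apply U; replace (x + h - x) with h by ring; lra. }
specialize (Hd' h ltac:(change (Rabs (h - 0) < d'); rewrite Rminus_0_r; lra) h0).
rewrite <- Series_minus by auto; unfold Rdiv; rewrite <- Series_scal_r, <- Series_minus; auto.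
apply ex_series_scal_r.
apply (ex_series_minus (fun k => u k (x + h)) (fun k => u k x)); auto.
Qed.

(** * Seeley's reflection coefficients *)

(* Taylor coefficients of the entire function [M z = prod_(i >= 0) (1 - z / 4 ^ i)], which satisfies
   [M (4 z) = (1 - 4 z) M z] and hence vanishes at all the points [4 ^ j]. *)
Fixpoint seeley_pre (k : nat) : R :=
  match k with O => 1 | S m => - 4 / (4 ^ k - 1) * seeley_pre m end.

Lemma pow4_ge k : 4 <= 4 ^ S k.
Proof. pose proof (pow_R1_Rle 4 k ltac:(lra)); cbn [pow]; lra. Qed.

Lemma seeley_pre_ne k : seeley_pre k <> 0.
Proof.
induction k as [|k IH]; [cbn; lra|].
pose proof (pow4_ge k); cbn [seeley_pre]; apply Rmult_integral_contrapositive; split; auto.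
unfold Rdiv; apply Rmult_integral_contrapositive; split; [lra|apply Rinv_neq_0_compat; lra].
Qed.

Lemma seeley_pre_radius : CV_radius seeley_pre = p_infty.
Proof.
apply CV_radius_infinite_DAlembert; [apply seeley_pre_ne|].
apply (is_lim_seq_le_le (fun _ => 0) _ (fun n => 2 * (/ 4) ^ n)).
- intros n; split; [apply Rabs_pos|].
  replace (seeley_pre (S n) / seeley_pre n) with (- (4 / (4 ^ S n - 1)))
    by (pose proof (seeley_pre_ne n); pose proof (pow4_ge n); cbn [seeley_pre]; field; split; auto; lra).
  pose proof (pow4_ge n); rewrite Rabs_Ropp, Rabs_pos_eq
    by (apply Rlt_le, Rdiv_lt_0_compat; lra).
  apply Rmult_le_reg_r with (4 ^ S n - 1); [lra|].
  unfold Rdiv; rewrite Rmult_assoc, Rinv_l, Rmult_1_r by lra.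
  pose proof (pow_lt 4 n ltac:(lra)); rewrite pow_inv; cbn [pow] in *.
  replace (2 * / 4 ^ n * (4 * 4 ^ n - 1)) with (8 - 2 * / 4 ^ n) by (field; lra).
  assert (/ 4 ^ n <= 1) by (rewrite <- Rinv_1; apply Rinv_le_contravar; lra); lra.
- apply is_lim_seq_const.
- replace (Finite 0) with (Rbar_mult 2 0) by (cbn; f_equal; ring).
  apply is_lim_seq_scal_l, is_lim_seq_geom; rewrite Rabs_pos_eq; lra.
Qed.

Lemma seeley_pre_ex_abs z : ex_series (fun k => Rabs (seeley_pre k * z ^ k)).
Proof. apply CV_disk_inside; rewrite seeley_pre_radius; exact I. Qed.

Lemma seeley_pre_ex z : ex_series (fun k => seeley_pre k * z ^ k).
Proof. apply ex_series_Rabs, seeley_pre_ex_abs. Qed.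

Lemma seeley_pre_functional z : Series (fun k => seeley_pre k * (4 * z) ^ k) = (1 - 4 * z) * Series (fun k => seeley_pre k * z ^ k).
Proof.
rewrite (Series_incr_1 _ (seeley_pre_ex (4 * z))).
rewrite (Series_ext _ (fun k => seeley_pre (S k) * z ^ S k + (- 4 * z) * (seeley_pre k * z ^ k))).
- rewrite Series_plus, Series_scal_l.
  + replace (Series (fun k => seeley_pre (S k) * z ^ S k)) with (Series (fun k => seeley_pre k * z ^ k) - 1);
      [cbn; ring|].
    rewrite (Series_incr_1 _ (seeley_pre_ex z)); cbn [seeley_pre pow]; ring.
  + apply (ex_series_incr_1 (fun k => seeley_pre k * z ^ k)), seeley_pre_ex.
  + apply (ex_series_scal_l (-4 * z) (fun k => seeley_pre k * z ^ k)), seeley_pre_ex.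
- intros k; rewrite Rpow_mult_distr; cbn [seeley_pre].
  pose proof (pow4_ge k); replace (4 ^ S k) with ((4 ^ S k - 1) + 1) at 2 by ring.
  cbn [pow] in *; field; lra.
Qed.

Lemma seeley_pre_moment j : Series (fun k => seeley_pre k * (4 ^ j) ^ k) = 0.
Proof.
induction j as [|j IH].
(* The zero at 1 comes from the factor [1 - 4 z] at [z = 1 / 4]; the functional equation then
   propagates it to all powers of 4. *)
- replace (4 ^ 0) with (4 * / 4) by (cbn; field); rewrite seeley_pre_functional; field.
- cbn [pow]; rewrite seeley_pre_functional, IH; ring.
Qed.

Definition seeley_norm : R := Series (fun k => seeley_pre k / (4 ^ k + 1)).

Lemma pow4_gt0 k : 0 < 4 ^ k.
Proof. apply pow_lt; lra. Qed.

Lemma seeley_pre_le k : Rabs (seeley_pre (S k)) <= 4 / 3.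
Proof.
induction k as [|k IH].
- cbn; rewrite Rabs_left1; lra.
- replace (seeley_pre (S (S k))) with (- 4 / (4 ^ S (S k) - 1) * seeley_pre (S k)) by reflexivity.
  rewrite Rabs_mult.
  pose proof (pow4_ge (S k)); pose proof (pow4_ge k).
  assert (4 ^ S (S k) = 4 * 4 ^ S k) by reflexivity.
  assert (Rabs (- 4 / (4 ^ S (S k) - 1)) <= 1).
  { unfold Rdiv; rewrite Rabs_mult, (Rabs_left (- 4)), Rabs_pos_eq by (try apply Rlt_le, Rinv_0_lt_compat; lra).
    apply Rmult_le_reg_r with (4 ^ S (S k) - 1); [lra|]; rewrite Rmult_assoc, Rinv_l; lra. }
  pose proof (Rabs_pos (seeley_pre (S k))); nra.
Qed.

Lemma seeley_pre_dom j k : Rabs (seeley_pre k / (4 ^ k + 1) * (- 4 ^ k) ^ j) <= Rabs (seeley_pre k * (4 ^ j) ^ k).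
Proof.
pose proof (pow4_gt0 k).
rewrite !Rabs_mult; unfold Rdiv.
replace (Rabs ((- 4 ^ k) ^ j)) with (Rabs ((4 ^ j) ^ k)).
- rewrite !(Rabs_mult (seeley_pre k)), (Rabs_pos_eq (/ _)) by (apply Rlt_le, Rinv_0_lt_compat; lra).

  apply Rmult_le_compat_r; [apply Rabs_pos|].
  rewrite <- (Rmult_1_r (Rabs (seeley_pre k))) at 2; apply Rmult_le_compat_l; [apply Rabs_pos|].
  rewrite <- Rinv_1; apply Rinv_le_contravar; lra.
- rewrite <- !RPow_abs, Rabs_Ropp, <- !RPow_abs, <- !pow_mult; f_equal; lia.
Qed.

(** The term [k = 0] is 1/2, while the remaining terms are dominated by the geometric series of
    [(1/3) (1/4) ^ k], whose sum 4/9 is smaller. *)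
Lemma seeley_norm_gt0 : 0 < seeley_norm.
Proof.
assert (E : ex_series (fun k => seeley_pre k / (4 ^ k + 1))).
{ apply (ex_series_dom _ (fun k => Rabs (seeley_pre k * (4 ^ 0) ^ k))); [|apply seeley_pre_ex_abs].
  intros k; pose proof (seeley_pre_dom 0 k) as H; rewrite (pow_O (- 4 ^ k)), Rmult_1_r in H; exact H. }
unfold seeley_norm; rewrite Series_incr_1 by exact E.
assert (G : is_series (fun k => / 3 * (/ 4) ^ k) (4 / 9)).
{ replace (4 / 9) with (/ 3 * / (1 - / 4)) by field.
  apply (is_series_scal_l (/ 3) (fun k => (/ 4) ^ k) (/ (1 - / 4))), is_series_geom; rewrite Rabs_pos_eq; lra. }
assert (B : Rabs (Series (fun k => seeley_pre (S k) / (4 ^ S k + 1))) <= 4 / 9).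
{ rewrite <- (is_series_unique _ _ G); apply Series_dom; [|eexists; exact G].
  intros k; pose proof (seeley_pre_le k); pose proof (pow4_gt0 k).
  assert (4 ^ S k = 4 * 4 ^ k) by reflexivity.
  unfold Rdiv; rewrite Rabs_mult, (Rabs_pos_eq (/ _)) by (apply Rlt_le, Rinv_0_lt_compat; lra).
  rewrite pow_inv; apply Rle_trans with (4 / 3 * / (4 ^ S k)).
  - apply Rmult_le_compat; [apply Rabs_pos|apply Rlt_le, Rinv_0_lt_compat; lra|auto|].
    apply Rinv_le_contravar; lra.
  - rewrite H1; right; field; lra. }
apply Rabs_le_between in B; cbn [seeley_pre pow] in *; lra.
Qed.

(* Dividing by [4 ^ k + 1] moves the interpolation node to [-1]: [sum_k c_k (- 4 ^ k) ^ j = 1] for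
   every [j], where [c_k = seeley_weight 0 k]. *)
Definition seeley_weight (j k : nat) : R := seeley_pre k / (4 ^ k + 1) * (- 4 ^ k) ^ j / seeley_norm.

Lemma seeley_weight_S j k : seeley_weight (S j) k = seeley_weight j k * - 4 ^ k.
Proof. pose proof seeley_norm_gt0; pose proof (pow4_gt0 k); unfold seeley_weight; cbn [pow]; field; lra. Qed.

Lemma seeley_pre_dom_ex j : ex_series (fun k => Rabs (seeley_pre k / (4 ^ k + 1) * (- 4 ^ k) ^ j)).
Proof.
apply (ex_series_dom _ (fun k => Rabs (seeley_pre k * (4 ^ j) ^ k))); [|apply seeley_pre_ex_abs].
intros k; rewrite Rabs_Rabsolu; apply seeley_pre_dom.
Qed.

Lemma seeley_weight_ex j : ex_series (fun k => Rabs (seeley_weight j k)).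
Proof.
apply ex_series_ext with (fun k => Rabs (seeley_pre k / (4 ^ k + 1) * (- 4 ^ k) ^ j) * Rabs (/ seeley_norm)).
- intros k; unfold seeley_weight, Rdiv; now rewrite <- Rabs_mult.
- apply ex_series_scal_r, seeley_pre_dom_ex.
Qed.

(** Passing from [j] to [j + 1] multiplies the [k]-th term by [- 4 ^ k]. Since
    [- 4 ^ k - 1 = - (4 ^ k + 1)], the difference of the two sums loses its denominator and becomes
    a multiple of a vanishing moment of [seeley_pre]. *)
Lemma seeley_weight_sum j : Series (seeley_weight j) = 1.
Proof.
pose proof seeley_norm_gt0; unfold seeley_weight, Rdiv; rewrite Series_scal_r.
enough (E : Series (fun k => seeley_pre k * / (4 ^ k + 1) * (- 4 ^ k) ^ j) = seeley_norm) by (rewrite E; field; lra).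
induction j as [|j IH].
- apply Series_ext; intros k; rewrite (pow_O (- 4 ^ k)); unfold Rdiv; ring.
- rewrite <- IH; apply Rminus_diag_uniq; rewrite <- Series_minus by apply ex_series_Rabs, seeley_pre_dom_ex.
  rewrite (Series_ext _ (fun k => - (-1) ^ j * (seeley_pre k * (4 ^ j) ^ k))).
  + rewrite Series_scal_l, seeley_pre_moment; ring.
  + intros k; pose proof (pow4_gt0 k).
    replace ((4 ^ j) ^ k) with ((4 ^ k) ^ j) by (rewrite <- !pow_mult; f_equal; lia).
    replace (- 4 ^ k) with (-1 * 4 ^ k) by ring; rewrite !Rpow_mult_distr; cbn [pow].
    field; lra.
Qed.

(** * Even functions as functions of the square *)

(** Bounded support bounds [f] globally, so the reflection series converges even though its
    arguments [2 ^ k * sqrt (- y)] run off to infinity. The strict inequalities make the region of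
    vanishing open, so that derivatives vanish there too and the class is stable under [d1] and
    [deriv_sq]. *)
Definition even_cs (f : R * R -> R) : Prop :=
  smooth_on full f /\ (forall x y, f (x, - y) = f (x, y)) /\
  exists r, 0 < r /\ forall p, (r < Rabs (fst p) \/ r < Rabs (snd p)) -> f p = 0.

Lemma even_cs_bounded f : even_cs f -> exists B, 0 <= B /\ forall p, Rabs (f p) <= B.
Proof.
intros [S [_ [r [r0 Hr]]]].
destruct (continuous_bounded f r) as [B HB]; [intros p; now apply (smooth_on_cont full)|].
assert (B0 : 0 <= B).
{ eapply Rle_trans; [apply Rabs_pos|apply (HB 0 0)]; rewrite Rabs_R0; lra. }
exists B; split; auto; intros [x y].
destruct (Rlt_or_le r (Rabs x)); [rewrite Hr, Rabs_R0; auto|].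
destruct (Rlt_or_le r (Rabs y)); [rewrite Hr, Rabs_R0; auto|].
now apply HB.
Qed.

Lemma abs_gt_nbhd r x : r < Rabs x -> forall t, Rabs (t - x) < Rabs x - r -> r < Rabs t.
Proof.
intros H t Ht; pose proof (Rabs_triang (x - t) t) as T.
replace (x - t + t) with x in T by ring; rewrite Rabs_minus_sym in Ht; lra.
Qed.

Lemma derive_zero_nbhd (g : R -> R) x l d : 0 < d -> (forall t, Rabs (t - x) < d -> g t = 0) ->
  is_derive g x l -> l = 0.
Proof.
intros d0 H D; apply is_derive_unique in D; rewrite <- D; apply is_derive_unique.
apply (is_derive_ext_near (fun _ => 0) _ x d); auto; [intros; symmetry; auto|].
apply @is_derive_const.
Qed.

Lemma even_cs_d1 f : even_cs f -> even_cs (d1 f).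
Proof.
intros [S [E [r [r0 Hr]]]]; destruct (smooth_on_derive full f open_full S) as [S1 [S2 D]].
split; [auto|split].
- intros x y; unfold d1; cbn [fst snd]; apply Derive_ext; auto.
(* One radius serves both cases: it amounts to [|fst p| - r] when the first coordinate is out of
   range, and to 1 otherwise, when the whole horizontal line already lies outside the support. *)
- exists r; split; auto; intros p [H|H]; apply (derive_zero_nbhd (fun t => f (t, snd p)) (fst p)
    _ (Rmax 1 (Rabs (fst p)) * 0 + (if Rlt_dec r (Rabs (fst p)) then Rabs (fst p) - r else 1)));
    try apply D; try exact I; destruct (Rlt_dec r (Rabs (fst p))); try lra;
    intros t Ht; apply Hr; cbn [fst snd]; auto.
  left; apply (abs_gt_nbhd r (fst p) H); lra.
Qed.

(* The derivative with respect to [y ^ 2], that is [d2 f / (2 y)]. *)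
Definition deriv_sq (f : R * R -> R) (p : R * R) : R := / 2 * moment 0 (d2 (d2 f)) p.

Lemma deriv_sq_spec f x y : even_cs f -> d2 f (x, y) = 2 * (y * deriv_sq f (x, y)).
Proof.
intros [S [E _]]; destruct (smooth_on_derive full f open_full S) as [S1 [S2 D]].
pose proof (moment_spec (d2 f) x y S2) as H; unfold deriv_sq.
enough (d2 f (x, 0) = 0) by lra.
assert (D0 := proj2 (D (x, 0) I)); cbn [fst snd] in D0.
assert (is_derive (fun t => f (x, t)) 0 (- d2 f (x, 0))).
{ apply (is_derive_ext (fun t => f (x, - t))); [intros; apply E|].
  replace (- d2 f (x, 0)) with (-1 * d2 f (x, 0)) by ring.
  apply (is_derive_comp (fun t => f (x, t)) (fun t => - t)).
  - rewrite Ropp_0; exact D0.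
  - auto_derive; trivial. }
apply is_derive_unique in D0, H0; lra.
Qed.

(** The integral defining [deriv_sq] shows smoothness, but not the vanishing for [|y| > r], since it
    runs through the support. There, as for evenness when [y <> 0], the relation
    [d2 f = 2 y deriv_sq f] is divided by [y]. *)
Lemma even_cs_deriv_sq f : even_cs f -> even_cs (deriv_sq f).
Proof.
intros H; pose proof H as [S [E [r [r0 Hr]]]].
destruct (smooth_on_derive full f open_full S) as [S1 [S2 D]].
destruct (smooth_on_derive full (d2 f) open_full S2) as [S21 [S22 D2]].
split; [|split].
- apply smooth_on_mult; [apply smooth_on_const|now apply moment_smooth].
- intros x y; destruct (Req_dec y 0) as [->|N]; [now rewrite Ropp_0|].
  pose proof (deriv_sq_spec f x y H); pose proof (deriv_sq_spec f x (- y) H).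
  assert (d2 f (x, - y) = - d2 f (x, y)).
  { apply is_derive_unique; replace (- d2 f (x, y)) with (-1 * d2 f (x, y)) by ring.
    apply (is_derive_ext (fun t => f (x, - t))); [intros; apply E|].
    apply (is_derive_comp (fun t => f (x, t)) (fun t => - t)).
    - cbn; rewrite Ropp_involutive; apply (D (x, y) I).
    - cbn; auto_derive; trivial. }
  apply Rmult_eq_reg_l with (2 * y); lra.
- exists r; split; auto; intros [x y] Hp; cbn [fst snd] in Hp.
  destruct Hp as [Hx|Hy].
  + unfold deriv_sq, moment; cbn [fst snd].
    rewrite (RInt_ext _ (fun _ => 0)); [rewrite RInt_const; change (/ 2 * ((1 - 0) * 0) = 0); ring|].
    intros t _; enough (Z : d2 (d2 f) (x, t * y) = 0) by (rewrite Z; apply Rmult_0_r).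
    assert (Z : forall s, d2 f (x, s) = 0).
    { intros s; apply (derive_zero_nbhd (fun s => f (x, s)) s _ 1); [lra| |apply (D (x, s) I)].
      intros; apply Hr; auto. }
    apply (derive_zero_nbhd (fun s => d2 f (x, s)) (t * y) _ 1); [lra| |apply (D2 (x, t * y) I)].
    auto.
  + assert (y <> 0) by (intros ->; rewrite Rabs_R0 in Hy; lra).
    enough (d2 f (x, y) = 0) by (pose proof (deriv_sq_spec f x y H); nra).
    apply (derive_zero_nbhd (fun s => f (x, s)) y _ (Rabs y - r)); [lra| |apply (D (x, y) I)].
    intros t Ht; apply Hr; right; apply (abs_gt_nbhd r y Hy t Ht).
Qed.

(* Seeley's extension of [f (x, sqrt Y)] to [Y < 0]. For [Y >= 0] the last two terms cancel, as the
   weights sum to 1; for [Y <= 0] the first two do (both using [sqrt] = 0 on negative arguments).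
   Again the family is closed: [d2 (seeley j f) = seeley (S j) (deriv_sq f)]. *)
Definition seeley (j : nat) (f : R * R -> R) (p : R * R) : R :=
  f (fst p, sqrt (snd p)) - f (fst p, 0) +
  Series (fun k => seeley_weight j k * f (fst p, 2 ^ k * sqrt (- snd p))).

Lemma seeley_nneg j f x y : 0 <= y -> seeley j f (x, y) = f (x, sqrt y).
Proof.
intros y0; unfold seeley; cbn [fst snd].
rewrite (Series_ext _ (fun k => seeley_weight j k * f (x, 0))).
- rewrite Series_scal_r, seeley_weight_sum; ring.
- intros k; rewrite (sqrt_neg_0 (- y)) by lra; now rewrite Rmult_0_r.
Qed.

Lemma seeley_npos j f x y : y <= 0 ->
  seeley j f (x, y) = Series (fun k => seeley_weight j k * f (x, 2 ^ k * sqrt (- y))).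
Proof. intros y0; unfold seeley; cbn [fst snd]; rewrite (sqrt_neg_0 y) by lra; ring. Qed.

Lemma seeley_weight_dom j (f : R * R -> R) B x : (forall p, Rabs (f p) <= B) -> forall k y,
  Rabs (seeley_weight j k * f (x, y)) <= Rabs (seeley_weight j k) * B.
Proof. intros H k y; rewrite Rabs_mult; apply Rmult_le_compat_l; [apply Rabs_pos|apply H]. Qed.

Lemma seeley_weight_dom_ex j B : ex_series (fun k => Rabs (seeley_weight j k) * B).
Proof. apply (ex_series_scal_r B (fun k => Rabs (seeley_weight j k))), seeley_weight_ex. Qed.

Lemma continuous_pair_comp (f : R * R -> R) (u v : R * R -> R) p :
  continuous u p -> continuous v p -> continuous f (u p, v p) ->
  continuous (fun q => f (u q, v q)) p.
Proof.
intros U V F; apply (continuous_comp_2 u v (fun a b => f (a, b))); auto.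
apply continuous_ext with f; [now intros []|exact F].
Qed.

Lemma seeley_cont j f p : even_cs f -> continuous (seeley j f) p.
Proof.
intros H; destruct (even_cs_bounded f H) as [B [B0 HB]].
assert (C : forall q, continuous f q) by (intros q; apply (smooth_on_cont full); [apply H|exact I]).
unfold seeley.
apply (continuous_plus (fun p => f (fst p, sqrt (snd p)) - f (fst p, 0))).
- apply (continuous_minus (fun p => f (fst p, sqrt (snd p))) (fun p => f (fst p, 0)));
    apply (continuous_pair_comp f); auto.
  + apply continuous_fst.
  + apply (continuous_comp snd sqrt); [apply continuous_snd|apply continuous_sqrt].
  + apply continuous_fst.
  + apply continuous_const.
- apply (Series_continuous _ (fun k => Rabs (seeley_weight j k) * B) p 1).
  + apply seeley_weight_dom_ex.
  + lra.
  + intros k q _ _; now apply seeley_weight_dom.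
  + intros k; apply (continuous_mult (K := R_AbsRing) (fun _ => seeley_weight j k)); [apply continuous_const|].
    apply (continuous_pair_comp f); auto; [apply continuous_fst|].
    apply (continuous_mult (K := R_AbsRing) (fun _ => 2 ^ k)); [apply continuous_const|].
    apply (continuous_comp (fun q => - snd q) sqrt); [|apply continuous_sqrt].
    apply (continuous_opp (K := R_AbsRing) (V := R_NormedModule)), continuous_snd.
Qed.

Lemma seeley_derive1 j f x y : even_cs f ->
  is_derive (fun t => seeley j f (t, y)) x (seeley j (d1 f) (x, y)).
Proof.
intros H; destruct (even_cs_bounded f H) as [B [B0 HB]].
pose proof (even_cs_d1 f H) as H1; destruct (even_cs_bounded _ H1) as [B' [B0' HB']].
destruct (smooth_on_derive full f open_full (proj1 H)) as [S1 [S2 D]].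
assert (D1 : forall t s, is_derive (fun t => f (t, s)) t (d1 f (t, s)))
  by (intros t s; apply (D (t, s) I)).
unfold seeley; cbn [fst snd].
apply @is_derive_plus; [apply @is_derive_minus; apply D1|].
apply (Series_derive (fun k t => seeley_weight j k * f (t, 2 ^ k * sqrt (- y)))
  (fun k t => seeley_weight j k * d1 f (t, 2 ^ k * sqrt (- y))) (fun k => Rabs (seeley_weight j k) * B') x 1).
- apply seeley_weight_dom_ex.
- lra.
- intros t _; apply (ex_series_dom _ (fun k => Rabs (seeley_weight j k) * B)); [|apply seeley_weight_dom_ex].
  intros k; now apply seeley_weight_dom.
- intros k t _; apply is_derive_scal, D1.
- intros k t _; now apply seeley_weight_dom.
Qed.

(** For [t < 0] the derivative of [f (x, 2 ^ k * sqrt (- t))] is [- 4 ^ k] times [deriv_sq f] at the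
    same point: the square root from the chain rule cancels against the factor [2 s] of [d2 f]. The
    factor [- 4 ^ k] is absorbed by raising the index of the weights. *)
Lemma seeley_derive2_ne j f x y : even_cs f -> y <> 0 ->
  is_derive (fun t => seeley j f (x, t)) y (seeley (S j) (deriv_sq f) (x, y)).
Proof.
intros H N; destruct (even_cs_bounded f H) as [B [B0 HB]].
pose proof (even_cs_deriv_sq f H) as H1; destruct (even_cs_bounded _ H1) as [B' [B0' HB']].
destruct (smooth_on_derive full f open_full (proj1 H)) as [S1 [S2 D]].
assert (D2 : forall s, is_derive (fun t => f (x, t)) s (2 * (s * deriv_sq f (x, s)))).
{ intros s; rewrite <- deriv_sq_spec by auto; apply (D (x, s) I). }
destruct (Rlt_or_le 0 y) as [y0|y0].
- rewrite seeley_nneg by lra.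
  apply (is_derive_ext_near (fun t => f (x, sqrt t)) _ y y); auto.
  + intros t Ht; apply Rabs_def2 in Ht; rewrite seeley_nneg; auto; lra.
  + pose proof (sqrt_lt_R0 y y0).
    replace (deriv_sq f (x, sqrt y)) with (/ (2 * sqrt y) * (2 * (sqrt y * deriv_sq f (x, sqrt y))))
      by (field; lra).
    apply (is_derive_comp (fun s => f (x, s)) sqrt); [apply D2|].
    auto_derive; auto; field; lra.
- assert (y1 : y < 0) by lra; clear y0 N.
  rewrite seeley_npos by lra.
  apply (is_derive_ext_near (fun t => Series (fun k => seeley_weight j k * f (x, 2 ^ k * sqrt (- t)))) _ y (- y));
    [lra| |].
  + intros t Ht; apply Rabs_def2 in Ht; rewrite seeley_npos; auto; lra.
  + apply (Series_derive (fun k t => seeley_weight j k * f (x, 2 ^ k * sqrt (- t)))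
      (fun k t => seeley_weight (S j) k * deriv_sq f (x, 2 ^ k * sqrt (- t))) (fun k => Rabs (seeley_weight (S j) k) * B') y (- y)).
    * apply seeley_weight_dom_ex.
    * lra.
    * intros t _; apply (ex_series_dom _ (fun k => Rabs (seeley_weight j k) * B)); [|apply seeley_weight_dom_ex].
      intros k; now apply seeley_weight_dom.
    * intros k t Ht; apply Rabs_def2 in Ht.
      assert (t0 : 0 < - t) by lra; pose proof (sqrt_lt_R0 _ t0).
      rewrite seeley_weight_S, Rmult_assoc; apply is_derive_scal.
      set (s := 2 ^ k * sqrt (- t)).
      replace (- 4 ^ k * deriv_sq f (x, s)) with
        (- 2 ^ k / (2 * sqrt (- t)) * (2 * (s * deriv_sq f (x, s)))).
      -- apply (is_derive_comp (fun s => f (x, s)) (fun t => 2 ^ k * sqrt (- t))); [apply D2|].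
         auto_derive; auto; field; lra.
      -- unfold s; replace 4 with (2 * 2) by ring; rewrite Rpow_mult_distr; field; lra.
    * intros k t _; now apply seeley_weight_dom.
Qed.

(** The two half-planes match at 0 because the candidate derivative is again a [seeley] function and
    hence continuous, its weights having sum 1 as well. *)
Lemma seeley_derive2 j f x y : even_cs f ->
  is_derive (fun t => seeley j f (x, t)) y (seeley (S j) (deriv_sq f) (x, y)).
Proof.
intros H; destruct (Req_dec y 0) as [->|N]; [|now apply seeley_derive2_ne].
assert (C : forall j f, even_cs f -> continuous (fun t => seeley j f (x, t)) 0).
{ intros i g Hg; apply (continuous_comp_2 (fun _ => x) (fun t => t) (fun u v => seeley i g (u, v))).
  - apply continuous_const.
  - apply continuous_id.
  - apply continuous_ext with (seeley i g); [now intros []|now apply seeley_cont]. }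
apply (is_derive_limit (fun t => seeley j f (x, t)) (fun t => seeley (S j) (deriv_sq f) (x, t)) 0 1).
- lra.
- now apply C.
- now apply C, even_cs_deriv_sq.
- intros; now apply seeley_derive2_ne.
Qed.

Lemma seeley_smooth j f : even_cs f -> smooth_on full (seeley j f).
Proof.
intros H n; apply (Ck2_coind (fun g => exists j f, even_cs f /\ g = seeley j f)); [|eauto].
clear; intros g [j [f [H ->]]]; split.
- apply cont2_onE; intros; now apply seeley_cont.
- exists (seeley j (d1 f)), (seeley (S j) (deriv_sq f)).
  split; [eauto using even_cs_d1|split; [eauto using even_cs_deriv_sq|]].
  intros [x y] _; cbn [fst snd]; split; [now apply seeley_derive1|now apply seeley_derive2].
Qed.

Lemma seeley_sq f x y : even_cs f -> seeley 0 f (x, y ^ 2) = f (x, y).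
Proof.
intros [_ [E _]]; rewrite seeley_nneg by apply pow2_ge_0.
replace (y ^ 2) with (Rsqr y) by (unfold Rsqr; ring); rewrite sqrt_Rsqr_abs.
unfold Rabs; destruct (Rcase_abs y); auto.
Qed.

Lemma seeley_axis f x : (forall y, f (x, y) = 0) -> forall y, seeley 0 f (x, y) = 0.
Proof.
intros Z y; unfold seeley; cbn [fst snd]; rewrite !Z.
rewrite (Series_ext _ (fun _ => 0 * 0)) by (intros; rewrite Z; ring).
rewrite Series_scal_l; ring.
Qed.

(** * Germs *)

Lemma near0_2_and P Q : near0_2 P -> near0_2 Q -> near0_2 (fun p => P p /\ Q p).
Proof.
intros [r [r0 H]] [s [s0 H']]; exists (Rmin r s); split; [now apply Rmin_glb_lt|].
intros p [H1 H2]; pose proof (Rmin_l r s); pose proof (Rmin_r r s).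
split; [apply H|apply H']; split; lra.
Qed.

Lemma near0_2_imp (P Q : R * R -> Prop) : (forall p, P p -> Q p) -> near0_2 P -> near0_2 Q.
Proof. intros PQ [r [r0 H]]; exists r; auto. Qed.

Lemma near0_2_0 P : near0_2 P -> P (0, 0).
Proof. intros [r [r0 H]]; apply H; split; cbn; rewrite Rabs_R0; exact r0. Qed.

Lemma near0_2_true (P : R * R -> Prop) : (forall p, P p) -> near0_2 P.
Proof. intros H; exists 1; split; [lra|auto]. Qed.

Lemma near0_2_fst P : near0_1 P -> near0_2 (fun p => P (fst p)).
Proof. intros [r [r0 H]]; exists r; split; auto; intros p [H1 _]; auto. Qed.

Lemma near0_1_fst P : near0_2 P -> near0_1 (fun t => P (t, 0)).
Proof.
intros [r [r0 H]]; exists r; split; auto; intros t Ht; apply H; split; cbn; auto.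
rewrite Rabs_R0; exact r0.
Qed.

Lemma near0_1_snd P : near0_2 P -> near0_1 (fun t => P (0, t)).
Proof.
intros [r [r0 H]]; exists r; split; auto; intros t Ht; apply H; split; cbn; auto.
rewrite Rabs_R0; exact r0.
Qed.

Lemma near0_2_nbhd P : near0_2 P -> near0_2 (fun p => exists d, 0 < d /\ forall q,
  Rabs (fst q - fst p) < d -> Rabs (snd q - snd p) < d -> P q).
Proof.
intros [r [r0 H]]; exists r; split; auto; intros p Hp.
destruct (open_box r p Hp) as [d [d0 Hd]]; exists d; auto.
Qed.

Lemma smooth_on_box_le r s f : s <= r -> smooth_on (box r) f -> smooth_on (box s) f.
Proof.
intros H F n; apply (Ck2_sub n _ (box r)); auto; intros p [H1 H2]; split; lra.
Qed.

Lemma smooth2_shrink f P : smooth2 f -> near0_2 P ->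
  exists r, 0 < r /\ smooth_on (box r) f /\ forall p, box r p -> P p.
Proof.
intros [r [r0 F]] [s [s0 H]]; exists (Rmin r s); split; [now apply Rmin_glb_lt|split].
- eapply smooth_on_box_le; [apply Rmin_l|exact F].
- intros p [H1 H2]; pose proof (Rmin_r r s); apply H; split; lra.
Qed.

Lemma smooth2_ext f g : near0_2 (fun p => f p = g p) -> smooth2 f -> smooth2 g.
Proof.
intros E F; destruct (smooth2_shrink f _ F E) as [r [r0 [H H']]].
exists r; split; auto; apply (smooth_on_ext (box r) f); auto; apply open_box.
Qed.

Lemma smooth2_full f : smooth_on full f -> smooth2 f.
Proof.
intros H; exists 1; split; [lra|]; intros n; apply (Ck2_sub n _ full); auto; intros; exact I.
Qed.

Lemma smooth2_2 (op : (R * R -> R) -> (R * R -> R) -> R * R -> R) f g :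
  (forall U f g, smooth_on U f -> smooth_on U g -> smooth_on U (op f g)) ->
  smooth2 f -> smooth2 g -> smooth2 (op f g).
Proof.
intros H [r [r0 F]] [s [s0 G]]; exists (Rmin r s); split; [now apply Rmin_glb_lt|].
apply H; [apply (smooth_on_box_le r); [apply Rmin_l|]|apply (smooth_on_box_le s); [apply Rmin_r|]]; auto.
Qed.

Lemma smooth2_const c : smooth2 (fun _ => c).
Proof. apply smooth2_full, smooth_on_const. Qed.
Lemma smooth2_fst : smooth2 (fun p => fst p).
Proof. apply smooth2_full, smooth_on_fst. Qed.
Lemma smooth2_snd : smooth2 (fun p => snd p).
Proof. apply smooth2_full, smooth_on_snd. Qed.
Lemma smooth2_plus f g : smooth2 f -> smooth2 g -> smooth2 (fun p => f p + g p).
Proof. apply (smooth2_2 (fun f g p => f p + g p)), smooth_on_plus. Qed.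
Lemma smooth2_minus f g : smooth2 f -> smooth2 g -> smooth2 (fun p => f p - g p).
Proof. apply (smooth2_2 (fun f g p => f p - g p)), smooth_on_minus. Qed.
Lemma smooth2_mult f g : smooth2 f -> smooth2 g -> smooth2 (fun p => f p * g p).
Proof. apply (smooth2_2 (fun f g p => f p * g p)), smooth_on_mult. Qed.
Lemma smooth2_pow f k : smooth2 f -> smooth2 (fun p => f p ^ k).
Proof. intros [r [r0 F]]; exists r; split; auto; now apply smooth_on_pow. Qed.
Lemma smooth2_opp f : smooth2 f -> smooth2 (fun p => - f p).
Proof.
intros F; apply (smooth2_ext (fun p => 0 - f p)); [apply near0_2_true; intros; ring|].
apply smooth2_minus; auto; apply smooth2_const.
Qed.
Lemma smooth2_exp f : smooth2 f -> smooth2 (fun p => exp (f p)).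
Proof. intros [r [r0 F]]; exists r; split; auto; now apply smooth_on_exp. Qed.

Lemma smooth2_near f eps : smooth2 f -> 0 < eps -> near0_2 (fun p => Rabs (f p - f (0, 0)) < eps).
Proof.
intros [r [r0 F]] e0.
destruct (proj1 (F 0%nat) (0, 0)) with (eps := eps) as [d [d0 H]]; auto.
{ split; cbn; rewrite Rabs_R0; exact r0. }
exists d; split; auto; intros p [H1 H2]; apply H; cbn; now rewrite Rminus_0_r.
Qed.

Lemma smooth2_gt0 f : smooth2 f -> 0 < f (0, 0) -> near0_2 (fun p => 0 < f p).
Proof.
intros F f0; generalize (smooth2_near f _ F f0); apply near0_2_imp; intros p Hp.
apply Rabs_def2 in Hp; lra.
Qed.

Lemma smooth2_ne0 f : smooth2 f -> f (0, 0) <> 0 -> near0_2 (fun p => f p <> 0).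
Proof.
intros F f0; generalize (smooth2_near f _ F (Rabs_pos_lt _ f0)); apply near0_2_imp; intros p Hp E.
rewrite E, Rminus_0_l, Rabs_Ropp in Hp; lra.
Qed.

Lemma smooth2_ln f : 0 < f (0, 0) -> smooth2 f -> smooth2 (fun p => ln (f p)).
Proof.
intros f0 F; destruct (smooth2_shrink f _ F (smooth2_gt0 f F f0)) as [r [r0 [H N]]].
exists r; split; auto; now apply smooth_on_ln.
Qed.

Lemma smooth2_sqrt f : 0 < f (0, 0) -> smooth2 f -> smooth2 (fun p => sqrt (f p)).
Proof.
intros f0 F; destruct (smooth2_shrink f _ F (smooth2_gt0 f F f0)) as [r [r0 [H N]]].
exists r; split; auto; apply smooth_on_sqrt; auto; apply open_box.
Qed.

Lemma near0_2_pull P F1 F2 : smooth2 F1 -> smooth2 F2 -> F1 (0, 0) = 0 -> F2 (0, 0) = 0 ->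
  near0_2 P -> near0_2 (fun p => P (F1 p, F2 p)).
Proof.
intros S1 S2 E1 E2 [r [r0 H]].
generalize (near0_2_and _ _ (smooth2_near F1 r S1 r0) (smooth2_near F2 r S2 r0)).
apply near0_2_imp; intros p; rewrite E1, E2, !Rminus_0_r; intros [H1 H2]; apply H; split; auto.
Qed.

Lemma near0_2_pull1 P f : smooth2 f -> f (0, 0) = 0 -> near0_1 P -> near0_2 (fun p => P (f p)).
Proof.
intros F f0 H; apply (near0_2_pull (fun p => P (fst p)) f f); auto; now apply near0_2_fst.
Qed.

Lemma smooth2_comp f F1 F2 : F1 (0, 0) = 0 -> F2 (0, 0) = 0 ->
  smooth2 f -> smooth2 F1 -> smooth2 F2 -> smooth2 (fun p => f (F1 p, F2 p)).
Proof.
intros E1 E2 [r [r0 F]] S1 S2.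
assert (N : near0_2 (box r)) by (exists r; auto).
generalize (near0_2_pull _ F1 F2 S1 S2 E1 E2 N); intros B.
destruct (smooth2_shrink F1 _ S1 B) as [r1 [r10 [H1 B1]]].
destruct (smooth2_shrink F2 _ S2 B) as [r2 [r20 [H2 _]]].
exists (Rmin r1 r2); split; [now apply Rmin_glb_lt|].
apply (smooth_on_comp _ (box r)); auto.
- apply open_box.
- intros p [Q1 Q2]; pose proof (Rmin_l r1 r2); apply B1; split; lra.
- eapply smooth_on_box_le; [apply Rmin_l|auto].
- eapply smooth_on_box_le; [apply Rmin_r|auto].
Qed.

Lemma smooth2_comp1 h f : f (0, 0) = 0 -> smooth2 (fun p => h (fst p)) -> smooth2 f ->
  smooth2 (fun p => h (f p)).
Proof. intros E H F; apply (smooth2_comp (fun p => h (fst p)) f f); auto. Qed.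

Lemma Ck1_Ck2 n : forall r h, Ck1 n (fun t => Rabs t < r) h -> Ck2 n (box r) (fun p => h (fst p)).
Proof.
assert (C0 : forall r h, cont1_on (fun t => Rabs t < r) h -> cont2_on (box r) (fun p => h (fst p))).
{ intros r h C p [Hp _] eps e0; destruct (C _ Hp eps e0) as [d [d0 Hd]]; exists d; split; auto. }
induction n as [|n IH]; intros r h [C H]; split; auto.
destruct H as [h' [D H]]; exists (fun p => h' (fst p)), (fun _ => 0).
split; [|split; [now apply IH|apply Ck2_const]].
intros [x y] [Hx _]; cbn [fst snd] in *; split; [now apply D|apply @is_derive_const].
Qed.

Lemma Ck2_Ck1 n : forall r f, 0 < r -> Ck2 n (box r) f ->
  Ck1 n (fun t => Rabs t < r) (fun t => f (t, 0)).
Proof.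
assert (B : forall r x, 0 < r -> Rabs x < r -> box r (x, 0)).
{ intros r x r0 Hx; split; cbn; auto; rewrite Rabs_R0; auto. }
assert (C0 : forall r f, 0 < r -> cont2_on (box r) f ->
  cont1_on (fun t => Rabs t < r) (fun t => f (t, 0))).
{ intros r f r0 C x Hx eps e0; destruct (C (x, 0) (B r x r0 Hx) eps e0) as [d [d0 Hd]].
  exists d; split; auto; intros y Hy; apply Hd; cbn; auto; rewrite Rminus_0_r, Rabs_R0; auto. }
induction n as [|n IH]; intros r f r0 [C H]; split; auto.
destruct H as [fx [fy [D [Hx Hy]]]]; exists (fun t => fx (t, 0)).
split; [|now apply IH].
intros x Hx'; apply (D (x, 0) (B r x r0 Hx')).
Qed.

Lemma smooth1_smooth2 h : smooth1 h -> smooth2 (fun p => h (fst p)).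
Proof. intros [r [r0 H]]; exists r; split; auto; intros n; now apply Ck1_Ck2. Qed.

Lemma smooth2_smooth1 f : smooth2 f -> smooth1 (fun t => f (t, 0)).
Proof. intros [r [r0 H]]; exists r; split; auto; intros n; now apply Ck2_Ck1. Qed.

Lemma smooth2_d f : smooth2 f -> smooth2 (d1 f) /\ smooth2 (d2 f) /\
  near0_2 (fun p => is_derive (fun t => f (t, snd p)) (fst p) (d1 f p) /\
                    is_derive (fun t => f (fst p, t)) (snd p) (d2 f p)).
Proof.
intros [r [r0 F]]; destruct (smooth_on_derive _ f (open_box r) F) as [F1 [F2 D]].
split; [exists r; auto|split; [exists r; auto|exists r; auto]].
Qed.

Lemma near0_d_ext f g : near0_2 (fun p => f p = g p) -> near0_2 (fun p => d1 f p = d1 g p /\ d2 f p = d2 g p).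
Proof.
intros E; generalize (near0_2_nbhd _ E); apply near0_2_imp; intros p [d [d0 H]].
split; apply Derive_ext_loc; exists (mkposreal d d0); intros t Ht; apply H; cbn;
  try exact Ht; rewrite Rminus_diag, Rabs_R0; exact d0.
Qed.

Lemma near0_d_comp f F1 F2 : F1 (0, 0) = 0 -> F2 (0, 0) = 0 ->
  smooth2 f -> smooth2 F1 -> smooth2 F2 -> near0_2 (fun p =>
    d1 (fun q => f (F1 q, F2 q)) p = d1 f (F1 p, F2 p) * d1 F1 p + d2 f (F1 p, F2 p) * d1 F2 p /\
    d2 (fun q => f (F1 q, F2 q)) p = d1 f (F1 p, F2 p) * d2 F1 p + d2 f (F1 p, F2 p) * d2 F2 p).
Proof.
intros E1 E2 F S1 S2.
destruct F as [r [r0 F]]; destruct (smooth_on_derive _ f (open_box r) F) as [Fx [Fy D]].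
assert (N : near0_2 (box r)) by (exists r; auto).
generalize (near0_2_pull _ F1 F2 S1 S2 E1 E2 N); intros B.
destruct (smooth2_d F1 S1) as [_ [_ D1]]; destruct (smooth2_d F2 S2) as [_ [_ D2]].
generalize (near0_2_and _ _ B (near0_2_and _ _ D1 D2)); apply near0_2_imp.
intros [x y] [Bp [[D1x D1y] [D2x D2y]]]; cbn [fst snd] in *.
destruct (open_box r _ Bp) as [d [d0 Hd]].
assert (Cx : continuous (d1 f) (F1 (x, y), F2 (x, y))) by (now apply (smooth_on_cont (box r))).
split; apply is_derive_unique; cbn [fst snd].
- apply (is_derive_comp2 f (d1 f) (d2 f) (fun t => F1 (t, y)) (fun t => F2 (t, y)) x _ _ d); auto.
- apply (is_derive_comp2 f (d1 f) (d2 f) (fun t => F1 (x, t)) (fun t => F2 (x, t)) y _ _ d); auto.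
Qed.

Lemma d_mult0 f g : smooth2 f -> smooth2 g ->
  d1 (fun p => f p * g p) (0, 0) = d1 f (0, 0) * g (0, 0) + f (0, 0) * d1 g (0, 0) /\
  d2 (fun p => f p * g p) (0, 0) = d2 f (0, 0) * g (0, 0) + f (0, 0) * d2 g (0, 0).
Proof.
intros F G; destruct (smooth2_d f F) as [_ [_ D]]; destruct (smooth2_d g G) as [_ [_ D']].
destruct (near0_2_0 _ D), (near0_2_0 _ D').
split; apply is_derive_unique; cbn [fst snd];
 apply @is_derive_mult; auto; intros; apply Rmult_comm.
Qed.

(** * Division and squares for germs *)

(** Moments and reflection series evaluate a function far from the origin, so a germ must first be
    replaced by a globally smooth function of bounded support. *)
Definition cut (r : R) (f : R * R -> R) (p : R * R) : R := bump r (fst p) * bump r (snd p) * f p.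

Lemma cut_out r f p : 0 < r -> (r <= Rabs (fst p) \/ r <= Rabs (snd p)) -> cut r f p = 0.
Proof.
intros r0 [H|H]; unfold cut; rewrite (bump_out r _ r0 H); ring.
Qed.

Lemma cut_in r f p : 0 < r -> box (r / 2) p -> cut r f p = f p.
Proof. intros r0 [H1 H2]; unfold cut; rewrite !bump_in by lra; ring. Qed.

Lemma cut_near r f : 0 < r -> near0_2 (fun p => cut r f p = f p).
Proof. intros r0; exists (r / 2); split; [lra|]; intros p; now apply cut_in. Qed.

Lemma cut_smooth r r' f : 0 < r < r' -> smooth_on (box r') f -> smooth_on full (cut r f).
Proof.
intros [r0 rr] F; apply smooth_on_local; intros p _.
destruct (Rlt_or_le r (Rabs (fst p))) as [Hx|Hx]; [|destruct (Rlt_or_le r (Rabs (snd p))) as [Hy|Hy]].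
- exists (fun q => r < Rabs (fst q)); assert (O : open_set (fun q => r < Rabs (fst q))).
  { apply (open_fst (fun x => r < Rabs x)); intros x H; exists (Rabs x - r); split; [lra|].
    intros; now apply (abs_gt_nbhd r x). }
  split; [exact O|split; [exact Hx|]].
  apply (smooth_on_ext _ (fun _ => 0)); [exact O| |apply smooth_on_const].
  intros q Hq; symmetry; apply cut_out; lra.
- exists (fun q => r < Rabs (snd q)); assert (O : open_set (fun q => r < Rabs (snd q))).
  { intros q H; exists (Rabs (snd q) - r); split; [lra|].
    intros; now apply (abs_gt_nbhd r (snd q)). }
  split; [exact O|split; [exact Hy|]].
  apply (smooth_on_ext _ (fun _ => 0)); [exact O| |apply smooth_on_const].
  intros q Hq; symmetry; apply cut_out; lra.
- exists (box r'); split; [apply open_box|split; [split; lra|]].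
  apply smooth_on_mult; auto; apply smooth_on_mult; apply smooth_on_bump; auto;
    [apply smooth_on_fst|apply smooth_on_snd].
Qed.

Lemma germ_cut f P : smooth2 f -> near0_2 P ->
  exists r, 0 < r /\ smooth_on full (cut r f) /\ forall p, box r p -> P p.
Proof.
intros F H; destruct (smooth2_shrink f P F H) as [r [r0 [S HP]]].
exists (r / 2); split; [lra|split; [apply (cut_smooth _ r); auto; lra|]].
intros p [H1 H2]; apply HP; split; lra.
Qed.

Lemma box_or r p : box r p \/ (r <= Rabs (fst p) \/ r <= Rabs (snd p)).
Proof.
destruct (Rlt_or_le (Rabs (fst p)) r), (Rlt_or_le (Rabs (snd p)) r); auto; left; split; auto.
Qed.

Lemma cut_even r f : 0 < r -> (forall p, box r p -> f (fst p, - snd p) = f p) ->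
  forall x y, cut r f (x, - y) = cut r f (x, y).
Proof.
intros r0 E x y; destruct (box_or r (x, y)) as [B|O].
- unfold cut; cbn [fst snd]; rewrite bump_even; f_equal; apply (E (x, y) B).
- rewrite !cut_out; auto; cbn [fst snd] in *; now rewrite Rabs_Ropp.
Qed.

Lemma cut_odd r f : 0 < r -> (forall p, box r p -> f (fst p, - snd p) = - f p) ->
  forall x y, cut r f (x, - y) = - cut r f (x, y).
Proof.
intros r0 E x y; destruct (box_or r (x, y)) as [B|O].
- unfold cut; cbn [fst snd]; rewrite bump_even; generalize (E (x, y) B); cbn [fst snd].
  intros ->; ring.
- rewrite !cut_out; auto; [ring|]; cbn [fst snd] in *; now rewrite Rabs_Ropp.
Qed.

(** The last clause also covers [y < 0], where the even germ does not determine [a]: each term of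
    the reflection series on the line [x = 0] involves only values of [f] on that line. *)
Lemma whitney_even f : smooth2 f -> near0_2 (fun p => f (fst p, - snd p) = f p) ->
  exists a, smooth2 a /\ near0_2 (fun p => f p = a (fst p, snd p ^ 2)) /\
    (near0_1 (fun y => f (0, y) = 0) -> near0_1 (fun y => a (0, y) = 0)).
Proof.
intros F E.
(* The cutoff must lie inside the neighbourhood where [f (0, y) = 0], if there is one. As the same
   [a] has to serve the implication in either case, this neighbourhood is chosen by excluded middle
   beforehand. *)
assert (Z : exists P : R * R -> Prop, near0_2 P /\ (near0_1 (fun y => f (0, y) = 0) ->
  forall y, P (0, y) -> f (0, y) = 0)).
{ destruct (classic (near0_1 (fun y => f (0, y) = 0))) as [[d [d0 Hd]]|N].
  - exists (box d); split; [exists d; auto|]; intros _ y [_ Hy]; now apply Hd.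
  - exists (fun _ => True); split; [now apply near0_2_true|tauto]. }
destruct Z as [P [NP HP]].
destruct (germ_cut f _ F (near0_2_and _ _ E NP)) as [r [r0 [S H]]].
assert (EC : even_cs (cut r f)).
{ split; [auto|split; [apply cut_even; auto; apply H|]].
  exists r; split; auto; intros p Hp; apply cut_out; auto; lra. }
exists (seeley 0 (cut r f)); split; [|split].
- now apply smooth2_full, seeley_smooth.
- generalize (cut_near r f r0); apply near0_2_imp; intros [x y] <-; cbn [fst snd].
  now rewrite seeley_sq.
- intros Z; exists 1; split; [lra|]; intros y _; apply seeley_axis; intros t.
  destruct (box_or r (0, t)) as [B|O]; [|now apply cut_out].
  unfold cut; rewrite (HP Z t) by (apply H, B); ring.
Qed.

(** [moment] divides by the second coordinate, hence the exchange of coordinates in [C]. The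
    quotient remains even in the other variable because the integrand does. *)
Lemma germ_div_fst f : smooth2 f -> near0_2 (fun p => f (fst p, - snd p) = f p) ->
  near0_1 (fun y => f (0, y) = 0) ->
  exists g, smooth2 g /\ near0_2 (fun p => f p = fst p * g p) /\
    near0_2 (fun p => g (fst p, - snd p) = g p).
Proof.
intros F E [d [d0 Z]].
assert (NB : near0_2 (box d)) by (exists d; auto).
destruct (germ_cut f _ F (near0_2_and _ _ E NB)) as [r [r0 [S H]]].
set (C := fun p => cut r f (snd p, fst p)).
assert (SC : smooth_on full C) by (apply smooth_on_comp_full; auto; [apply smooth_on_snd|apply smooth_on_fst]).
destruct (smooth_on_derive full C open_full SC) as [_ [SC2 _]].
assert (C0 : forall y, C (y, 0) = 0).
{ intros y; unfold C; cbn [fst snd]; destruct (box_or r (0, y)) as [B|O]; [|now apply cut_out].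
  unfold cut; rewrite Z; [ring|]; apply H in B; apply B. }
exists (fun p => moment 0 (d2 C) (snd p, fst p)); split; [|split].
- apply smooth2_full, smooth_on_comp_full;
    [now apply moment_smooth|apply smooth_on_snd|apply smooth_on_fst].
- generalize (cut_near r f r0); apply near0_2_imp; intros [x y] <-; cbn [fst snd].
  rewrite <- moment_spec by auto; rewrite C0; unfold C; cbn [fst snd]; ring.
- apply near0_2_true; intros [x y]; cbn [fst snd]; unfold moment; cbn [fst snd].
  apply RInt_ext; intros t _; f_equal; unfold d2; cbn [fst snd].
  apply Derive_ext; intros s; unfold C; cbn [fst snd]; apply cut_even; auto; apply H.
Qed.

Lemma germ_div_odd f : smooth2 f -> near0_2 (fun p => f (fst p, - snd p) = - f p) ->
  exists g, smooth2 g /\ near0_2 (fun p => f p = snd p * g p) /\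
    near0_2 (fun p => g (fst p, - snd p) = g p).
Proof.
intros F E.
destruct (germ_cut f _ F E) as [r [r0 [S H]]].
set (C := cut r f) in *.
destruct (smooth_on_derive full C open_full S) as [_ [SC2 _]].
assert (O : forall x y, C (x, - y) = - C (x, y)) by (apply cut_odd; auto).
assert (C0 : forall x, C (x, 0) = 0) by (intros x; specialize (O x 0); rewrite Ropp_0 in O; lra).
assert (M : forall x y, C (x, y) = y * moment 0 (d2 C) (x, y)).
{ intros x y; rewrite <- moment_spec by auto; rewrite C0; ring. }
exists (moment 0 (d2 C)); split; [|split].
- now apply smooth2_full, moment_smooth.
- generalize (cut_near r f r0); apply near0_2_imp; intros [x y] <-; apply M.
- apply near0_2_true; intros [x y]; cbn [fst snd].
  destruct (Req_dec y 0) as [->|N]; [now rewrite Ropp_0|].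
  pose proof (M x y); pose proof (M x (- y)); pose proof (O x y).
  apply Rmult_eq_reg_l with y; lra.
Qed.

(** * The inverse function theorem *)

Lemma box_mvt1 g r x x' y : smooth_on (box r) g -> Rabs x < r -> Rabs x' < r -> Rabs y < r ->
  exists c, Rmin x x' <= c <= Rmax x x' /\ g (x', y) - g (x, y) = d1 g (c, y) * (x' - x).
Proof.
intros G Hx Hx' Hy; destruct (smooth_on_derive _ g (open_box r) G) as [_ [_ D]].
assert (I : forall t, Rmin x x' <= t <= Rmax x x' -> box r (t, y)).
{ intros t Ht; split; cbn; auto; apply Rabs_def1; apply Rabs_def2 in Hx, Hx';
    unfold Rmin, Rmax in Ht; destruct (Rle_dec x x'); lra. }
destruct (MVT_gen (fun t => g (t, y)) x x' (fun t => d1 g (t, y))) as [c H]; [| |exists c; exact H].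
- intros t Ht; apply (D (t, y)), I; lra.
- intros t Ht; apply continuity_pt_filterlim, derive_cont; eexists; apply (D (t, y)), I, Ht.
Qed.

Lemma box_mvt2 g r x y y' : smooth_on (box r) g -> Rabs x < r -> Rabs y < r -> Rabs y' < r ->
  exists c, Rmin y y' <= c <= Rmax y y' /\ g (x, y') - g (x, y) = d2 g (x, c) * (y' - y).
Proof.
intros G Hx Hy Hy'; destruct (smooth_on_derive _ g (open_box r) G) as [_ [_ D]].
assert (I : forall t, Rmin y y' <= t <= Rmax y y' -> box r (x, t)).
{ intros t Ht; split; cbn; auto; apply Rabs_def1; apply Rabs_def2 in Hy, Hy';
    unfold Rmin, Rmax in Ht; destruct (Rle_dec y y'); lra. }
destruct (MVT_gen (fun t => g (x, t)) y y' (fun t => d2 g (x, t))) as [c H]; [| |exists c; exact H].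
- intros t Ht; apply (D (x, t)), I; lra.
- intros t Ht; apply continuity_pt_filterlim, derive_cont; eexists; apply (D (x, t)), I, Ht.
Qed.

Lemma between_dist x x' c d : Rmin x x' <= c <= Rmax x x' -> Rabs (x' - x) < d -> Rabs (c - x) < d.
Proof.
intros H1 H2; apply Rabs_def2 in H2; apply Rabs_def1; unfold Rmin, Rmax in H1;
  destruct (Rle_dec x x'); lra.
Qed.

Lemma mult_near a0 b0 eps : 0 < eps -> exists d, 0 < d /\ forall a b,
  Rabs (a - a0) < d -> Rabs (b - b0) < d -> Rabs (a * b - a0 * b0) < eps.
Proof.
intros e0.
assert (S : smooth_on full (fun p => fst p * snd p))
  by (apply smooth_on_mult; [apply smooth_on_fst|apply smooth_on_snd]).
destruct (proj1 (S 0%nat) (a0, b0) I eps e0) as [d [d0 Hd]].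
exists d; split; auto; intros a b Ha Hb; apply (Hd (a, b)); auto.
Qed.

(** The lower bound [de] on the slope of [g] makes any solution [X] continuous, and the mean value
    theorem identifies its partial derivatives as [1 / d1 g] and [- d2 g / d1 g] at [(X p, snd p)].
    These are compositions with [X] itself, so each order of smoothness of [X] yields the next on
    the same box. *)
Lemma implicit_smooth g r rho de X : smooth_on (box r) g -> 0 < de -> rho <= r ->
  (forall p, box r p -> de <= d1 g p) ->
  (forall p, box rho p -> Rabs (X p) < r /\ g (X p, snd p) = fst p) ->
  smooth_on (box rho) X.
Proof.
intros G de0 rr Gd HX.
destruct (smooth_on_derive _ g (open_box r) G) as [G1 [G2 D]].
assert (B : forall p, box rho p -> box r (X p, snd p)).
{ intros p Hp; split; cbn; [now apply HX|]; destruct Hp; lra. }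
assert (C : cont2_on (box rho) X).
{ intros p Hp eps e0; destruct (HX p Hp) as [b0 E0].
  assert (e1 : 0 < de * eps / 2) by (apply Rmult_lt_0_compat; [nra|lra]).
  destruct (proj1 (G 0%nat) _ (B p Hp) _ e1) as [d [d0 Hd]].
  destruct (open_box rho p Hp) as [d' [d0' Hd']].
  exists (Rmin (Rmin d d') (de * eps / 2)); split; [repeat apply Rmin_glb_lt; auto|].
  intros q H1 H2.
  pose proof (Rmin_l (Rmin d d') (de * eps / 2)); pose proof (Rmin_r (Rmin d d') (de * eps / 2)).
  pose proof (Rmin_l d d'); pose proof (Rmin_r d d').
  assert (Hq : box rho q) by (apply Hd'; lra).
  destruct (HX q Hq) as [b1 E1].
  destruct (box_mvt1 g r (X p) (X q) (snd q)) as [c [Hc E]]; auto; [destruct Hq; lra|].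
  assert (Bc : box r (c, snd q)).
  { split; cbn; [|destruct Hq; lra]; apply Rabs_def1; apply Rabs_def2 in b0, b1;
      unfold Rmin, Rmax in Hc; destruct (Rle_dec (X p) (X q)); lra. }
  specialize (Gd _ Bc).
  specialize (Hd (X p, snd q)); cbn [fst snd] in Hd; rewrite Rminus_diag, Rabs_R0 in Hd.
  specialize (Hd d0 ltac:(lra)).
  assert (L : Rabs (d1 g (c, snd q) * (X q - X p)) < de * eps).
  { rewrite <- E, E1.
    replace (fst q - g (X p, snd q)) with
      ((fst q - fst p) - (g (X p, snd q) - g (X p, snd p))) by (rewrite E0; ring).
    eapply Rle_lt_trans; [apply Rabs_triang|]; rewrite Rabs_Ropp; lra. }
  rewrite Rabs_mult, (Rabs_pos_eq (d1 g _)) in L by lra.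
  pose proof (Rabs_pos (X q - X p)); nra. }
intros n; induction n as [|n IH]; split; auto.
set (I1 := fun q => / d1 g q).
assert (SI : smooth_on (box r) I1).
{ intros m; apply Ck2_inv; auto; intros p Hp; specialize (Gd p Hp); lra. }
exists (fun p => I1 (X p, snd p)), (fun p => -1 * d2 g (X p, snd p) * I1 (X p, snd p)).
split; [|split; [|apply Ck2_mult; [apply Ck2_scal|]]];
  try (apply (Ck2_comp n (box rho) (box r)); auto; [apply open_box|apply Ck2_snd]).
intros p Hp; destruct (HX p Hp) as [b0 E0]; pose proof (B p Hp) as Bp.
split; apply is_derive_Reals; intros eps e0.
- destruct (proj1 (SI 0%nat) _ Bp eps e0) as [d [d0 Hd]].
  destruct (C p Hp d d0) as [d' [d0' Hd']].
  destruct (open_box rho p Hp) as [d'' [d0'' Hd'']].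
  assert (m0 : 0 < Rmin d' d'') by (now apply Rmin_glb_lt).
  exists (mkposreal _ m0); cbn [pos]; intros h h0 Hh.
  pose proof (Rmin_l d' d''); pose proof (Rmin_r d' d'').
  set (q := (fst p + h, snd p)).
  assert (Q1 : Rabs (fst q - fst p) < Rmin d' d'') by (cbn; now replace (fst p + h - fst p) with h by ring).
  assert (Q2 : Rabs (snd q - snd p) < Rmin d' d'') by (cbn; now rewrite Rminus_diag, Rabs_R0).
  assert (Hq : box rho q) by (apply Hd''; lra).
  specialize (Hd' q ltac:(lra) ltac:(lra)).
  destruct (HX q Hq) as [b1 E1].
  destruct (box_mvt1 g r (X p) (X q) (snd p)) as [c [Hc E]]; auto; [apply (B p Hp)|].
  pose proof (between_dist _ _ _ _ Hc Hd') as Hcd.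
  cbn [snd fst q] in E1.
  assert (Eh : h = d1 g (c, snd p) * (X q - X p)) by (rewrite <- E, E1, E0; cbn; ring).
  change (Rabs ((X q - X (fst p, snd p)) / h - I1 (X p, snd p)) < eps); rewrite <- (surjective_pairing p).
  replace ((X q - X p) / h) with (I1 (c, snd p)).
  + apply (Hd (c, snd p)); cbn; auto; now rewrite Rminus_diag, Rabs_R0.
  + unfold I1; rewrite Eh; field; split; intros Z; apply h0; rewrite Eh, Z; ring.
- destruct (mult_near (-1 * d2 g (X p, snd p)) (I1 (X p, snd p)) eps e0) as [m [m0 Hm]].
  destruct (proj1 (SI 0%nat) _ Bp m m0) as [d [d0 Hd]].
  destruct (proj1 (G2 0%nat) _ Bp m m0) as [e [ep He]].
  destruct (C p Hp d d0) as [d' [d0' Hd']].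
  destruct (open_box rho p Hp) as [d'' [d0'' Hd'']].
  set (w := Rmin (Rmin d' d'') (Rmin d e)).
  assert (w0 : 0 < w) by (unfold w; repeat apply Rmin_glb_lt; auto).
  assert (W : w <= d' /\ w <= d'' /\ w <= d /\ w <= e).
  { unfold w; pose proof (Rmin_l (Rmin d' d'') (Rmin d e)); pose proof (Rmin_r (Rmin d' d'') (Rmin d e)).
    pose proof (Rmin_l d' d''); pose proof (Rmin_r d' d''); pose proof (Rmin_l d e);
    pose proof (Rmin_r d e); lra. }
  exists (mkposreal _ w0); cbn [pos]; intros h h0 Hh.
  set (q := (fst p, snd p + h)).
  assert (Q1 : Rabs (fst q - fst p) < w) by (cbn; now rewrite Rminus_diag, Rabs_R0).
  assert (Q2 : Rabs (snd q - snd p) < w) by (cbn; now replace (snd p + h - snd p) with h by ring).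
  assert (Hq : box rho q) by (apply Hd''; lra).
  specialize (Hd' q ltac:(lra) ltac:(lra)).
  destruct (HX q Hq) as [b1 E1].
  destruct (box_mvt1 g r (X p) (X q) (snd q)) as [c [Hc E]]; auto; [destruct Hq; lra|].
  destruct (box_mvt2 g r (X p) (snd p) (snd q)) as [c' [Hc' E']]; auto;
    [destruct Hp; lra|destruct Hq; lra|].
  pose proof (between_dist _ _ _ _ Hc Hd') as Hcd.
  pose proof (between_dist _ _ _ _ Hc' Q2) as Hcd'.
  assert (Bc : box r (c, snd q)).
  { split; cbn [fst snd]; [|destruct Hq; lra]; apply Rabs_def1; apply Rabs_def2 in b0, b1;
      unfold Rmin, Rmax in Hc; destruct (Rle_dec (X p) (X q)); lra. }
  pose proof (Gd _ Bc) as Gc.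
  assert (Eh : d1 g (c, snd q) * (X q - X p) = - (d2 g (X p, c') * h)).
  { replace h with (snd q - snd p) by (cbn; ring); rewrite <- E, <- E', E1, E0; cbn; ring. }
  change (Rabs ((X q - X (fst p, snd p)) / h - -1 * d2 g (X p, snd p) * I1 (X p, snd p)) < eps); rewrite <- (surjective_pairing p).
  replace ((X q - X p) / h) with (-1 * d2 g (X p, c') * I1 (c, snd q)).
  + apply Hm.
    * rewrite <- Rmult_minus_distr_l, Rabs_mult, Rabs_left1 by lra.
      specialize (He (X p, c')); cbn [fst snd] in He; rewrite Rminus_diag, Rabs_R0 in He.
      specialize (He ep ltac:(lra)); lra.
    * apply (Hd (c, snd q)); cbn [fst snd]; [exact Hcd|lra].
  + apply Rmult_eq_reg_l with (d1 g (c, snd q) * h).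
    * unfold I1; replace (d1 g (c, snd q) * h * ((X q - X p) / h)) with (d1 g (c, snd q) * (X q - X p))
        by (field; auto).
      rewrite Eh; field; lra.
    * apply Rmult_integral_contrapositive; split; auto; lra.
Qed.

(** On each horizontal line [g] is strictly increasing with slope at least [de], so a root exists by
    the intermediate value theorem and is unique. It is picked by [epsilon], and uniqueness shows
    that the choice inverts [g]. *)
Lemma implicit_pos g : smooth2 g -> g (0, 0) = 0 -> 0 < d1 g (0, 0) ->
  exists X, smooth2 X /\ X (0, 0) = 0 /\ near0_2 (fun p => g (X p, snd p) = fst p) /\
    near0_2 (fun p => X (g p, snd p) = fst p).
Proof.
intros G g0 dg0; set (de := d1 g (0, 0) / 2).
destruct (smooth2_d g G) as [G1 _].
assert (N : near0_2 (fun p => de < d1 g p)).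
{ generalize (smooth2_near (d1 g) (d1 g (0, 0) / 2) G1 ltac:(lra)); apply near0_2_imp; intros p Hp.
  apply Rabs_def2 in Hp; unfold de; lra. }
assert (de0 : 0 < de) by (unfold de; lra).
destruct (smooth2_shrink g _ G N) as [r [r0 [S Gd]]].
assert (M : forall x x' y, Rabs x < r -> Rabs x' < r -> Rabs y < r -> x <= x' ->
  de * (x' - x) <= g (x', y) - g (x, y)).
{ intros x x' y Hx Hx' Hy L; destruct (box_mvt1 g r x x' y) as [c [Hc ->]]; auto.
  apply Rmult_le_compat_r; [lra|]; apply Rlt_le, Gd; split; cbn; auto.
  apply Rabs_def1; apply Rabs_def2 in Hx, Hx'; unfold Rmin, Rmax in Hc; destruct (Rle_dec x x'); lra. }
assert (J : forall x x' y, Rabs x < r -> Rabs x' < r -> Rabs y < r -> g (x, y) = g (x', y) -> x = x').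
{ intros x x' y Hx Hx' Hy E; destruct (Rle_or_lt x x') as [L|L].
  - specialize (M x x' y Hx Hx' Hy L); nra.
  - specialize (M x' x y Hx' Hx Hy ltac:(lra)); nra. }
destruct (smooth2_near g (de * r / 4) G) as [eta [eta0 He]]; [nra|].
rewrite g0 in He.
(* For [|y| < eta] one has [|g (0, y)| < de * r / 4], and moving by [r / 2] changes [g] by at least
   [de * r / 2]. Hence every target of modulus below [de * r / 4] is attained between [- r / 2] and
   [r / 2]. *)
set (rho := Rmin (Rmin eta (r / 2)) (de * r / 4)).
assert (rho0 : 0 < rho) by (unfold rho; repeat apply Rmin_glb_lt; nra).
assert (R : rho <= eta /\ rho <= r / 2 /\ rho <= de * r / 4).
{ unfold rho; pose proof (Rmin_l (Rmin eta (r / 2)) (de * r / 4));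
  pose proof (Rmin_r (Rmin eta (r / 2)) (de * r / 4)); pose proof (Rmin_l eta (r / 2));
  pose proof (Rmin_r eta (r / 2)); lra. }
set (sol := fun p x => Rabs x < r /\ g (x, snd p) = fst p).
assert (Ex : forall p, box rho p -> exists x, sol p x).
{ intros [u y] [Hu Hy]; cbn [fst snd] in *.
  assert (Ar : Rabs (r / 2) < r) by (rewrite Rabs_pos_eq; lra).
  assert (Ar' : Rabs (- (r / 2)) < r) by (rewrite Rabs_Ropp; auto).
  assert (A0 : Rabs 0 < r) by (rewrite Rabs_R0; auto).
  specialize (He (0, y)); rewrite Rminus_0_r in He.
  specialize (He ltac:(split; cbn; [rewrite Rabs_R0; lra|lra])).
  apply Rabs_def2 in He; apply Rabs_def2 in Hu.
  pose proof (M 0 (r / 2) y A0 Ar ltac:(lra) ltac:(lra)).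
  pose proof (M (- (r / 2)) 0 y Ar' A0 ltac:(lra) ltac:(lra)).
  destruct (Ranalysis5.IVT_interv (fun x => g (x, y) - u) (- (r / 2)) (r / 2)) as [x [Hx E]].
  - intros a Ha; apply continuity_pt_minus; [|apply continuity_pt_const; now intros ? ?].
    apply continuity_pt_filterlim, derive_cont; exists (d1 g (a, y)).
    destruct (smooth_on_derive _ g (open_box r) S) as [_ [_ D]]; apply (D (a, y)).
    split; cbn; [apply Rabs_def1; lra|lra].
  - lra.
  - nra.
  - nra.
  - exists x; split; cbn [fst snd]; [apply Rabs_def1; lra|lra]. }
set (X := fun p => epsilon (inhabits 0) (sol p)).
assert (HX : forall p, box rho p -> sol p (X p)) by (intros p Hp; apply epsilon_spec, Ex, Hp).
exists X; split; [|split; [|split]].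
- exists rho; split; auto.
  apply (implicit_smooth g r rho de); auto; [lra|]; intros p Hp; apply Rlt_le, Gd, Hp.
- destruct (HX (0, 0)) as [b E]; [split; cbn; rewrite Rabs_R0; auto|].
  apply (J _ _ 0); auto; [rewrite Rabs_R0; auto|rewrite Rabs_R0; auto|]; cbn [fst snd] in E; lra.
- exists rho; split; auto; intros p Hp; apply (HX p Hp).
- assert (NB : near0_2 (box rho)) by (exists rho; auto).
  generalize (near0_2_and _ _ NB (near0_2_pull _ g (fun p => snd p) G smooth2_snd g0 eq_refl NB)).
  apply near0_2_imp; intros p [[B1 B2] Bg]; destruct (HX _ Bg) as [b E]; cbn [fst snd] in E.
  apply (J _ _ (snd p)); auto; try lra; now rewrite E, <- surjective_pairing.
Qed.

Lemma implicit_function g : smooth2 g -> g (0, 0) = 0 -> d1 g (0, 0) <> 0 ->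
  exists X, smooth2 X /\ X (0, 0) = 0 /\ near0_2 (fun p => g (X p, snd p) = fst p) /\
    near0_2 (fun p => X (g p, snd p) = fst p).
Proof.
intros G g0 dg0; destruct (Rlt_or_le 0 (d1 g (0, 0))) as [P|P]; [now apply implicit_pos|].
destruct (implicit_pos (fun p => - g p)) as [X [SX [X0 [E1 E2]]]].
- now apply smooth2_opp.
- lra.
- unfold d1; rewrite Derive_opp; fold (d1 g (0, 0)); lra.
- assert (So : smooth2 (fun p => - fst p)) by (apply smooth2_opp, smooth2_fst).
  exists (fun p => X (- fst p, snd p)); split; [|split; [|split]].
  + apply smooth2_comp; auto; [cbn; ring|apply smooth2_snd].
  + cbn; now rewrite Ropp_0.
  + generalize (near0_2_pull _ _ _ So smooth2_snd Ropp_0 eq_refl E1); apply near0_2_imp.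
    intros p; cbn [fst snd]; intros H; lra.
  + exact E2.
Qed.

(** * Diffeomorphism germs, Jacobians and the inverse function theorem *)

Lemma smooth2_compF f F : mgerm F -> smooth2 f -> smooth2 (fun p => f (F p)).
Proof.
intros [[F1 F2] F0] S.
apply (smooth2_ext (fun p => f (fst (F p), snd (F p)))).
- apply near0_2_true; intros p; now rewrite <- surjective_pairing.
- apply (smooth2_comp f (fun p => fst (F p)) (fun p => snd (F p))); auto; cbn beta; now rewrite F0.
Qed.

Lemma near0_2_pullF P F : mgerm F -> near0_2 P -> near0_2 (fun p => P (F p)).
Proof.
intros [[F1 F2] F0] N.
generalize (near0_2_pull P _ _ F1 F2 ltac:(cbn beta; now rewrite F0) ltac:(cbn beta; now rewrite F0) N).
apply near0_2_imp; intros p; now rewrite <- surjective_pairing.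
Qed.

Lemma mgerm_comp F G : mgerm F -> mgerm G -> mgerm (fun p => G (F p)).
Proof.
intros HF HG; split; [split|].
- apply (smooth2_compF (fun p => fst (G p))); auto; apply HG.
- apply (smooth2_compF (fun p => snd (G p))); auto; apply HG.
- destruct HF as [_ ->]; apply HG.
Qed.

Lemma diffeo2_mgerm H : diffeo2 H -> mgerm H.
Proof. intros [S [H0 _]]; split; auto. Qed.

Lemma diffeo2_inv H : diffeo2 H -> exists G, diffeo2 G /\ near0_2 (fun p => G (H p) = p) /\
  near0_2 (fun p => H (G p) = p).
Proof.
intros [S [H0 [G [SG [G0 [E1 E2]]]]]]; exists G; split; auto.
split; auto; split; auto; exists H; auto.
Qed.

Lemma diffeo2_comp H K : diffeo2 H -> diffeo2 K -> diffeo2 (fun p => K (H p)).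
Proof.
intros DH DK; pose proof (diffeo2_mgerm H DH) as MH; pose proof (diffeo2_mgerm K DK) as MK.
destruct (mgerm_comp H K MH MK) as [S E0]; split; [auto|split; [auto|]].
destruct (diffeo2_inv H DH) as [G [DG [E1 E2]]]; destruct (diffeo2_inv K DK) as [L [DL [E3 E4]]].
pose proof (diffeo2_mgerm G DG) as MG; pose proof (diffeo2_mgerm L DL) as ML.
destruct (mgerm_comp L G ML MG) as [S' E0'].
exists (fun p => G (L p)); split; [auto|split; [auto|split]].
- generalize (near0_2_and _ _ E1 (near0_2_pullF _ H MH E3)); apply near0_2_imp.
  intros p [Q1 Q2]; now rewrite Q2.
- generalize (near0_2_and _ _ E4 (near0_2_pullF _ L ML E2)); apply near0_2_imp.
  intros p [Q1 Q2]; now rewrite Q2.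
Qed.

Lemma diffeo2_ext H K : near0_2 (fun p => H p = K p) -> diffeo2 H -> diffeo2 K.
Proof.
intros E DH; pose proof DH as [[S1 S2] [H0 [G [SG [G0 [E1 E2]]]]]].
split; [split|split].
- apply (smooth2_ext (fun p => fst (H p))); auto; revert E; apply near0_2_imp; now intros p ->.
- apply (smooth2_ext (fun p => snd (H p))); auto; revert E; apply near0_2_imp; now intros p ->.
- now rewrite <- (near0_2_0 _ E).
- exists G; split; [auto|split; [auto|split]].
  + generalize (near0_2_and _ _ E E1); apply near0_2_imp; intros p [<- Q]; auto.
  + generalize (near0_2_and _ _ E2 (near0_2_pullF _ G (conj SG G0) E)); apply near0_2_imp.
    intros p [Q1 Q2]; now rewrite <- Q2.
Qed.

Lemma diffeo2_shear g : smooth2 g -> g (0, 0) = 0 -> d1 g (0, 0) <> 0 ->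
  diffeo2 (fun p => (g p, snd p)).
Proof.
intros G g0 dg; destruct (implicit_function g G g0 dg) as [X [SX [X0 [E1 E2]]]].
split; [split; cbn; auto; apply smooth2_snd|split; [cbn; now rewrite g0|]].
exists (fun p => (X p, snd p)); split; [split; cbn; auto; apply smooth2_snd|split; [cbn; now rewrite X0|split]].
- revert E2; apply near0_2_imp; intros [x y]; cbn; now intros ->.
- revert E1; apply near0_2_imp; intros [x y]; cbn; now intros ->.
Qed.

Lemma diffeo2_swap : diffeo2 (fun p => (snd p, fst p)).
Proof.
split; [split; [apply smooth2_snd|apply smooth2_fst]|split; [reflexivity|]].
exists (fun p => (snd p, fst p)); split; [split; [apply smooth2_snd|apply smooth2_fst]|split; [reflexivity|]].
split; apply near0_2_true; now intros [].
Qed.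

Lemma near0_d_compF f F : mgerm F -> smooth2 f -> near0_2 (fun p =>
  d1 (fun q => f (F q)) p = d1 f (F p) * d1 (comp1 F) p + d2 f (F p) * d1 (comp2 F) p /\
  d2 (fun q => f (F q)) p = d1 f (F p) * d2 (comp1 F) p + d2 f (F p) * d2 (comp2 F) p).
Proof.
intros [[F1 F2] F0] S.
assert (E : near0_2 (fun p => f (F p) = f (fst (F p), snd (F p))))
  by (apply near0_2_true; intros p; now rewrite <- surjective_pairing).
generalize (near0_2_and _ _ (near0_d_ext _ _ E) (near0_d_comp f (fun p => fst (F p)) (fun p => snd (F p))
  ltac:(cbn beta; now rewrite F0) ltac:(cbn beta; now rewrite F0) S F1 F2)).
apply near0_2_imp; intros p [[-> ->] H]; rewrite <- surjective_pairing in H; exact H.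
Qed.

(** The identity is kept on a neighbourhood, not only at the origin, because [fold_tangent]
    differentiates it once more. *)
Lemma jac_comp F G : mgerm F -> mgerm G -> near0_2 (fun p =>
  jac_det (fun q => G (F q)) p = jac_det G (F p) * jac_det F p).
Proof.
intros MF [[G1 G2] G0].
generalize (near0_2_and _ _ (near0_d_compF _ F MF G1) (near0_d_compF _ F MF G2)); apply near0_2_imp.
intros p [[A1 A2] [B1 B2]]; unfold jac_det, comp1, comp2 in *; rewrite A1, A2, B1, B2; ring.
Qed.

Lemma jac_ext F G : near0_2 (fun p => F p = G p) -> near0_2 (fun p => jac_det F p = jac_det G p).
Proof.
intros E.
assert (E1 : near0_2 (fun p => comp1 F p = comp1 G p))
  by (revert E; apply near0_2_imp; unfold comp1; now intros p ->).
assert (E2 : near0_2 (fun p => comp2 F p = comp2 G p))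
  by (revert E; apply near0_2_imp; unfold comp2; now intros p ->).
generalize (near0_2_and _ _ (near0_d_ext _ _ E1) (near0_d_ext _ _ E2)); apply near0_2_imp.
intros p [[A1 A2] [B1 B2]]; unfold jac_det; congruence.
Qed.

Lemma d_fst p : d1 (fun q => fst q) p = 1 /\ d2 (fun q => fst q) p = 0.
Proof. unfold d1, d2; cbn [fst snd]; split; [apply Derive_id|apply Derive_const]. Qed.
Lemma d_snd p : d1 (fun q => snd q) p = 0 /\ d2 (fun q => snd q) p = 1.
Proof. unfold d1, d2; cbn [fst snd]; split; [apply Derive_const|apply Derive_id]. Qed.

Lemma jac_id p : jac_det (fun p => p) p = 1.
Proof.
unfold jac_det; destruct (d_fst p) as [A B], (d_snd p) as [C D].
change (d1 (fun q => fst q) p * d2 (fun q => snd q) p - d2 (fun q => fst q) p * d1 (fun q => snd q) p = 1).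
rewrite A, B, C, D; ring.
Qed.

Lemma diffeo2_jac H : diffeo2 H -> jac_det H (0, 0) <> 0.
Proof.
intros DH; destruct (diffeo2_inv H DH) as [G [DG [E1 E2]]].
pose proof (near0_2_0 _ (jac_comp H G (diffeo2_mgerm _ DH) (diffeo2_mgerm _ DG))) as J.
pose proof (near0_2_0 _ (jac_ext _ _ E1)) as J'; cbn beta in *.
rewrite J', jac_id in J; intros Z; rewrite Z in J; lra.
Qed.

(** [F] factors into two shears: [(x, y)] goes to [(F_1 (x, y), y)], and then the second coordinate
    alone is changed, by the function [m]. The shears are inverted by the scalar implicit function
    theorem; for the second one, the Jacobian of [F] gives [d2 m <> 0]. *)
Lemma inverse_function_aux F : mgerm F -> jac_det F (0, 0) <> 0 -> d1 (comp1 F) (0, 0) <> 0 ->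
  diffeo2 F.
Proof.
intros MF J N; pose proof MF as [[F1 F2] F0].
assert (F10 : comp1 F (0, 0) = 0) by (unfold comp1; now rewrite F0).
pose proof (diffeo2_shear (comp1 F) F1 F10 N) as D1.
destruct (diffeo2_inv _ D1) as [G [DG [E1 E2]]].
pose proof (diffeo2_mgerm _ DG) as MG.
assert (MFG := mgerm_comp G F MG MF).
pose proof (diffeo2_jac G DG) as JG.
pose proof (near0_2_0 _ (jac_comp G F MG MF)) as JFG; cbn beta in JFG.
destruct MG as [SG G0]; rewrite G0 in JFG.
set (m := fun p => snd (F (G p))).
assert (E1' : near0_2 (fun p => comp1 (fun q => F (G q)) p = fst p)).
{ revert E2; apply near0_2_imp; intros p Q; unfold comp1 in *; apply (f_equal fst) in Q; exact Q. }
destruct (near0_2_0 _ (near0_d_ext _ _ E1')) as [A1 A2].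
destruct (d_fst (0, 0)) as [B1 B2]; pose proof (eq_trans A1 B1) as C1; pose proof (eq_trans A2 B2) as C2.
assert (Dm : d2 m (0, 0) <> 0).
{ intros Z; unfold jac_det in JFG at 1; rewrite C1, C2 in JFG.
  change (comp2 (fun q => F (G q))) with m in JFG; rewrite Z in JFG.
  assert (jac_det F (0, 0) * jac_det G (0, 0) = 0) by lra.
  apply Rmult_integral in H; tauto. }
assert (m0 : m (0, 0) = 0) by (unfold m; now rewrite G0, F0).
assert (D2 : diffeo2 (fun p => (m (snd p, fst p), snd p))).
{ apply diffeo2_shear.
  - apply (smooth2_compF m (fun p => (snd p, fst p))); [apply diffeo2_mgerm, diffeo2_swap|apply MFG].
  - exact m0.
  - exact Dm. }
apply (diffeo2_ext (fun p => (comp1 F p, m (comp1 F p, snd p)))).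
- generalize E1; apply near0_2_imp; intros p Q; unfold m; rewrite Q; unfold comp1.
  now rewrite <- surjective_pairing.
- pose proof (diffeo2_comp _ _ (diffeo2_comp _ _ (diffeo2_comp _ _ D1 diffeo2_swap) D2) diffeo2_swap) as D.
  exact D.
Qed.

Lemma inverse_function F : mgerm F -> jac_det F (0, 0) <> 0 -> diffeo2 F.
Proof.
intros MF J; destruct (Req_dec (d1 (comp1 F) (0, 0)) 0) as [Z|N]; [|now apply inverse_function_aux].
pose proof (diffeo2_mgerm _ diffeo2_swap) as MS.
apply (diffeo2_ext (fun p => F ((fun p => (snd p, fst p)) ((fun p => (snd p, fst p)) p)))).
{ apply near0_2_true; now intros []. }
apply (diffeo2_comp (fun p => (snd p, fst p)) (fun p => F (snd p, fst p))); [apply diffeo2_swap|].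
apply inverse_function_aux.
- now apply (mgerm_comp (fun p => (snd p, fst p)) F).
- rewrite (near0_2_0 _ (jac_comp _ F MS MF)); apply Rmult_integral_contrapositive; split; auto.
  apply diffeo2_jac, diffeo2_swap.
- change (d2 (comp1 F) (0, 0) <> 0); intros Z'; apply J; unfold jac_det; rewrite Z, Z'; ring.
Qed.

(** * A contracting functional equation *)

Lemma bounded_1d (f : R -> R) a : 0 <= a -> (forall t, Rabs t <= a -> continuous f t) ->
  exists B, 0 <= B /\ forall t, Rabs t <= a -> Rabs (f t) <= B.
Proof.
intros a0 C.
destruct (continuity_ab_maj (fun t => Rabs (f t)) (- a) a) as [x [Hx _]]; [lra| |].
- intros c Hc; apply continuity_pt_filterlim.
  apply (continuous_comp f Rabs); [apply C, Rabs_le_between, Hc|apply continuous_Rabs].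
- exists (Rabs (f x)); split; [apply Rabs_pos|]; intros t Ht; apply Hx, Rabs_le_between, Ht.
Qed.

(** The derivative furnished by [Ck2] might a priori depend on the second variable; freezing that
    variable at 0 and using uniqueness of derivatives removes the dependence. *)
Lemma Ck2_fst_S n R f : 0 < R -> Ck2 (S n) (box R) (fun p => f (fst p)) ->
  exists f', (forall t, Rabs t < R -> is_derive f t (f' t)) /\ Ck2 n (box R) (fun p => f' (fst p)).
Proof.
intros R0 [_ [fx [fy [D [Hx _]]]]].
assert (D' : forall t, Rabs t < R -> is_derive f t (fx (t, 0))).
{ intros t Ht; apply (D (t, 0)); split; cbn; auto; rewrite Rabs_R0; auto. }
exists (fun t => fx (t, 0)); split; auto.
apply (Ck2_ext n _ fx); auto; [apply open_box|]; intros p Hp.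
destruct (D p Hp) as [Dp _]; apply is_derive_unique in Dp.
rewrite <- Dp; symmetry; rewrite <- (is_derive_unique _ _ _ (D' (fst p) (proj1 Hp))); reflexivity.
Qed.

Lemma Ck2_fst_cont n R f t : 0 < R -> Ck2 n (box R) (fun p => f (fst p)) -> Rabs t < R ->
  continuous f t.
Proof.
intros R0 H Ht; apply Ck2_cont in H; intros P [eps He].
destruct (H (t, 0)) with (eps := pos eps) as [d [d0 Hd]]; [split; cbn; auto; rewrite Rabs_R0; auto|apply cond_pos|].
exists (mkposreal d d0); intros s Hs; apply He; apply (Hd (s, 0)); cbn; auto.
now rewrite Rminus_diag, Rabs_R0.
Qed.

(* The solution of [M = G + m * (M o tau)] is the series of these terms. Its derivative solves the
   equation with [G' + m' * (M o tau)] and [m * tau'] in place of [G] and [m], so that smoothness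
   on one fixed interval follows by induction on the order. *)
Fixpoint contr_term (m G tau : R -> R) (k : nat) (t : R) : R :=
  match k with O => G t | S j => m t * contr_term m G tau j (tau t) end.

Section FunctionalEquation.
Variables (rad : R) (tau tau' : R -> R).
Hypothesis rad0 : 0 < rad.
Hypothesis tau_smooth : smooth_on (box rad) (fun p => tau (fst p)).
Hypothesis tau'_smooth : smooth_on (box rad) (fun p => tau' (fst p)).
Hypothesis tau_derive : forall t, Rabs t < rad -> is_derive tau t (tau' t).
Hypothesis tau_le : forall t, Rabs t < rad -> Rabs (tau t) <= Rabs t.
Hypothesis tau'_le : forall t, Rabs t < rad -> Rabs (tau' t) <= 1.

(** Boundedness is required on compact subintervals only, since smoothness on the open interval does
    not bound the derivatives up to its ends. As [tau] moves no point away from 0, each such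
    subinterval is stable under it. *)
Definition loc_bdd (M : R -> R) : Prop := forall a, 0 <= a < rad ->
  exists B, 0 <= B /\ forall t, Rabs t <= a -> Rabs (M t) <= B.

Lemma Ck2_tau n M : Ck2 n (box rad) (fun p => M (fst p)) -> Ck2 n (box rad) (fun p => M (tau (fst p))).
Proof.
intros H; apply (Ck2_comp n (box rad) (box rad) (fun p => M (fst p)) (fun p => tau (fst p)) (fun _ => 0)); auto.
- apply open_box.
- intros p [Hp _]; split; cbn; [|rewrite Rabs_R0; auto]; eapply Rle_lt_trans; [now apply tau_le|auto].
- apply Ck2_const.
Qed.

Lemma loc_bdd_Ck n M : Ck2 n (box rad) (fun p => M (fst p)) -> loc_bdd M.
Proof.
intros H a [a0 aR]; apply bounded_1d; auto; intros t Ht; apply (Ck2_fst_cont n rad M t); auto; lra.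
Qed.

Lemma contr_term_bound m G a B : a < rad -> 0 <= B ->
  (forall t, Rabs t < rad -> Rabs (m t) <= / 4) -> (forall t, Rabs t <= a -> Rabs (G t) <= B) ->
  forall k t, Rabs t <= a -> Rabs (contr_term m G tau k t) <= B * (/ 4) ^ k.
Proof.
intros aR B0 Hm HG; induction k as [|k IH]; intros t Ht; cbn [contr_term pow].
- rewrite Rmult_1_r; auto.
- rewrite Rabs_mult; replace (B * (/ 4 * (/ 4) ^ k)) with (/ 4 * (B * (/ 4) ^ k)) by ring.
  apply Rmult_le_compat; try apply Rabs_pos; [apply Hm; lra|apply IH].
  eapply Rle_trans; [apply tau_le; lra|auto].
Qed.

Lemma geom_ex B q : Rabs q < 1 -> ex_series (fun k => B * q ^ k).
Proof. intros H; apply (ex_series_scal_l B (fun k => q ^ k)), ex_series_geom, H. Qed.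

Lemma quarter_lt1 : Rabs (/ 4) < 1.
Proof. rewrite Rabs_pos_eq; lra. Qed.

Lemma contr_sum m G n s : sum_f_R0 (fun k => contr_term m G tau k s) (S n) =
  G s + m s * sum_f_R0 (fun k => contr_term m G tau k (tau s)) n.
Proof.
induction n as [|n IH]; [reflexivity|].
rewrite tech5, IH, tech5; cbn [contr_term]; ring.
Qed.

(** Iterating the equation leaves a remainder of size at most [B * (/ 4) ^ n]. Thus a locally
    bounded solution is unique and equals the series, whatever construction it comes from; this is
    what transfers to derivatives. *)
Lemma contr_series m G M : (forall t, Rabs t < rad -> Rabs (m t) <= / 4) -> loc_bdd M ->
  (forall t, Rabs t < rad -> M t = G t + m t * M (tau t)) ->
  forall t, Rabs t < rad -> is_series (fun k => contr_term m G tau k t) (M t).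
Proof.
intros Hm HM E t Ht; destruct (HM (Rabs t)) as [B [B0 HB]]; [split; [apply Rabs_pos|auto]|].
assert (W : forall n s, Rabs s <= Rabs t ->
  Rabs (M s - sum_f_R0 (fun k => contr_term m G tau k s) n) <= B * (/ 4) ^ S n).
{ induction n as [|n IH]; intros s Hs.
  - cbn [sum_f_R0 contr_term]; rewrite E by lra.
    replace (G s + m s * M (tau s) - G s) with (m s * M (tau s)) by ring.
    rewrite Rabs_mult, Rmult_comm; cbn [pow]; rewrite Rmult_1_r.
    apply Rmult_le_compat; try apply Rabs_pos; [apply HB|apply Hm; lra].
    eapply Rle_trans; [apply tau_le; lra|auto].
  - rewrite contr_sum, E by lra.
    replace (G s + m s * M (tau s) - _) with
      (m s * (M (tau s) - sum_f_R0 (fun k => contr_term m G tau k (tau s)) n)) by ring.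
    rewrite Rabs_mult; replace (B * (/ 4) ^ S (S n)) with (/ 4 * (B * (/ 4) ^ S n)) by (cbn; ring).
    apply Rmult_le_compat; try apply Rabs_pos; [apply Hm; lra|apply IH].
    eapply Rle_trans; [apply tau_le; lra|auto]. }
apply is_series_Reals; intros eps e0.
assert (L : is_lim_seq (fun n => B * (/ 4) ^ S n) 0).
{ replace (Finite 0) with (Rbar_mult B 0) by (cbn; f_equal; ring).
  apply is_lim_seq_scal_l, (is_lim_seq_incr_1 (fun n => (/ 4) ^ n)), is_lim_seq_geom, quarter_lt1. }
apply is_lim_seq_Reals in L; destruct (L eps e0) as [N HN]; exists N; intros n Hn.
specialize (HN n Hn); unfold Rdist in *; rewrite Rminus_0_r in HN; rewrite Rabs_minus_sym.
eapply Rle_lt_trans; [apply W; lra|]; eapply Rle_lt_trans; [apply Rle_abs|exact HN].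
Qed.

Lemma nbhd_inside t : Rabs t < rad -> exists a d, 0 <= a < rad /\ 0 < d /\
  forall s, Rabs (s - t) < d -> Rabs s <= a.
Proof.
intros Ht; exists ((Rabs t + rad) / 2), ((rad - Rabs t) / 2); pose proof (Rabs_pos t).
split; [lra|split; [lra|]]; intros s Hs.
pose proof (Rabs_triang (s - t) t) as T; replace (s - t + t) with s in T by ring; lra.
Qed.

Lemma contr_cont m G M : (forall t, Rabs t < rad -> Rabs (m t) <= / 4) -> loc_bdd M ->
  (forall t, Rabs t < rad -> M t = G t + m t * M (tau t)) ->
  Ck2 0 (box rad) (fun p => m (fst p)) -> Ck2 0 (box rad) (fun p => G (fst p)) ->
  cont2_on (box rad) (fun p => M (fst p)).
Proof.
intros Hm HM E Cm CG; apply cont2_onE; intros p Hp.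
destruct (nbhd_inside (fst p) (proj1 Hp)) as [a [d [aR [d0 Hd]]]].
destruct (loc_bdd_Ck 0 G CG a aR) as [B [B0 HB]].
assert (CT : forall k, Ck2 0 (box rad) (fun p => contr_term m G tau k (fst p))).
{ induction k as [|k IH]; [exact CG|].
  apply (Ck2_mult 0 (box rad) (fun p => m (fst p)) (fun p => contr_term m G tau k (tau (fst p)))); auto.
  now apply (Ck2_tau 0 (contr_term m G tau k)). }
destruct (open_box rad p Hp) as [d' [d0' Hd']].
apply (continuous_ext_box (fun q => Series (fun k => contr_term m G tau k (fst q))) _ p d' d0').
- intros q H1 H2; apply is_series_unique, contr_series; auto; apply (Hd' q H1 H2).
- apply (Series_continuous _ (fun k => B * (/ 4) ^ k) p d); auto.
  + apply geom_ex, quarter_lt1.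
  + intros k q H1 _; apply (contr_term_bound m G a B); auto; lra.
  + intros k; apply (proj1 (cont2_onE _ _) (Ck2_cont 0 _ _ (CT k))); auto.
Qed.

Lemma contr_derive m m' G G' M : (forall t, Rabs t < rad -> Rabs (m t) <= / 4) -> loc_bdd M ->
  (forall t, Rabs t < rad -> M t = G t + m t * M (tau t)) ->
  (forall t, Rabs t < rad -> is_derive m t (m' t)) -> (forall t, Rabs t < rad -> is_derive G t (G' t)) ->
  loc_bdd G -> loc_bdd m' -> loc_bdd G' ->
  exists N, loc_bdd N /\ forall t, Rabs t < rad -> is_derive M t (N t).
Proof.
intros Hm HM E Dm DG bG bm' bG'.
set (D := contr_term m G tau).
set (Ed := fix Ed k t := match k with O => G' t
  | S j => m' t * D j (tau t) + m t * (tau' t * Ed j (tau t)) end).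
assert (DD : forall k t, Rabs t < rad -> is_derive (D k) t (Ed k t)).
{ induction k as [|k IH]; intros t Ht; [now apply DG|].
  apply (is_derive_mult m (fun t => D k (tau t))); [now apply Dm| |intros; apply Rmult_comm].
  apply (is_derive_comp (D k) tau); [apply IH|now apply tau_derive].
  eapply Rle_lt_trans; [now apply tau_le|auto]. }
assert (EB : forall a, 0 <= a < rad -> exists C, 0 <= C /\
  forall k t, Rabs t <= a -> Rabs (Ed k t) <= C * (/ 2) ^ k).
{ intros a Ha; destruct (bG a Ha) as [B [B0 HB]], (bm' a Ha) as [B1 [B10 HB1]],
    (bG' a Ha) as [B2 [B20 HB2]].
  (* The product rule spoils the rate 1/4, so the weaker rate 1/2 is claimed. For a constant [C] the
     recursion gives [(B1 * B + C / 4) * (/ 2) ^ k], which is at most [(C / 2) * (/ 2) ^ k] once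
     [C >= 4 * (B1 * B)]; the summand [B2] starts the induction. *)
  exists (B2 + 4 * (B1 * B)); split; [nra|].
  induction k as [|k IH]; intros t Ht; cbn [Ed pow].
  - specialize (HB2 t Ht); nra.
  - assert (Ht' : Rabs (tau t) <= a) by (eapply Rle_trans; [apply tau_le; lra|auto]).
    specialize (IH _ Ht').
    pose proof (contr_term_bound m G a B (proj2 Ha) B0 Hm HB k _ Ht') as K; fold D in K.
    assert (P : (/ 4) ^ k <= (/ 2) ^ k) by (apply pow_incr; lra).
    assert (P0 : 0 <= (/ 4) ^ k) by (apply pow_le; lra).
    set (x := (/ 2) ^ k) in *; set (y := (/ 4) ^ k) in *.
    eapply Rle_trans; [apply Rabs_triang|]; rewrite !Rabs_mult.
    specialize (HB1 t Ht); specialize (Hm t ltac:(lra)).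
    pose proof (tau'_le t ltac:(lra)) as T.
    assert (K1 : Rabs (m' t) * Rabs (D k (tau t)) <= B1 * (B * x)).
    { apply Rmult_le_compat; try apply Rabs_pos; auto; nra. }
    assert (K2 : Rabs (m t) * (Rabs (tau' t) * Rabs (Ed k (tau t))) <= / 4 * (1 * ((B2 + 4 * (B1 * B)) * x))).
    { apply Rmult_le_compat; try apply Rabs_pos; auto.
      - apply Rmult_le_pos; apply Rabs_pos.
      - apply Rmult_le_compat; try apply Rabs_pos; auto. }
    assert (0 <= B2 * x) by (apply Rmult_le_pos; lra).
    lra. }
assert (hq : Rabs (/ 2) < 1) by (rewrite Rabs_pos_eq; lra).
exists (fun t => Series (fun k => Ed k t)); split.
- intros a Ha; destruct (EB a Ha) as [C [C0 HC]]; exists (Series (fun k => C * (/ 2) ^ k)).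
  assert (X : forall t, Rabs t <= a -> Rabs (Series (fun k => Ed k t)) <= Series (fun k => C * (/ 2) ^ k)).
  { intros t Ht; apply Series_dom; [intros k; now apply HC|now apply geom_ex]. }
  split; auto; eapply Rle_trans; [apply Rabs_pos|apply (X 0)]; rewrite Rabs_R0; lra.
- intros t Ht; destruct (nbhd_inside t Ht) as [a [d [aR [d0 Hd]]]].
  destruct (EB a aR) as [C [C0 HC]].
  apply (is_derive_ext_near (fun s => Series (fun k => D k s)) _ t d); auto.
  + intros s Hs; apply is_series_unique, contr_series; auto; specialize (Hd s Hs); lra.
  + apply (Series_derive D Ed (fun k => C * (/ 2) ^ k) t d); auto.
    * now apply geom_ex.
    * intros s Hs; specialize (Hd s Hs); exists (M s); apply contr_series; auto; lra.
    * intros k s Hs; apply DD; specialize (Hd s Hs); lra.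
Qed.

Lemma contr_smooth n : forall m G M, (forall t, Rabs t < rad -> Rabs (m t) <= / 4) -> loc_bdd M ->
  (forall t, Rabs t < rad -> M t = G t + m t * M (tau t)) ->
  Ck2 n (box rad) (fun p => m (fst p)) -> Ck2 n (box rad) (fun p => G (fst p)) ->
  Ck2 n (box rad) (fun p => M (fst p)).
Proof.
induction n as [|n IH]; intros m G M Hm HM E Cm CG; [split; auto; now apply (contr_cont m G)|].
assert (CM : Ck2 n (box rad) (fun p => M (fst p))) by (apply (IH m G M); auto using Ck2_pred).
destruct (Ck2_fst_S n rad m rad0 Cm) as [m' [Dm Cm']]; destruct (Ck2_fst_S n rad G rad0 CG) as [G' [DG CG']].
destruct (contr_derive m m' G G' M) as [N [bN DN]]; auto; try (now apply (loc_bdd_Ck n));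
  [now apply (loc_bdd_Ck (S n))|].
assert (CN : Ck2 n (box rad) (fun p => N (fst p))).
(* The bound [|tau'| <= 1] keeps the new multiplier below 1/4, so the induction hypothesis applies
   to the differentiated equation without shrinking the interval. *)
{ apply (IH (fun t => m t * tau' t) (fun t => G' t + m' t * M (tau t))); auto.
  - intros t Ht; rewrite Rabs_mult; specialize (Hm t Ht); pose proof (tau'_le t Ht).
    pose proof (Rabs_pos (m t)); pose proof (Rabs_pos (tau' t)); nra.
  - intros t Ht; pose proof (is_derive_unique _ _ _ (DN t Ht)) as U; rewrite <- U.
    apply is_derive_unique; destruct (nbhd_inside t Ht) as [a [d [aR [d0 Hd]]]].
    apply (is_derive_ext_near (fun s => G s + m s * M (tau s)) _ t d); auto.
    + intros s Hs; symmetry; apply E; specialize (Hd s Hs); lra.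
    + replace (G' t + m' t * M (tau t) + m t * tau' t * N (tau t)) with
        (G' t + (m' t * M (tau t) + m t * (tau' t * N (tau t)))) by ring.
      apply @is_derive_plus; [now apply DG|].
      apply (is_derive_mult m (fun t => M (tau t))); [now apply Dm| |intros; apply Rmult_comm].
      apply (is_derive_comp M tau); [apply DN|now apply tau_derive].
      eapply Rle_lt_trans; [now apply tau_le|auto].
  - apply (Ck2_mult n _ (fun p => m (fst p)) (fun p => tau' (fst p))); auto using Ck2_pred.
  - apply (Ck2_plus n _ (fun p => G' (fst p)) (fun p => m' (fst p) * M (tau (fst p)))); auto.
    apply (Ck2_mult n _ (fun p => m' (fst p)) (fun p => M (tau (fst p)))); auto.
    now apply Ck2_tau. }
split; [now apply (Ck2_cont n)|].
exists (fun p => N (fst p)), (fun _ => 0); split; [|split; auto; apply Ck2_const].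
intros p [Hp _]; cbn [fst snd]; split; [now apply DN|apply @is_derive_const].
Qed.

Lemma contr_solve G : smooth_on (box rad) (fun p => G (fst p)) ->
  exists L, smooth_on (box rad) (fun p => L (fst p)) /\
    forall t, Rabs t < rad -> L t = G t + / 4 * L (tau t).
Proof.
intros SG; set (D := contr_term (fun _ => / 4) G tau).
assert (q4 : forall t, Rabs t < rad -> Rabs (/ 4) <= / 4) by (intros; rewrite Rabs_pos_eq; lra).
assert (DB : forall a, 0 <= a < rad -> exists B, 0 <= B /\
  forall k t, Rabs t <= a -> Rabs (D k t) <= B * (/ 4) ^ k).
{ intros a Ha; destruct (loc_bdd_Ck 0 G (SG 0%nat) a Ha) as [B [B0 HB]]; exists B; split; auto.
  intros k t Ht; apply (contr_term_bound (fun _ => / 4) G a B); auto; lra. }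
assert (DE : forall t, Rabs t < rad -> ex_series (fun k => D k t)).
{ intros t Ht; destruct (DB (Rabs t)) as [B [B0 HB]]; [split; [apply Rabs_pos|auto]|].
  apply (ex_series_dom _ (fun k => B * (/ 4) ^ k)); [intros k; apply HB; lra|apply geom_ex, quarter_lt1]. }
set (L := fun t => Series (fun k => D k t)).
assert (E : forall t, Rabs t < rad -> L t = G t + / 4 * L (tau t)).
{ intros t Ht; unfold L; rewrite (Series_incr_1 _ (DE t Ht)); cbn [D contr_term].
  now rewrite <- Series_scal_l. }
exists L; split; auto; intros n; apply (contr_smooth n (fun _ => / 4) G L); auto; [|apply Ck2_const].
intros a Ha; destruct (DB a Ha) as [B [B0 HB]]; exists (Series (fun k => B * (/ 4) ^ k)).
assert (X : forall t, Rabs t <= a -> Rabs (L t) <= Series (fun k => B * (/ 4) ^ k)).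
{ intros t Ht; apply Series_dom; [intros k; now apply HB|apply geom_ex, quarter_lt1]. }
split; auto; eapply Rle_trans; [apply Rabs_pos|apply (X 0)]; rewrite Rabs_R0; lra.
Qed.

End FunctionalEquation.

(** Since [tau] has derivative 0 at the origin, [|tau'| < 1] near it, and [|tau t| <= |t|] follows
    by the mean value theorem. This first-order condition alone fixes the interval for all
    orders. *)
Lemma functional_equation tau G : smooth2 (fun p => tau (fst p)) -> smooth2 (fun p => G (fst p)) ->
  tau 0 = 0 -> Derive tau 0 = 0 ->
  exists L, smooth2 (fun p => L (fst p)) /\ near0_1 (fun t => L t = G t + / 4 * L (tau t)).
Proof.
intros ST SG t0 dt0.
destruct (smooth2_d _ ST) as [ST1 _].
assert (N : near0_2 (fun p => Rabs (d1 (fun p => tau (fst p)) p) < 1)).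
{ generalize (smooth2_near _ 1 ST1 Rlt_0_1); apply near0_2_imp; intros p.
  replace (d1 (fun p => tau (fst p)) (0, 0)) with 0 by (symmetry; exact dt0).
  now rewrite Rminus_0_r. }
destruct (smooth2_shrink _ _ ST N) as [r [r0 [S1 B]]].
destruct SG as [s [s0 SG]].
set (R := Rmin r s); assert (R0 : 0 < R) by (now apply Rmin_glb_lt).
apply (smooth_on_box_le r R) in S1; [|apply Rmin_l].
apply (smooth_on_box_le s R) in SG; [|apply Rmin_r].
assert (D : forall t, Rabs t < R -> is_derive tau t (Derive tau t)).
{ intros t Ht; destruct (smooth_on_derive _ _ (open_box R) S1) as [_ [_ D]].
  apply (D (t, 0)); split; cbn; auto; rewrite Rabs_R0; auto. }
assert (T1 : forall t, Rabs t < R -> Rabs (Derive tau t) <= 1).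
{ intros t Ht; apply Rlt_le, (B (t, 0)); pose proof (Rmin_l r s); fold R in H.
  split; cbn; [lra|rewrite Rabs_R0; lra]. }
destruct (contr_solve R tau (Derive tau) R0) with (G := G) as [L [SL E]]; auto.
- apply (smooth_on_derive _ _ (open_box R) S1).
- intros t Ht; destruct (MVT_abs tau (Derive tau) 0 t R) as [c [Hc E]].
  + intros x; rewrite Rminus_0_r; apply D.
  + now rewrite Rminus_0_r.
  + rewrite t0, !Rminus_0_r in *; rewrite E, Rabs_mult.
    specialize (T1 c ltac:(lra)); pose proof (Rabs_pos t); nra.
- exists L; split; [exists R; auto|exists R; auto].
Qed.

(** * Germs in one variable *)

(** Regarding a germ in one variable as a function of two that ignores the second makes the whole
    calculus of [smooth2] available. *)
Definition germ1 (h : R -> R) : Prop := smooth2 (fun p => h (fst p)).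

Lemma near0_1_and P Q : near0_1 P -> near0_1 Q -> near0_1 (fun t => P t /\ Q t).
Proof.
intros HP HQ; exact (near0_1_fst _ (near0_2_and _ _ (near0_2_fst P HP) (near0_2_fst Q HQ))).
Qed.

Lemma near0_1_imp (P Q : R -> Prop) : (forall t, P t -> Q t) -> near0_1 P -> near0_1 Q.
Proof. intros PQ [r [r0 H]]; exists r; auto. Qed.

Lemma near0_1_0 P : near0_1 P -> P 0.
Proof. intros [r [r0 H]]; apply H; rewrite Rabs_R0; exact r0. Qed.

Lemma near0_1_pull P f : germ1 f -> f 0 = 0 -> near0_1 P -> near0_1 (fun t => P (f t)).
Proof. intros F f0 H; exact (near0_1_fst _ (near0_2_pull1 P _ F f0 H)). Qed.

Lemma near0_2_snd P : near0_1 P -> near0_2 (fun p => P (snd p)).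
Proof. intros [r [r0 H]]; exists r; split; auto; intros p [_ H1]; auto. Qed.

Lemma germ1_fst f : smooth2 f -> germ1 (fun t => f (t, 0)).
Proof.
intros F; apply (smooth2_comp f (fun p => fst p) (fun _ => 0)); auto;
  [apply smooth2_fst|apply smooth2_const].
Qed.

Lemma germ1_snd f : smooth2 f -> germ1 (fun t => f (0, t)).
Proof.
intros F; apply (smooth2_comp f (fun _ => 0) (fun p => fst p)); auto;
  [apply smooth2_const|apply smooth2_fst].
Qed.

Lemma germ1_comp h f : f 0 = 0 -> germ1 h -> germ1 f -> germ1 (fun t => h (f t)).
Proof. intros f0 H F; now apply (smooth2_comp1 h (fun p => f (fst p))). Qed.

Lemma germ1_smooth1 h : germ1 h -> smooth1 h.
Proof. exact (smooth2_smooth1 (fun p => h (fst p))). Qed.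

Lemma germ1_near_pos h : germ1 h -> 0 < h 0 -> near0_1 (fun t => 0 < h t).
Proof. intros H h0; exact (near0_1_fst _ (smooth2_gt0 _ H h0)). Qed.

Lemma germ1_inverse h : germ1 h -> h 0 = 0 -> Derive h 0 <> 0 ->
  exists g, germ1 g /\ g 0 = 0 /\ near0_1 (fun t => g (h t) = t) /\ near0_1 (fun t => h (g t) = t).
Proof.
intros H h0 dh.
destruct (implicit_function (fun p => h (fst p)) H h0 dh) as [X [SX [X0 [E1 E2]]]].
exists (fun t => X (t, 0)); split; [now apply germ1_fst|split; [auto|split]].
- exact (near0_1_fst _ E2).
- exact (near0_1_fst _ E1).
Qed.

Lemma diffeo1_intro h g : germ1 h -> h 0 = 0 -> germ1 g -> g 0 = 0 ->
  near0_1 (fun t => g (h t) = t) -> near0_1 (fun t => h (g t) = t) -> diffeo1 h.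
Proof.
intros H h0 G g0 E1 E2; split; [now apply germ1_smooth1|split; auto].
exists g; split; [now apply germ1_smooth1|auto].
Qed.

Lemma diffeo1_comp h k : diffeo1 h -> diffeo1 k -> diffeo1 (fun t => k (h t)).
Proof.
intros [H [h0 [h' [H' [h0' [E1 E2]]]]]] [K [k0 [k' [K' [k0' [E3 E4]]]]]].
apply smooth1_smooth2 in H, H', K, K'.
apply (diffeo1_intro _ (fun t => h' (k' t))).
- now apply (germ1_comp k h).
- now rewrite h0.
- now apply (germ1_comp h' k').
- now rewrite k0'.
- generalize (near0_1_and _ _ E1 (near0_1_pull _ h H h0 E3)); apply near0_1_imp.
  intros t [Q1 Q2]; now rewrite Q2.
- generalize (near0_1_and _ _ E4 (near0_1_pull _ k' K' k0' E2)); apply near0_1_imp.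
  intros t [Q1 Q2]; now rewrite Q2.
Qed.

Lemma diffeo1_of_derive h : germ1 h -> h 0 = 0 -> Derive h 0 <> 0 -> diffeo1 h.
Proof.
intros H h0 dh; destruct (germ1_inverse h H h0 dh) as [g [G [g0 [E1 E2]]]].
now apply (diffeo1_intro h g).
Qed.

Lemma Derive_id_mult u : germ1 u -> Derive (fun t => t * u t) 0 = u 0.
Proof.
intros U; destruct (d_mult0 (fun p => fst p) (fun p => u (fst p)) smooth2_fst U) as [D _].
destruct (d_fst (0, 0)) as [D1 _]; rewrite D1 in D; cbn [fst] in D.
change (d1 (fun p => fst p * u (fst p)) (0, 0)) with (Derive (fun t => t * u t) 0) in D.
rewrite D; ring.
Qed.

(** At [t = 0], where division fails, the value [u 0] is recovered as the derivative of
    [t * u t]. *)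
Lemma near0_1_cancel u w : germ1 u -> germ1 w -> near0_1 (fun t => t * u t = t * w t) ->
  near0_1 (fun t => u t = w t).
Proof.
intros U W [r [r0 E]]; exists r; split; auto; intros t Ht.
destruct (Req_dec t 0) as [->|N]; [|now apply (Rmult_eq_reg_l t); auto].
rewrite <- Derive_id_mult, <- (Derive_id_mult w) by auto.
apply Derive_ext_loc; exists (mkposreal r r0); intros s Hs; apply E.
change (Rabs (s - 0) < r) in Hs; now rewrite Rminus_0_r in Hs.
Qed.

Lemma germ1_div h : germ1 h -> h 0 = 0 ->
  exists g, germ1 g /\ near0_1 (fun t => h t = t * g t) /\ g 0 = Derive h 0.
Proof.
intros H h0.
destruct (germ_div_fst (fun p => h (fst p)) H) as [g [G [E _]]].
- now apply near0_2_true.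
- exists 1; split; [lra|intros; exact h0].
- assert (E1 := near0_1_fst _ E); cbn [fst] in E1.
  exists (fun t => g (t, 0)); split; [now apply germ1_fst|split; auto].
  rewrite <- (Derive_id_mult (fun t => g (t, 0))) by now apply germ1_fst.
  destruct E1 as [r [r0 E1]]; symmetry; apply Derive_ext_loc; exists (mkposreal r r0).
  intros s Hs; apply E1; change (Rabs (s - 0) < r) in Hs; now rewrite Rminus_0_r in Hs.
Qed.

Lemma diffeo1_id_mult u : germ1 u -> u 0 <> 0 -> diffeo1 (fun t => t * u t).
Proof.
intros U u0; apply diffeo1_of_derive; [|ring|now rewrite Derive_id_mult].
apply smooth2_mult; [apply smooth2_fst|exact U].
Qed.

Lemma diffeo2_diag u v : smooth2 u -> smooth2 v -> u (0, 0) <> 0 -> v (0, 0) <> 0 ->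
  diffeo2 (fun p => (fst p * u p, snd p * v p)).
Proof.
intros U V u0 v0; apply inverse_function.
- split; [split; apply smooth2_mult; auto; [apply smooth2_fst|apply smooth2_snd]|].
  cbn [fst snd]; f_equal; ring.
- unfold jac_det, comp1, comp2; cbn [fst snd].
  destruct (d_mult0 (fun p => fst p) u smooth2_fst U) as [A1 A2].
  destruct (d_mult0 (fun p => snd p) v smooth2_snd V) as [B1 B2].
  destruct (d_fst (0, 0)) as [C1 C2], (d_snd (0, 0)) as [D1 D2].
  rewrite A1, A2, B1, B2, C1, C2, D1, D2; cbn [fst snd].
  replace (_ - _) with (u (0, 0) * v (0, 0)) by ring.
  now apply Rmult_integral_contrapositive.
Qed.

(** * The normal form for a pair of standard folds *)

(* Prescribing [b (0, Y)] also for [Y < 0], where it is not determined by [P], makes the condition on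
   [c] in [fold_pair_normal_form] a functional equation. *)
Lemma even_odd_split P c : smooth2 P -> germ1 c ->
  near0_1 (fun y => P (0, y) = y * c (y ^ 2)) ->
  exists A b, smooth2 A /\ smooth2 b /\
    near0_2 (fun p => P p = fst p * A (fst p, snd p ^ 2) + snd p * b (fst p, snd p ^ 2)) /\
    near0_1 (fun y => b (0, y) = c y).
Proof.
intros SP Sc E0.
assert (Sn : smooth2 (fun p => - snd p)) by (apply smooth2_opp, smooth2_snd).
assert (SP' : smooth2 (fun p => P (fst p, - snd p))).
{ apply smooth2_comp; auto; [cbn; ring|apply smooth2_fst]. }
assert (E0' : near0_1 (fun y => P (0, - y) = - y * c (y ^ 2))).
{ assert (G : germ1 (fun t => - t)) by (apply smooth2_opp, smooth2_fst).
  generalize (near0_1_pull _ _ G Ropp_0 E0); apply near0_1_imp; intros t.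
  now replace ((- t) ^ 2) with (t ^ 2) by ring. }
set (e := fun p => / 2 * (P p + P (fst p, - snd p))).
set (o := fun p => / 2 * (P p - P (fst p, - snd p))).
assert (Se : smooth2 e) by (apply smooth2_mult; [apply smooth2_const|now apply smooth2_plus]).
assert (So : smooth2 o) by (apply smooth2_mult; [apply smooth2_const|now apply smooth2_minus]).
(* The even part vanishes on the line [x = 0] because [P (0, y)] is odd; hence it is divisible by
   [x]. *)
destruct (germ_div_fst e Se) as [e' [Se' [Ee Eve]]].
{ apply near0_2_true; intros [x y]; unfold e; cbn [fst snd]; rewrite Ropp_involutive; ring. }
{ generalize (near0_1_and _ _ E0 E0'); apply near0_1_imp; intros y [Q1 Q2]; unfold e; cbn [fst snd].
  rewrite Q1, Q2; ring. }
destruct (whitney_even e' Se' Eve) as [A [SA [EA _]]].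
destruct (germ_div_odd o So) as [o' [So' [Eo Evo]]].
{ apply near0_2_true; intros [x y]; unfold o; cbn [fst snd]; rewrite Ropp_involutive; ring. }
assert (Sq : smooth2 (fun p => snd p ^ 2)) by (apply smooth2_pow, smooth2_snd).
assert (q0 : 0 ^ 2 = 0) by ring.
assert (Sc2 : smooth2 (fun p => c (snd p ^ 2))) by (apply (smooth2_comp1 c (fun p => snd p ^ 2)); auto).
assert (Eo0 : near0_1 (fun y => o' (0, y) = c (y ^ 2))).
{ apply near0_1_cancel.
  - now apply germ1_snd.
  - now apply (germ1_comp c (fun t => t ^ 2)); auto; apply smooth2_pow, smooth2_fst.
  - generalize (near0_1_and _ _ (near0_1_snd _ Eo) (near0_1_and _ _ E0 E0')); apply near0_1_imp.
    cbn [fst snd]; intros y [<- [Q1 Q2]]; unfold o; cbn [fst snd]; rewrite Q1, Q2; field. }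
(* Subtracting [c (y ^ 2)] makes the germ vanish on [x = 0], so its Whitney function [B] vanishes at
   [(0, Y)] for both signs of [Y]. Adding back [c Y] gives [b (0, Y) = c Y] everywhere near 0. *)
destruct (whitney_even (fun p => o' p - c (snd p ^ 2))) as [B [SB [EB ZB]]].
{ now apply smooth2_minus. }
{ revert Evo; apply near0_2_imp; intros [x y]; cbn [fst snd]; intros ->.
  now replace ((- y) ^ 2) with (y ^ 2) by ring. }
exists A, (fun p => B p + c (snd p)); split; [auto|split; [|split]].
- apply smooth2_plus; auto; apply (smooth2_comp1 c (fun p => snd p)); auto; apply smooth2_snd.
- generalize (near0_2_and _ _ (near0_2_and _ _ Ee EA) (near0_2_and _ _ Eo EB)); apply near0_2_imp.
  intros [x y] [[Q1 Q2] [Q3 Q4]]; cbn [fst snd] in *.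
  rewrite <- Q2, <- Q4; replace (o' (x, y) - c (y ^ 2) + c (y ^ 2)) with (o' (x, y)) by ring.
  rewrite <- Q1, <- Q3; unfold e, o; cbn [fst snd]; field.
- assert (Z : near0_1 (fun y => B (0, y) = 0)).
  { apply ZB; revert Eo0; apply near0_1_imp; cbn [snd]; intros y ->; ring. }
  revert Z; apply near0_1_imp; cbn [snd]; intros y ->; ring.
Qed.

Definition sign1 (x : R) : R := if Rlt_dec 0 x then 1 else -1.

Lemma sign1_mult_pos x : x <> 0 -> 0 < sign1 x * x.
Proof. intros N; unfold sign1; destruct (Rlt_dec 0 x); lra. Qed.

Lemma sign1_sq x : sign1 x * sign1 x = 1.
Proof. unfold sign1; destruct (Rlt_dec 0 x); ring. Qed.

(* Writing [c = exp L], the last conclusion becomes [L y = k y + / 4 * L (tau y)] with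
   [tau y = G (s y ^ 2, 0) ^ 2] of order 4 at 0. *)
Lemma scaling_exists G s : smooth2 G -> G (0, 0) = 0 -> d1 G (0, 0) <> 0 ->
  germ1 s -> s 0 = 0 -> Derive s 0 <> 0 ->
  exists c g, germ1 c /\ (forall t, 0 < c t) /\ germ1 g /\
    near0_1 (fun x => G (x, 0) = x * g x) /\ 0 < sign1 (d1 G (0, 0)) * g 0 /\
    near0_1 (fun y => y * c y ^ 2 = sign1 (Derive s 0) * s y *
      sqrt (sign1 (d1 G (0, 0)) * g (s y ^ 2) * c (G (s y ^ 2, 0) ^ 2))).
Proof.
intros SG G0 dG Ss s0 ds.
destruct (germ1_div (fun t => G (t, 0))) as [g [Sg [Eg g0]]]; [now apply germ1_fst|auto|].
destruct (germ1_div s Ss s0) as [v [Sv [Ev v0]]].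
change (Derive (fun t => G (t, 0)) 0) with (d1 G (0, 0)) in g0.
set (s1 := sign1 (d1 G (0, 0))); set (ep := sign1 (Derive s 0)).
assert (g0' : 0 < s1 * g 0) by (rewrite g0; now apply sign1_mult_pos).
assert (v0' : 0 < ep * v 0) by (rewrite v0; now apply sign1_mult_pos).
assert (Ss2 : germ1 (fun y => s y ^ 2)) by (now apply smooth2_pow).
assert (s20 : s 0 ^ 2 = 0) by (rewrite s0; ring).
assert (Sw : germ1 (fun y => G (s y ^ 2, 0))).
{ now apply (germ1_comp (fun t => G (t, 0)) (fun y => s y ^ 2)); [|apply germ1_fst|]. }
set (tau := fun y => G (s y ^ 2, 0) ^ 2).
assert (St : germ1 tau) by (now apply smooth2_pow).
assert (w0 : G (s 0 ^ 2, 0) = 0) by (now rewrite s20).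
assert (t0 : tau 0 = 0) by (unfold tau; rewrite w0; ring).
assert (Sg2 : germ1 (fun y => s1 * g (s y ^ 2))).
{ apply smooth2_mult; [apply smooth2_const|]; now apply (germ1_comp g (fun y => s y ^ 2)). }
assert (Sev : germ1 (fun y => ep * v y)) by (apply smooth2_mult; [apply smooth2_const|auto]).
assert (gp : 0 < s1 * g (s 0 ^ 2)) by (now rewrite s20).
(* Divide the desired equation by [y], using [s y = y * v y], and take logarithms:
   [2 L y = ln (...) + / 2 * L (tau y)]. The signs [ep] and [s1] make the arguments of the logarithm
   and of the square root positive. *)
set (k := fun y => / 2 * ln (ep * v y * sqrt (s1 * g (s y ^ 2)))).
assert (Sk : germ1 k).
{ apply smooth2_mult; [apply smooth2_const|].
  apply (smooth2_ln (fun p => ep * v (fst p) * sqrt (s1 * g (s (fst p) ^ 2)))); cbn [fst].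
  - apply Rmult_lt_0_compat; auto; now apply sqrt_lt_R0.
  - apply smooth2_mult; auto; now apply (smooth2_sqrt (fun p => s1 * g (s (fst p) ^ 2))). }
(* The remaining hypothesis [Derive tau 0 = 0] holds because [tau] is the square of a germ vanishing
   at 0. *)
destruct (functional_equation tau k St Sk t0) as [L [SL EL]].
{ destruct (d_mult0 (fun p => G (s (fst p) ^ 2, 0)) (fun p => G (s (fst p) ^ 2, 0)) Sw Sw) as [D _].
  cbn [fst] in D; rewrite w0 in D; transitivity (d1 (fun p => G (s (fst p) ^ 2, 0) * G (s (fst p) ^ 2, 0)) (0, 0)).
  - unfold d1; cbn [fst snd]; apply Derive_ext; intros t; unfold tau; ring.
  - rewrite D; ring. }
exists (fun t => exp (L t)), g.
split; [now apply smooth2_exp|split; [intros; apply exp_pos|split; [auto|split; [auto|split; [auto|]]]]].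
generalize (near0_1_and _ _ (near0_1_and _ _ EL Ev) (near0_1_and _ _ (germ1_near_pos _ Sg2 gp)
  (germ1_near_pos _ Sev v0'))); apply near0_1_imp.
intros y [[Q1 Q2] [Q3 Q4]]; fold (tau y).
rewrite sqrt_mult by (try apply Rlt_le, exp_pos; lra).
replace (sqrt (exp (L (tau y)))) with (exp (/ 2 * L (tau y))).
- replace (exp (L y) ^ 2) with (exp (L y + L y)) by (rewrite exp_plus; ring).
  rewrite Q1; unfold k.
  set (z := ep * v y * sqrt (s1 * g (s y ^ 2))).
  replace (/ 2 * ln z + / 4 * L (tau y) + (/ 2 * ln z + / 4 * L (tau y)))
    with (ln z + / 2 * L (tau y)) by field.
  rewrite exp_plus, exp_ln.
  + unfold z; rewrite Q2 at 2; ring.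
  + apply Rmult_lt_0_compat; auto; now apply sqrt_lt_R0.
- replace (L (tau y)) with (/ 2 * L (tau y) + / 2 * L (tau y)) at 2 by field.
  rewrite exp_plus, sqrt_square; auto; apply Rlt_le, exp_pos.
Qed.

(** All four nonvanishing partial derivatives are used: each restriction of [F1] and [F2] to an axis
    is then a local diffeomorphism of the line, and these restrictions determine the data [g], [s]
    and [tau] of the equation for [c]. *)
Lemma fold_pair_normal_form F1 F2 : fgerm F1 -> fgerm F2 ->
  d1 F1 (0, 0) <> 0 -> d2 F1 (0, 0) <> 0 -> d1 F2 (0, 0) <> 0 -> d2 F2 (0, 0) <> 0 ->
  exists theta, fgerm theta /\
    near0_2 (fun p => theta (fst p, 0) = 0 /\ theta (0, snd p) = 0) /\
    diagram_equiv F1 (fun p => (fst p, snd p ^ 2)) F2 (fun p => (fst p ^ 2, snd p))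
      (fun p => fst p + snd p) (fun p => (fst p, snd p ^ 2))
      (fun p => fst p + snd p + theta p) (fun p => (fst p ^ 2, snd p)).
Proof.
intros [SF1 F10] [SF2 F20] a1 b1 a2 b2.
(* [psi] reparametrises the target of [F1] so that [G = psi o F1] satisfies [G (0, y) = y]. The
   germs [bi] and [ai] invert the restrictions of [F2] to the axes [x = 0] and [y = 0]. *)
destruct (germ1_inverse (fun t => F1 (0, t)) (germ1_snd _ SF1) F10 b1) as [psi [Spsi [psi0 [Ep1 Ep2]]]].
destruct (germ1_inverse (fun t => F2 (0, t)) (germ1_snd _ SF2) F20 b2) as [bi [Sbi [bi0 [Eb1 Eb2]]]].
destruct (germ1_inverse (fun t => F2 (t, 0)) (germ1_fst _ SF2) F20 a2) as [ai [Sai [ai0 [Ea1 Ea2]]]].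
set (G := fun p => psi (F1 p)).
assert (SG : smooth2 G) by (now apply smooth2_comp1).
assert (G0 : G (0, 0) = 0) by (unfold G; now rewrite F10).
assert (EG : near0_1 (fun y => G (0, y) = y)) by exact Ep1.
assert (inv_derive : forall h g : R -> R, germ1 h -> h 0 = 0 -> germ1 g ->
  near0_1 (fun t => g (h t) = t) -> Derive g 0 * Derive h 0 = 1).
{ intros h g Sh h0 Sg [r [r0 E]].
  destruct (near0_2_0 _ (proj2 (proj2 (smooth2_d _ Sh)))) as [Dh _].
  destruct (near0_2_0 _ (proj2 (proj2 (smooth2_d _ Sg)))) as [Dg _]; cbn [fst snd] in Dh, Dg.
  rewrite <- h0 in Dg at 1.
  pose proof (is_derive_unique _ _ _ (is_derive_comp g h 0 _ _ Dg Dh)) as D.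
  change (Derive (fun x => g (h x)) 0 = Derive h 0 * Derive g 0) in D.
  rewrite Rmult_comm, <- D, <- (Derive_id 0); apply Derive_ext_loc; exists (mkposreal r r0).
  intros t Ht; apply E; change (Rabs (t - 0) < r) in Ht; now rewrite Rminus_0_r in Ht. }
assert (dG : d1 G (0, 0) <> 0).
{ destruct (near0_2_0 _ (near0_d_comp (fun p => psi (fst p)) F1 F1 F10 F10 Spsi SF1 SF1)) as [D _].
  cbn [fst] in D; fold G in D; rewrite D, F10.
  replace (d2 (fun p => psi (fst p)) (0, 0)) with 0 by (symmetry; apply (Derive_const (psi 0))).
  change (d1 (fun p => psi (fst p)) (0, 0)) with (Derive psi 0).
  pose proof (inv_derive _ _ (germ1_snd _ SF1) F10 Spsi Ep1) as I.
  rewrite Rmult_0_l, Rplus_0_r; apply Rmult_integral_contrapositive; split; auto.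
  intros Z; rewrite Z in I; lra. }
(* [(s y, 0)] is the point of the first axis on the same level of [F2] as [(0, y)]: there the two
   prescriptions for [h2] must agree. *)
set (s := fun y => ai (F2 (0, y))).
assert (Ss : germ1 s) by (apply (germ1_comp ai (fun y => F2 (0, y))); auto; now apply germ1_snd).
assert (s0 : s 0 = 0) by (unfold s; now rewrite F20).
assert (Es : near0_1 (fun y => bi (F2 (s y, 0)) = y)).
{ generalize (near0_1_and _ _ Eb1 (near0_1_pull _ _ (germ1_snd _ SF2) F20 Ea2)); apply near0_1_imp.
  intros y [Q1 Q2]; unfold s; now rewrite Q2. }
assert (Es' : near0_1 (fun x => s (bi (F2 (x, 0))) = x)).
{ generalize (near0_1_and _ _ Ea1 (near0_1_pull _ _ (germ1_fst _ SF2) F20 Eb2)); apply near0_1_imp.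
  intros x [Q1 Q2]; unfold s; now rewrite Q2. }
assert (Sx : germ1 (fun x => bi (F2 (x, 0)))).
{ apply (germ1_comp bi (fun x => F2 (x, 0))); auto; now apply germ1_fst. }
assert (x0 : bi (F2 (0, 0)) = 0) by (now rewrite F20).
assert (ds : Derive s 0 <> 0).
{ pose proof (inv_derive s (fun x => bi (F2 (x, 0))) Ss s0 Sx Es) as I.
  intros Z; rewrite Z in I; lra. }
destruct (scaling_exists G s SG G0 dG Ss s0 ds) as [c [g [Sc [c0 [Sg [Eg [g0 Esc]]]]]]].
set (s1 := sign1 (d1 G (0, 0))) in *; set (ep := sign1 (Derive s 0)) in *.
assert (s11 : s1 * s1 = 1) by apply sign1_sq.
assert (ep1 : ep * ep = 1) by apply sign1_sq.
assert (Sc' : germ1 (fun t => s1 * c t)) by (apply smooth2_mult; [apply smooth2_const|auto]).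
assert (Scq : germ1 (fun t => s1 * c (t ^ 2))).
{ apply (germ1_comp (fun t => s1 * c t) (fun t => t ^ 2)); auto; [ring|].
  apply smooth2_pow, smooth2_fst. }
(* [k] is odd, so [P (0, y) = k y] has the shape that [even_odd_split] requires. The sign [s1] makes
   [A (0, 0)] positive, so that [sqrt A] is smooth. *)
set (k := fun t => t * (s1 * c (t ^ 2))).
set (P := fun p => k (G p)).
assert (Sk : germ1 k) by (apply smooth2_mult; [apply smooth2_fst|exact Scq]).
assert (SP : smooth2 P) by (now apply smooth2_comp1).
destruct (even_odd_split P (fun t => s1 * c t) SP Sc') as [A [b [SA [Sb [EP Ebc]]]]].
{ revert EG; apply near0_1_imp; unfold P, k; now intros y ->. }
assert (SGx : germ1 (fun x => G (x, 0))) by (now apply germ1_fst).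
(* On [y = 0] the splitting reads [x * A (x, 0) = k (G (x, 0))] with [G (x, 0) = x * g x];
   cancelling [x] gives the value of [A]. *)
assert (EA : near0_1 (fun x => A (x, 0) = s1 * g x * c (G (x, 0) ^ 2))).
{ apply near0_1_cancel.
  - now apply germ1_fst.
  - apply smooth2_mult; [apply smooth2_mult; [apply smooth2_const|auto]|].
    apply (germ1_comp c (fun x => G (x, 0) ^ 2)); [rewrite G0; ring|auto|now apply smooth2_pow].
  - generalize (near0_1_and _ _ (near0_1_fst _ EP) Eg); apply near0_1_imp.
    intros x [Q1 Q2]; cbn [fst snd] in Q1; rewrite Rmult_0_l, Rplus_0_r in Q1.
    replace (0 ^ 2) with 0 in Q1 by ring; rewrite <- Q1; unfold P, k; rewrite Q2; ring. }
assert (A0 : 0 < A (0, 0)).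
{ rewrite (near0_1_0 _ EA); apply Rmult_lt_0_compat; auto. }
assert (bc0 : b (0, 0) <> 0).
{ rewrite (near0_1_0 _ Ebc); specialize (c0 0); intros Z.
  assert (s1 * (s1 * c 0) = 0) by (rewrite Z; ring); nra. }
assert (q0 : 0 ^ 2 = 0) by ring.
assert (Sx2 : smooth2 (fun p => fst p ^ 2)) by (apply smooth2_pow, smooth2_fst).
assert (Sy2 : smooth2 (fun p => snd p ^ 2)) by (apply smooth2_pow, smooth2_snd).
assert (SA1 : smooth2 (fun p => A (fst p, snd p ^ 2))) by (apply smooth2_comp; auto; apply smooth2_fst).
assert (Sb1 : smooth2 (fun p => b (fst p, snd p ^ 2))) by (apply smooth2_comp; auto; apply smooth2_fst).
assert (SA2 : smooth2 (fun p => A (fst p ^ 2, snd p))) by (apply smooth2_comp; auto; apply smooth2_snd).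
assert (Sb2 : smooth2 (fun p => b (fst p ^ 2, snd p))) by (apply smooth2_comp; auto; apply smooth2_snd).
set (K := fun p => (fst p * A p, snd p * b p ^ 2)).
set (H1 := fun p => (fst p * A (fst p, snd p ^ 2), snd p * b (fst p, snd p ^ 2))).
(* The lift of [K] to the second fold is determined only up to the sign of the first component. The
   choice [ep] makes it match the sign of the slope of [s] in [Esc]. *)
set (H2 := fun p => (fst p * (ep * sqrt (A (fst p ^ 2, snd p))), snd p * b (fst p ^ 2, snd p) ^ 2)).
assert (ep0 : ep <> 0) by (intros Z; rewrite Z in ep1; lra).
assert (DK : diffeo2 K).
{ apply diffeo2_diag; auto; [now apply smooth2_pow|lra|now apply pow_nonzero]. }
assert (DH1 : diffeo2 H1).
{ apply (diffeo2_diag (fun p => A (fst p, snd p ^ 2)) (fun p => b (fst p, snd p ^ 2))); auto;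
    cbn [fst snd]; rewrite q0; auto; lra. }
assert (DH2 : diffeo2 H2).
{ apply (diffeo2_diag (fun p => ep * sqrt (A (fst p ^ 2, snd p))) (fun p => b (fst p ^ 2, snd p) ^ 2)).
  - apply smooth2_mult; [apply smooth2_const|].
    apply (smooth2_sqrt (fun p => A (fst p ^ 2, snd p))); auto; cbn [fst snd]; now rewrite q0.
  - now apply smooth2_pow.
  - cbn [fst snd]; rewrite q0; apply Rmult_integral_contrapositive; split; auto.
    apply Rgt_not_eq, sqrt_lt_R0, A0.
  - cbn [fst snd]; rewrite q0; now apply pow_nonzero. }
assert (NA2 : near0_2 (fun p => 0 < A (fst p ^ 2, snd p))).
{ apply (smooth2_gt0 (fun p => A (fst p ^ 2, snd p))); auto; cbn [fst snd]; now rewrite q0. }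
assert (Nb2 : near0_2 (fun p => b (fst p ^ 2, snd p) <> 0)).
{ apply (smooth2_ne0 (fun p => b (fst p ^ 2, snd p))); auto; cbn [fst snd]; now rewrite q0. }
(* [Q] is the action of [H2] on the axis [x = 0], since [b (0, Y) ^ 2 = c Y ^ 2]. Thus [h2 = Q o bi]
   is the only choice compatible with [theta (0, y) = 0]. *)
set (Q := fun t => t * c t ^ 2).
set (h1 := fun t => k (psi t)); set (h2 := fun t => Q (bi t)).
assert (Dh1 : diffeo1 h1).
{ apply (diffeo1_comp psi k).
  - apply (diffeo1_intro psi (fun t => F1 (0, t))); auto; now apply germ1_snd.
  - apply (diffeo1_id_mult (fun t => s1 * c (t ^ 2))); auto; rewrite q0; specialize (c0 0); nra. }
assert (Dh2 : diffeo1 h2).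
{ apply (diffeo1_comp bi Q).
  - apply (diffeo1_intro bi (fun t => F2 (0, t))); auto; now apply germ1_snd.
  - apply (diffeo1_id_mult (fun t => c t ^ 2)); [now apply smooth2_pow|].
    apply pow_nonzero; specialize (c0 0); lra. }
destruct (diffeo2_inv H2 DH2) as [I2 [DI2 [EI1 EI2]]].
pose proof (diffeo2_mgerm _ DI2) as MI2; pose proof (diffeo2_mgerm _ DH2) as MH2.
pose proof MI2 as [[SI21 SI22] I20].
exists (fun p => h2 (F2 (I2 p)) - fst p - snd p).
split; [|split].
- split.
  + apply smooth2_minus; [apply smooth2_minus|]; [|apply smooth2_fst|apply smooth2_snd].
    apply (smooth2_comp1 h2 (fun p => F2 (I2 p))).
    * rewrite I20; exact F20.
    * apply smooth1_smooth2, Dh2.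
    * now apply smooth2_compF.
  + rewrite I20, F20; cbn [fst snd]; unfold h2; rewrite bi0; unfold Q; ring.
- generalize (near0_2_pullF _ I2 MI2 NA2) (near0_2_pullF _ I2 MI2 Nb2); intros NA3 Nb3.
  (* Here the functional equation enters: if [I2 (x, 0) = (u, 0)] and [y = bi (F2 (u, 0))], then
     [s y = u], and [Esc] turns [Q y] into [ep * u * sqrt (A (u ^ 2, 0)) = x]. *)
  assert (X1 : near0_1 (fun x => h2 (F2 (I2 (x, 0))) = x)).
  { assert (Su : germ1 (fun x => fst (I2 (x, 0)))) by (now apply (germ1_fst (fun p => fst (I2 p)))).
    assert (u0 : fst (I2 (0, 0)) = 0) by (now rewrite I20).
    assert (Su2 : germ1 (fun x => fst (I2 (x, 0)) ^ 2)) by (now apply smooth2_pow).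
    assert (u20 : fst (I2 (0, 0)) ^ 2 = 0) by (rewrite u0; ring).
    pose proof (near0_1_pull _ _ Su u0 Es') as Y1.
    pose proof (near0_1_pull _ _ Su u0 (near0_1_pull _ _ Sx x0 Esc)) as Y2.
    pose proof (near0_1_pull _ _ Su2 u20 EA) as Y3.
    generalize (near0_1_and _ _ (near0_1_and _ _ Y1 Y2) (near0_1_and _ _ Y3
      (near0_1_and _ _ (near0_1_fst _ EI2) (near0_1_fst _ Nb3)))).
    apply near0_1_imp; cbn beta; intros x [[E1 E2] [E3 [E4 E5]]].
    unfold H2 in E4; destruct (I2 (x, 0)) as [u v]; cbn [fst snd] in *.
    assert (E6 := f_equal fst E4); assert (E7 := f_equal snd E4); cbn [fst snd] in E6, E7.
    assert (v0 : v = 0).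
    { apply Rmult_integral in E7; destruct E7 as [|E7]; auto.
      now apply (pow_nonzero _ 2) in E5. }
    subst v; unfold h2, Q; rewrite E2, E1.
    rewrite <- E6, E3; ring. }
  assert (X2 : near0_1 (fun y => h2 (F2 (I2 (0, y))) = y)).
  { assert (Su : germ1 (fun y => snd (I2 (0, y)))) by (now apply (germ1_snd (fun p => snd (I2 p)))).
    assert (u0 : snd (I2 (0, 0)) = 0) by (now rewrite I20).
    pose proof (near0_1_pull _ _ Su u0 Eb1) as Y1.
    pose proof (near0_1_pull _ _ Su u0 Ebc) as Y2.
    generalize (near0_1_and _ _ (near0_1_and _ _ Y1 Y2)
      (near0_1_and _ _ (near0_1_snd _ EI2) (near0_1_snd _ NA3))).
    apply near0_1_imp; cbn beta; intros y [[E1 E2] [E4 E5]].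
    unfold H2 in E4; destruct (I2 (0, y)) as [u v]; cbn [fst snd] in *.
    assert (E6 := f_equal fst E4); assert (E7 := f_equal snd E4); cbn [fst snd] in E6, E7.
    assert (u00 : u = 0).
    { apply Rmult_integral in E6; destruct E6 as [|E6]; auto.
      apply Rmult_integral in E6; destruct E6 as [E6|E6]; [tauto|].
      pose proof (sqrt_lt_R0 _ E5); lra. }
    subst u; unfold h2, Q; rewrite E1.
    rewrite <- E7, q0, E2.
    replace ((s1 * c v) ^ 2) with (s1 * s1 * c v ^ 2) by ring; rewrite s11; ring. }
  generalize (near0_2_and _ _ (near0_2_fst _ X1) (near0_2_snd _ X2)); apply near0_2_imp.
  intros [x y]; cbn [fst snd]; intros [-> ->]; split; ring.
- exists h1, h2, H1, H2, K.
  do 5 (split; [assumption|]); split; [exact EP|repeat apply conj].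
  + revert EI1; apply near0_2_imp; intros p E; cbn beta; rewrite E; ring.
  + apply near0_2_true; intros p; unfold K, H1; cbn [fst snd]; f_equal; ring.
  + revert NA2; apply near0_2_imp; intros p E; unfold K, H2; cbn [fst snd]; f_equal.
    rewrite !Rpow_mult_distr, pow2_sqrt by lra.
    replace (ep ^ 2) with (ep * ep) by ring; rewrite ep1; ring.
Qed.

(** * Reduction to standard folds *)

(** Taking Jacobians gives [jac Psi (g) * jac g = 2 * Phi_2 * jac Phi]. Both [jac g] and [Phi_2]
    vanish at 0, so differentiating there makes their gradients proportional, with factor
    [u = 2 * jac Phi / jac Psi]; the singular set has the tangent of [Phi_2 = 0]. *)
Lemma fold_tangent g Phi Psi : mgerm g -> diffeo2 Phi -> diffeo2 Psi ->
  near0_2 (fun p => Psi (g p) = fold_nf (Phi p)) ->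
  exists u, u <> 0 /\ fst (sing_tangent g) = - (u * d2 (comp2 Phi) (0, 0)) /\
    snd (sing_tangent g) = u * d1 (comp2 Phi) (0, 0).
Proof.
intros Mg DPhi DPsi E.
pose proof (diffeo2_mgerm _ DPhi) as MPhi; pose proof (diffeo2_mgerm _ DPsi) as MPsi.
pose proof (diffeo2_jac _ DPhi) as JPhi; pose proof (diffeo2_jac _ DPsi) as JPsi.
assert (SJ : forall F, mgerm F -> smooth2 (jac_det F)).
{ intros F [[S1 S2] _]; apply smooth2_d in S1, S2; destruct S1 as [S11 [S12 _]], S2 as [S21 [S22 _]].
  apply smooth2_minus; apply smooth2_mult; auto. }
assert (Mf : mgerm fold_nf).
{ split; [split; [apply smooth2_fst|apply smooth2_pow, smooth2_snd]|]; unfold fold_nf; cbn; f_equal; ring. }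
assert (Jf : forall p, jac_det fold_nf p = 2 * snd p).
{ intros p; unfold jac_det, comp1, comp2, fold_nf; cbn [fst snd].
  destruct (d_fst p) as [-> ->].
  assert (X : d2 (fun q => snd q ^ 2) p = 2 * snd p).
  { apply is_derive_unique; cbn [fst snd]; auto_derive; trivial; ring. }
  rewrite X; ring. }
assert (EJ : near0_2 (fun p => jac_det Psi (g p) * jac_det g p = 2 * (comp2 Phi p * jac_det Phi p))).
{ generalize (near0_2_and _ _ (jac_ext _ _ E)
    (near0_2_and _ _ (jac_comp g Psi Mg MPsi) (jac_comp Phi fold_nf MPhi Mf))).
  apply near0_2_imp; intros p [Q1 [Q2 Q3]]; rewrite <- Q2, Q1, Q3, Jf; unfold comp2; ring. }
destruct MPsi as [SPsi Psi0]; destruct Mg as [Sg g0]; destruct MPhi as [SPhi Phi0].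
assert (c0 : comp2 Phi (0, 0) = 0) by (unfold comp2; now rewrite Phi0).
assert (jg0 : jac_det g (0, 0) = 0).
{ pose proof (near0_2_0 _ EJ) as Q; cbn beta in Q; rewrite c0, g0 in Q.
  apply (Rmult_eq_reg_l (jac_det Psi (0, 0))); auto; lra. }
assert (SJg := SJ g (conj Sg g0)); assert (SJPhi := SJ Phi (conj SPhi Phi0)).
assert (SJPsi := smooth2_compF _ g (conj Sg g0) (SJ Psi (conj SPsi Psi0))).
destruct (near0_2_0 _ (near0_d_ext _ _ EJ)) as [E1 E2].
destruct (d_mult0 _ _ SJPsi SJg) as [A1 A2].
assert (Sprod : smooth2 (fun p => comp2 Phi p * jac_det Phi p)) by (apply smooth2_mult; auto; apply SPhi).
destruct (d_mult0 _ _ (smooth2_const 2) Sprod) as [B1 B2].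
destruct (d_mult0 (comp2 Phi) _ (proj2 SPhi) SJPhi) as [C1 C2].
rewrite A1, B1, C1, jg0, c0, g0 in E1; rewrite A2, B2, C2, jg0, c0, g0 in E2.
replace (d1 (fun _ => 2) (0, 0)) with 0 in E1 by (symmetry; apply (Derive_const 2)).
replace (d2 (fun _ => 2) (0, 0)) with 0 in E2 by (symmetry; apply (Derive_const 2)).
exists (2 * jac_det Phi (0, 0) / jac_det Psi (0, 0)); split; [|split].
- unfold Rdiv; apply Rmult_integral_contrapositive; split; [lra|now apply Rinv_neq_0_compat].
- unfold sing_tangent; cbn [fst]; apply (Rmult_eq_reg_l (jac_det Psi (0, 0))); auto.
  replace (jac_det Psi (0, 0) * - d2 (jac_det g) (0, 0)) with
    (- (0 * d2 (fun p => jac_det Psi (g p)) (0, 0) + jac_det Psi (0, 0) * d2 (jac_det g) (0, 0))) by ring.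
  rewrite (Rmult_comm 0), E2; field; auto.
- unfold sing_tangent; cbn [snd]; apply (Rmult_eq_reg_l (jac_det Psi (0, 0))); auto.
  replace (jac_det Psi (0, 0) * d1 (jac_det g) (0, 0)) with
    (d1 (fun p => jac_det Psi (g p)) (0, 0) * 0 + jac_det Psi (0, 0) * d1 (jac_det g) (0, 0)) by ring.
  rewrite E1; field; auto.
Qed.

(** The differential of [chi] at 0 applied to [w]. *)
Definition pairing (chi : R * R -> R) (w : R * R) : R :=
  d1 chi (0, 0) * fst w + d2 chi (0, 0) * snd w.

(** [Psi_2 o g = Phi_2 ^ 2] is critical at 0, so the differential of [Psi_2] kills the whole image
    of [dg (0)], which contains the discriminant tangent. *)
Lemma disc_tangent_ker g Phi Psi : mgerm g -> diffeo2 Phi -> diffeo2 Psi ->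
  near0_2 (fun p => Psi (g p) = fold_nf (Phi p)) ->
  d1 (fun p => comp2 Psi (g p)) (0, 0) = 0 /\ d2 (fun p => comp2 Psi (g p)) (0, 0) = 0 /\
  pairing (comp2 Psi) (disc_tangent g) = 0.
Proof.
intros Mg [[_ SPhi] [Phi0 _]] [[_ SPsi] _] E.
assert (Es : near0_2 (fun p => comp2 Psi (g p) = comp2 Phi p * comp2 Phi p)).
{ revert E; apply near0_2_imp; intros p Q; unfold comp2; rewrite Q; unfold fold_nf; cbn [snd]; ring. }
assert (c0 : comp2 Phi (0, 0) = 0) by (unfold comp2; now rewrite Phi0).
destruct (near0_2_0 _ (near0_d_ext _ _ Es)) as [E1 E2].
destruct (d_mult0 (comp2 Phi) (comp2 Phi) SPhi SPhi) as [M1 M2].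
rewrite M1, c0 in E1; rewrite M2, c0 in E2.
destruct (near0_2_0 _ (near0_d_compF (comp2 Psi) g Mg SPsi)) as [A1 A2].
destruct Mg as [_ g0]; rewrite g0 in A1, A2.
split; [rewrite E1; ring|split; [rewrite E2; ring|]].
unfold pairing, disc_tangent; cbn [fst snd].
replace (_ + _) with ((d1 (comp2 Psi) (0, 0) * d1 (comp1 g) (0, 0) + d2 (comp2 Psi) (0, 0) * d1 (comp2 g) (0, 0))
    * fst (sing_tangent g) + (d1 (comp2 Psi) (0, 0) * d2 (comp1 g) (0, 0) +
    d2 (comp2 Psi) (0, 0) * d2 (comp2 g) (0, 0)) * snd (sing_tangent g)) by ring.
rewrite <- A1, <- A2, E1, E2; ring.
Qed.

Lemma det_ne0_ker a b c d x y : a * d - b * c <> 0 -> a * x + b * y = 0 -> c * x + d * y = 0 ->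
  x = 0 /\ y = 0.
Proof.
intros N E1 E2; split; apply (Rmult_eq_reg_l (a * d - b * c)); auto.
- replace ((a * d - b * c) * x) with (d * (a * x + b * y) - b * (c * x + d * y)) by ring.
  rewrite E1, E2; ring.
- replace ((a * d - b * c) * y) with (a * (c * x + d * y) - c * (a * x + b * y)) by ring.
  rewrite E1, E2; ring.
Qed.

Lemma diffeo2_comp2_grad Psi : diffeo2 Psi ->
  ~ (d1 (comp2 Psi) (0, 0) = 0 /\ d2 (comp2 Psi) (0, 0) = 0).
Proof. intros D [Z1 Z2]; apply (diffeo2_jac _ D); unfold jac_det; rewrite Z1, Z2; ring. Qed.

(** If the two gradients were dependent, then, as [d chi] does not kill [w] and [d Psi_2] does,
    [d Psi_2] would be zero, which a diffeomorphism excludes. *)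
Lemma jac_pair_ne chi Psi w : diffeo2 Psi -> pairing chi w <> 0 -> pairing (comp2 Psi) w = 0 ->
  d1 chi (0, 0) * d2 (comp2 Psi) (0, 0) - d2 chi (0, 0) * d1 (comp2 Psi) (0, 0) <> 0.
Proof.
intros DPsi N Z J; apply (diffeo2_comp2_grad Psi DPsi); unfold pairing in *.
set (a := d1 chi (0, 0)) in *; set (b := d2 chi (0, 0)) in *.
set (c := d1 (comp2 Psi) (0, 0)) in *; set (d := d2 (comp2 Psi) (0, 0)) in *.
destruct w as [x y]; cbn [fst snd] in *.
split; apply (Rmult_eq_reg_l (a * x + b * y)); auto; rewrite Rmult_0_r.
- replace ((a * x + b * y) * c) with (a * (c * x + d * y) - y * (a * d - b * c)) by ring.
  rewrite Z, J; ring.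
- replace ((a * x + b * y) * d) with (b * (c * x + d * y) + x * (a * d - b * c)) by ring.
  rewrite Z, J; ring.
Qed.

(** [chi] is a free first coordinate in the target, later taken to be the equation of the other
    discriminant. In the source chart [(chi o g, Phi_2)] the singular set is the first axis, so
    [restr_regular] says [d1 F <> 0]. The second axis is tangent to the kernel of [dg (0)], so
    [pair_regular] gives [d2 F <> 0]. *)
Lemma fold_coordinates f g Phi Psi chi : fgerm f -> mgerm g -> diffeo2 Phi -> diffeo2 Psi ->
  near0_2 (fun p => Psi (g p) = fold_nf (Phi p)) ->
  smooth2 chi -> chi (0, 0) = 0 -> pairing chi (disc_tangent g) <> 0 ->
  restr_regular f g -> pair_regular f g ->
  exists F, fgerm F /\ d1 F (0, 0) <> 0 /\ d2 F (0, 0) <> 0 /\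
    diffeo2 (fun p => (chi (g p), comp2 Phi p)) /\
    near0_2 (fun p => f p = F (chi (g p), comp2 Phi p)).
Proof.
intros [Sf f0] Mg DPhi DPsi E Schi chi0 Nchi RR PR.
set (H := fun p => (chi (g p), comp2 Phi p)).
destruct (fold_tangent g Phi Psi Mg DPhi DPsi E) as [u [u0 [T1 T2]]].
destruct (disc_tangent_ker g Phi Psi Mg DPhi DPsi E) as [P1 [P2 PZ]].
pose proof (jac_pair_ne chi Psi _ DPsi Nchi PZ) as JK.
destruct (near0_2_0 _ (near0_d_compF chi g Mg Schi)) as [X1 X2].
destruct (near0_2_0 _ (near0_d_compF (comp2 Psi) g Mg (proj2 (proj1 DPsi)))) as [Y1 Y2].
pose proof (diffeo2_mgerm _ DPhi) as [[_ SPhi] Phi0]; pose proof Mg as [Sg g0].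
rewrite g0 in X1, X2, Y1, Y2; rewrite P1 in Y1; rewrite P2 in Y2.
assert (MH : mgerm H).
{ split; [split; [exact (smooth2_compF chi g Mg Schi)|exact SPhi]|].
  unfold H, comp2; now rewrite g0, Phi0, chi0. }
assert (PV : d1 (comp1 H) (0, 0) * fst (sing_tangent g) + d2 (comp1 H) (0, 0) * snd (sing_tangent g)
  = pairing chi (disc_tangent g)).
{ change (comp1 H) with (fun p => chi (g p)); rewrite X1, X2.
  unfold pairing, disc_tangent; cbn [fst snd]; ring. }
assert (JH : jac_det H (0, 0) <> 0).
{ intros Z; apply Nchi; rewrite <- PV, T1, T2; unfold jac_det in Z.
  change (comp2 H) with (comp2 Phi) in Z.
  replace (_ + _) with (- u * (d1 (comp1 H) (0, 0) * d2 (comp2 Phi) (0, 0)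
    - d2 (comp1 H) (0, 0) * d1 (comp2 Phi) (0, 0))) by ring.
  rewrite Z; ring. }
assert (DH : diffeo2 H) by (now apply inverse_function).
destruct (diffeo2_inv H DH) as [I [DI [E1 E2]]].
pose proof (diffeo2_mgerm _ DI) as MI.
assert (SF : smooth2 (fun p => f (I p))) by (now apply smooth2_compF).
assert (EF : near0_2 (fun p => f p = f (I (H p)))).
{ revert E1; apply near0_2_imp; now intros p ->. }
destruct (near0_2_0 _ (near0_d_ext _ _ EF)) as [F1 F2].
destruct (near0_2_0 _ (near0_d_compF (fun p => f (I p)) H MH SF)) as [G1 G2].
rewrite G1 in F1; rewrite G2 in F2; destruct MH as [_ H0]; rewrite H0 in F1, F2.
change (comp2 H) with (comp2 Phi) in F1, F2.
exists (fun p => f (I p)); split; [split; auto; destruct MI as [_ ->]; auto|].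
split; [|split; [|split; auto]].
- intros Z; apply RR; rewrite F1, F2, Z, T1, T2; ring.
- intros Z.
  (* The vector [(a1, a2)] is killed by [d (chi o g)], and by [d (Psi_2 o g) = 0]. Since [chi] and
     [Psi_2] have independent differentials, it is killed by [dg]; if [d2 F] vanished it would be
     killed by [df] too, hence be zero, against the invertibility of [dH]. *)
  assert (Q : - d2 (comp1 H) (0, 0) = 0 /\ d1 (comp1 H) (0, 0) = 0).
  { set (a1 := - d2 (comp1 H) (0, 0)); set (a2 := d1 (comp1 H) (0, 0)).
    assert (K0 : a1 * d1 (comp1 H) (0, 0) + a2 * d2 (comp1 H) (0, 0) = 0) by (unfold a1, a2; ring).
    destruct (det_ne0_ker _ _ _ _
      (a1 * d1 (comp1 g) (0, 0) + a2 * d2 (comp1 g) (0, 0))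
      (a1 * d1 (comp2 g) (0, 0) + a2 * d2 (comp2 g) (0, 0)) JK) as [K1 K2].
    - change (comp1 H) with (fun p => chi (g p)) in K0; rewrite X1, X2 in K0.
      eapply eq_trans; [|exact K0]; ring.
    - transitivity (
        a1 * (d1 (comp2 Psi) (0, 0) * d1 (comp1 g) (0, 0) + d2 (comp2 Psi) (0, 0) * d1 (comp2 g) (0, 0)) +
        a2 * (d1 (comp2 Psi) (0, 0) * d2 (comp1 g) (0, 0) + d2 (comp2 Psi) (0, 0) * d2 (comp2 g) (0, 0)));
        [|rewrite <- Y1, <- Y2]; ring.
    - apply PR; auto; rewrite F1, F2, Z, !Rmult_0_l, !Rplus_0_r.
      replace (_ + _) with (d1 (fun p => f (I p)) (0, 0) *
        (a1 * d1 (comp1 H) (0, 0) + a2 * d2 (comp1 H) (0, 0))) by ring.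
      rewrite K0; ring. }
  apply JH; destruct Q as [Q1 Q2]; unfold jac_det; rewrite Q2.
  replace (d2 (comp1 H) (0, 0)) with 0 by lra; ring.
Qed.

Theorem theoremA :
  forall (f1 : R * R -> R) (g1 : R * R -> R * R)
         (f2 : R * R -> R) (g2 : R * R -> R * R),
    fgerm f1 -> mgerm g1 -> fgerm f2 -> mgerm g2 ->
    type_III_III f1 g1 f2 g2 ->
    exists theta : R * R -> R,
      fgerm theta /\
      near0_2 (fun p => theta (fst p, 0) = 0 /\ theta (0, snd p) = 0) /\
      diagram_equiv f1 g1 f2 g2
        (fun p => fst p + snd p) (fun p => (fst p, snd p ^ 2))
        (fun p => fst p + snd p + theta p) (fun p => (fst p ^ 2, snd p)).
Proof.
intros f1 g1 f2 g2 Mf1 Mg1 Mf2 Mg2 [[_ [Fold1 [RR1 PR1]]] [[_ [Fold2 [RR2 PR2]]] TD]].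
destruct Fold1 as [Phi1 [Psi1 [DPhi1 [DPsi1 E1]]]], Fold2 as [Phi2 [Psi2 [DPhi2 [DPsi2 E2]]]].
destruct (disc_tangent_ker g1 Phi1 Psi1 Mg1 DPhi1 DPsi1 E1) as [_ [_ Z1]].
destruct (disc_tangent_ker g2 Phi2 Psi2 Mg2 DPhi2 DPsi2 E2) as [_ [_ Z2]].
unfold transversal_disc in TD.
set (w1 := disc_tangent g1) in *; set (w2 := disc_tangent g2) in *.
(* The differential of the second equation kills [w2]; if it killed [w1] as well, it would vanish,
   because [w1] and [w2] form a basis by transversality. *)
assert (N21 : pairing (comp2 Psi2) w1 <> 0).
{ intros N; apply (diffeo2_comp2_grad _ DPsi2); unfold pairing in N, Z2.
  apply (det_ne0_ker _ _ _ _ _ _ TD); lra. }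
assert (N12 : pairing (comp2 Psi1) w2 <> 0).
{ intros N; apply (diffeo2_comp2_grad _ DPsi1); unfold pairing in N, Z1.
  apply (det_ne0_ker _ _ _ _ _ _ TD); lra. }
pose proof (diffeo2_mgerm _ DPsi1) as [[_ SPsi1] Psi10].
pose proof (diffeo2_mgerm _ DPsi2) as [[_ SPsi2] Psi20].
assert (c1 : comp2 Psi1 (0, 0) = 0) by (unfold comp2; now rewrite Psi10).
assert (c2 : comp2 Psi2 (0, 0) = 0) by (unfold comp2; now rewrite Psi20).
destruct (fold_coordinates f1 g1 Phi1 Psi1 (comp2 Psi2)) as [F1 [MF1 [F1x [F1y [DH1 EF1]]]]]; auto.
destruct (fold_coordinates f2 g2 Phi2 Psi2 (comp2 Psi1)) as [F2 [MF2 [F2x [F2y [DH2 EF2]]]]]; auto.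
(* [comp2 Psi1] and [comp2 Psi2] are equations of the two discriminant curves. *)
set (K0 := fun p => (comp2 Psi2 p, comp2 Psi1 p)).
set (H1 := fun p => (comp2 Psi2 (g1 p), comp2 Phi1 p)) in *.
set (H2 := fun p => (comp2 Phi2 p, comp2 Psi1 (g2 p))).
assert (DK0 : diffeo2 K0).
{ apply inverse_function; [split; [split; auto|unfold K0; now rewrite c1, c2]|].
  exact (jac_pair_ne _ _ w1 DPsi1 N21 Z1). }
(* The normal form of the second fold squares the first coordinate, so the chart from
   [fold_coordinates], whose second coordinate is the squared one, is exchanged; [F2] is exchanged
   accordingly. *)
assert (DH2' : diffeo2 H2) by exact (diffeo2_comp _ _ DH2 diffeo2_swap).
assert (MF2' : fgerm (fun p => F2 (snd p, fst p))).
{ destruct MF2 as [SF2 F20]; split; [|exact F20].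
  apply (smooth2_compF F2 (fun p => (snd p, fst p))); auto; apply diffeo2_mgerm, diffeo2_swap. }
destruct (fold_pair_normal_form F1 (fun p => F2 (snd p, fst p)) MF1 MF2' F1x F1y F2y F2x)
  as [theta [Mt [Zt [h1 [h2 [L1 [L2 [K [Dh1 [Dh2 [DL1 [DL2 [DK [Q1 [Q2 [Q3 Q4]]]]]]]]]]]]]]]].
pose proof (diffeo2_mgerm _ DH1) as MH1; pose proof (diffeo2_mgerm _ DH2') as MH2.
exists theta; split; [auto|split; [auto|]].
exists h1, h2, (fun p => L1 (H1 p)), (fun p => L2 (H2 p)), (fun p => K (K0 p)).
split; [auto|split; [auto|]].
split; [now apply diffeo2_comp|split; [now apply diffeo2_comp|split; [now apply diffeo2_comp|]]].
repeat apply conj.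
- generalize (near0_2_and _ _ EF1 (near0_2_pullF _ H1 MH1 Q1)); apply near0_2_imp.
  intros p [-> Q]; exact Q.
- generalize (near0_2_and _ _ EF2 (near0_2_pullF _ H2 MH2 Q2)); apply near0_2_imp.
  intros p [-> Q]; exact Q.
- generalize (near0_2_and _ _ E1 (near0_2_pullF _ H1 MH1 Q3)); apply near0_2_imp.
  intros p [E Q]; rewrite <- Q; f_equal; unfold K0, H1; cbn [fst snd]; f_equal.
  unfold comp2 at 1; rewrite E; reflexivity.
- generalize (near0_2_and _ _ E2 (near0_2_pullF _ H2 MH2 Q4)); apply near0_2_imp.
  intros p [E Q]; rewrite <- Q; f_equal; unfold K0, H2; cbn [fst snd]; f_equal.
  unfold comp2 at 1; rewrite E; reflexivity.
Qed.
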